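(* Let $0<\varepsilon<1$. Let $(T_t)_{t\in\mathbb{R}}$ be an ergodic measure-preserving flow with simple spectrum on a standard probability space $(X,\mu)$ such that, for every $a>0$, the weak closure of the flow contains the operator $$(1-\varepsilon)\Theta+\frac{\varepsilon}{a}\int_0^a T_s\,ds .$$ Then: (1) the spectral measure $\sigma$ of $(T_t)$ and the convolution $\sigma\ast\sigma$ are disjoint (mutually singular); (2) the symmetric tensor square $T_t\odot T_t$ has simple spectrum; (3) the flow $T_t\otimes T_t$ has homogeneous spectrum of multiplicity $2$.
   Context: A standard probability space $(X,\mu)$ means a nonatomic standard (Lebesgue) probability space. A flow $(T_t)_{t\in\mathbb{R}}$ is a measurable one-parameter group of invertible $\mu$-preserving transformations of $X$; the same symbol $T_t$ denotes the induced strongly continuous unitary group $T_tf(x)=f(T_tx)$ on $L_2(X,\mu)$ (complex-valued functions). $\Theta$ is the orthogonal projection of $L_2(X,\mu)$ onto the constant functions. The weak closure of the flow is the closure of $\{T_t: t\in\mathbb{R}\}$ in the weak operator topology on bounded operators of $L_2(X,\mu)$. The operator $\int_0^a T_s\,ds$ is understood in the strong (equivalently weak) sense. A unitary representation of $\mathbb{R}$ has simple spectrum if it admits a cyclic vector, i.e. its spectral multiplicity function equals $1$ almost everywhere with respect to the maximal spectral type. The spectral measure $\sigma$ of the flow is a finite Borel measure on $\mathbb{R}$ representing the maximal spectral type of $(T_t)$ restricted to the orthogonal complement of the constants in $L_2(X,\mu)$. Two measures are disjoint if they are mutually singular. $T_t\otimes T_t$ is the product flow $(x,y)\mapsto (T_tx,T_ty)$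 on $(X\times X,\mu\otimes\mu)$, whose induced unitary group acts on $L_2(X\times X,\mu\otimes\mu)=L_2(X,\mu)\otimes L_2(X,\mu)$. The symmetric tensor square $T_t\odot T_t$ is the restriction of this unitary group to the invariant subspace of symmetric functions, $f(x,y)=f(y,x)$. A flow has homogeneous spectrum of multiplicity $2$ if the induced unitary group, restricted to the orthogonal complement of the constant functions, has spectral multiplicity function equal to $2$ almost everywhere with respect to its maximal spectral type (equivalently, it is unitarily equivalent to the direct sum of two copies of a unitary group with simple spectrum). *)

(* Defs.v *)
(* Elements of the complex L_2 are handled through representatives: a "vector"
   is a function [Y -> R[i]] in [L2 mu], and every notion below only depends on
   its class modulo equality almost everywhere. *)
From HB Require Import structures.
From mathcomp Require Import all_boot all_order all_algebra.
From mathcomp Require Import all_classical all_reals all_analysis.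
From mathcomp Require Import measurable_realfun complex.

Set Implicit Arguments.
Unset Strict Implicit.
Unset Printing Implicit Defensive.

Import Order.TTheory GRing.Theory Num.Theory.
Import numFieldNormedType.Exports.

Local Open Scope classical_set_scope.
Local Open Scope ring_scope.

Section ComplexL2.
Context d (Y : measurableType d) (R : realType).
Variable mu : {measure set Y -> \bar R}.
Implicit Types f g : Y -> R[i].

Definition cintegral (D : set Y) f : R[i] :=
  Complex (\int[mu]_(x in D) complex.Re (f x))
          (\int[mu]_(x in D) complex.Im (f x)).

Definition L2 : set (Y -> R[i]) :=
  [set f | (fun x => complex.Re (f x)) \in Lfun mu 2%:E /\
           (fun x => complex.Im (f x)) \in Lfun mu 2%:E].

Definition inner f g : R[i] := cintegral setT (fun x => f x * (g x)^*).

Definition sqnorm f : R := complex.Re (inner f f).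

Definition closed_span (S : set (Y -> R[i])) : set (Y -> R[i]) :=
  [set f | forall delta : R, 0 < delta ->
     exists n (c : 'I_n -> R[i]) (s : 'I_n -> (Y -> R[i])),
       (forall i, S (s i)) /\
       sqnorm (fun x => f x - \sum_(i < n) c i * s i x) < delta].

Definition bounded_operator (A : (Y -> R[i]) -> (Y -> R[i])) : Prop :=
  [/\ forall f, L2 f -> L2 (A f),
      forall (c : R[i]) f g, L2 f -> L2 g ->
        {ae mu, forall x, A (fun y => c * f y + g y) x = c * A f x + A g x}
    & exists M : R, forall f, L2 f -> sqnorm (A f) <= M * sqnorm f].

(* Closure of [{U t | t : R}] in the weak operator topology. *)
Definition weak_closure (U : R -> (Y -> R[i]) -> (Y -> R[i])) :
    set ((Y -> R[i]) -> (Y -> R[i])) :=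
  [set A | bounded_operator A /\
     forall n (f g : 'I_n -> (Y -> R[i])) (delta : R),
       (forall i, L2 (f i)) -> (forall i, L2 (g i)) -> 0 < delta ->
       exists t : R, forall i,
         `| inner (U t (f i)) (g i) - inner (A (f i)) (g i) | < delta%:C%C].

Definition orth_constants : set (Y -> R[i]) :=
  [set f | L2 f /\ inner f (cst 1) = 0].

(* The projection onto the constants when [mu] is a probability. *)
Definition Theta f : Y -> R[i] := cst (inner f (cst 1)).

End ComplexL2.

Section Spectrum.
Context d (Y : measurableType d) (R : realType).
Variable mu : {measure set Y -> \bar R}.
(* [U] is a unitary group and [H] a closed [U]-invariant subspace of [L2 mu];
   the notions below are those of the restriction of [U] to [H]. *)
Variables (U : R -> (Y -> R[i]) -> (Y -> R[i])) (H : set (Y -> R[i])).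

Definition orbit_of (v : Y -> R[i]) : set (Y -> R[i]) := range (fun t => U t v).

Definition simple_spectrum : Prop :=
  exists2 v, H v & H `<=` closed_span mu (orbit_of v).

Definition fourier (s : {finite_measure set (measurableTypeR R) -> \bar R})
    (D : set (measurableTypeR R)) (t : R) : R[i] :=
  cintegral s D (fun x => Complex (cos (t * x)) (sin (t * x))).

Definition spectral_measure_of (v : Y -> R[i])
    (s : {finite_measure set (measurableTypeR R) -> \bar R}) : Prop :=
  forall t, inner mu (U t v) v = fourier s setT t.

Definition maximal_spectral_type
    (s : {finite_measure set (measurableTypeR R) -> \bar R}) : Prop :=
  (forall v s', H v -> spectral_measure_of v s' -> s' `<< s) /\
  (exists v s', [/\ H v, spectral_measure_of v s' & s `<< s']).

(* Spectral multiplicity function with respect to [s] (the value [None] stands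
   for infinite multiplicity), through the Hahn-Hellinger decomposition: [H] is
   the orthogonal sum of cyclic subspaces generated by [v 0, v 1, ...], where
   the spectral measure of [v n] is the restriction of [s] to [{m > n}].
   Equivalently, [U] on [H] is multiplication by [exp(itx)] on the direct
   integral over [s] of Hilbert spaces of dimension [m x]. *)
Definition mult_gt (m : R -> option nat) (n : nat) : set (measurableTypeR R) :=
  [set x | if m x is Some k then (n < k)%N else true].

Definition spectral_multiplicity
    (s : {finite_measure set (measurableTypeR R) -> \bar R})
    (m : R -> option nat) : Prop :=
  (forall n, measurable (mult_gt m n)) /\
  exists v : nat -> (Y -> R[i]),
    [/\ forall n, H (v n),
        forall n t, inner mu (U t (v n)) (v n) = fourier s (mult_gt m n) t,
        forall n k t u, n <> k -> inner mu (U t (v n)) (U u (v k)) = 0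
      & H `<=` closed_span mu (\bigcup_n orbit_of (v n))].

Definition homogeneous_spectrum (k : nat) : Prop :=
  exists s m, [/\ maximal_spectral_type s, spectral_multiplicity s m
    & {ae s, forall x, m x = Some k}].

End Spectrum.

Section Measures.
Context (R : realType).
Implicit Types s : {finite_measure set (measurableTypeR R) -> \bar R}.

Definition mutually_singular (s1 s2 : set (measurableTypeR R) -> \bar R) : Prop :=
  exists A, [/\ measurable A, s1 A = 0%E & s2 (~` A) = 0%E].

Definition convolution s1 s2 : set (measurableTypeR R) -> \bar R :=
  pushforward (s1 \x s2)%E (fun p => p.1 + p.2 : measurableTypeR R).

End Measures.

Section Flows.
Context d (X : measurableType d) (R : realType) (P : probability X R).

(* The completion of [P] is isomorphic modulo null sets to Lebesgue measure on
   [0, 1].  Since images are only required to be Lebesgue measurable, the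
   sigma-algebra of [X] may be either a standard Borel one or its completion. *)
Definition standard_probability : Prop :=
  exists (phi : X -> measurableTypeR R) (X0 : set X),
    [/\ measurable X0 /\ P X0 = 1%E,
        measurable_fun X0 phi /\ {in X0 &, injective phi},
        phi @` X0 `<=` `[0, 1],
        forall A, measurable A -> A `<=` X0 ->
          completed_algebra_gen (@lebesgue_measure R) (phi @` A)
      & forall B, measurable B ->
          P (X0 `&` phi @^-1` B) = lebesgue_measure (B `&` `[0, 1])].

(* Joint measurability is with respect to the completion of the product. *)
Definition measure_preserving_flow (T : R -> X -> X) : Prop :=
  [/\ T 0 = id /\ (forall s t, T (s + t) = T s \o T t),
      forall t, measurable_fun setT (T t),
      forall t A, measurable A -> P (T t @^-1` A) = P A
    & forall A, measurable A ->
        completed_algebra_gen (@lebesgue_measure R \x P)%E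
          [set p : measurableTypeR R * X | A (T p.1 p.2)]].

Definition ergodic_flow (T : R -> X -> X) : Prop :=
  forall A, measurable A -> (forall t, P (A `+` (T t @^-1` A)) = 0%E) ->
    P A = 0%E \/ P A = 1%E.

Definition koopman (T : R -> X -> X) (t : R) (f : X -> R[i]) : X -> R[i] :=
  f \o T t.

(* [J] is the operator [\int_0^a T_s ds], in the weak sense. *)
Definition flow_integral (T : R -> X -> X) (a : R)
    (J : (X -> R[i]) -> (X -> R[i])) : Prop :=
  bounded_operator P J /\
  forall f g, L2 P f -> L2 P g ->
    inner P (J f) g =
    cintegral (@lebesgue_measure R) `[0, a] (fun s => inner P (koopman T s f) g).

Definition symmetric_L2 : set (X * X -> R[i]) :=
  [set f | L2 (P \x P)%E f /\ {ae (P \x P)%E, forall p, f p = f (p.2, p.1)}].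

Definition product_flow (T : R -> X -> X) (t : R) (p : X * X) : X * X :=
  (T t p.1, T t p.2).

End Flows.

(* Main.v *)
From HB Require Import structures.
Require Import Defs.
From mathcomp Require Import all_boot all_order all_algebra.
From mathcomp Require Import all_classical all_reals all_analysis.
From mathcomp Require Import measurable_realfun complex.
From mathcomp Require Import ring lra zify.

(* Let s be the spectral measure of a cyclic vector u of U_t = koopman T t.
   Sending U_p u (x) U_q u to the character e^{i(px+qy)} identifies L_2(P x P)
   with L_2(s x s), the product flow with multiplication by e^{it(x+y)} and the
   flip with the exchange of x and y.  The hypothesis says that for every a > 0
   some e^{i t_n x} converges weakly-* in L_oo(s) to the symbol m_a equal to 1 at
   0 and to eps psi(ax) elsewhere, where psi(v) = (e^{iv} - 1) / (iv).

   If kappa in L_1(s x s) annihilates all the e^{it(x+y)}, then so does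
   m_a(x) m_a(y) kappa.  Letting a -> 0 separates the axes from the rest of the
   plane; off the axes, it says that kappa annihilates
   (int_p^q e^{ivx} dv) (int_p^q e^{ivy} dv) for all p < q.  The symmetrisation of
   a product over two adjacent intervals is a combination of such squares, so
   shrinking intervals around p and r shows that kappa annihilates
   e^{i(px+ry)} + e^{i(rx+py)}.  Hence kappa(x, y) + kappa(y, x) = 0.

   (2) If h is orthogonal to the orbit of u (x) u, its image is antisymmetric,
   hence orthogonal to all symmetric functions.
   (3) s has no atom outside 0, so the diagonal is negligible up to the origin,
   which corresponds to the constants.  The vectors corresponding to the
   indicators of x < y and y < x therefore generate the orthocomplement of the
   constants, and both have as spectral measure the image of s x s restricted to
   x < y under (x, y) |-> x + y.
   (1) On a spectral measure s' of a vector orthogonal to the constants the limit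
   symbol tends to eps as a -> 0, and on s' * s' the same times t_n give eps^2;
   hence s' and s' * s' have no common part. *)

Set Implicit Arguments.
Unset Strict Implicit.
Unset Printing Implicit Defensive.

Import Order.TTheory GRing.Theory Num.Theory.
Import numFieldNormedType.Exports.

Local Open Scope classical_set_scope.
Local Open Scope ring_scope.

(** A product of two weakly convergent sequences need not converge weakly. Here
    [e^{i t_n x} e^{i t_n y}] does, because the variables separate on rectangles; and multiplying a
    diagonal character by it gives a diagonal character again, which is why the annihilator of these
    characters is stable under [m_a(x) m_a(y)]. The symbol of [Theta] makes [m_a] jump at 0, so the
    link with squares of exponential integrals holds only off the axes. As a -> 0 the product symbol
    takes the values 1, eps, eps^2 at the origin, on the axes and elsewhere; they are distinct since
    0 < eps < 1, so a polynomial in it isolates the last region. The spectral measure of the cyclic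
    vector has to be built: joint measurability of the flow makes correlations continuous, and
    Bochner's theorem comes from finite Fourier sums whose quantile functions converge along a
    subsequence. Vectors stay functions, and the spectral isomorphism is a relation between
    functions having the same coefficients on two families with equal Gram matrices. Borel sets are
    reached through classes of bounded functions stable under linear combinations and bounded
    pointwise limits. *)

Section RealIntegrable.
Context d (Y : measurableType d) (R : realType).
Variable mu : {measure set Y -> \bar R}.
Implicit Types f g : Y -> R.

Definition rintegrable f := mu.-integrable setT (EFin \o f).

Lemma rintegrable_meas f : rintegrable f -> measurable_fun setT f.
Proof. by move=> /measurable_int/measurable_EFinP. Qed.

Lemma rintegrableD f g : rintegrable f -> rintegrable g ->
  rintegrable (fun x => f x + g x).
Proof. by move=> fi gi; exact: (integrableD _ fi gi). Qed.

Lemma rintegrableZ c f : rintegrable f -> rintegrable (fun x => c * f x).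
Proof. by move=> fi; exact: (integrableZl _ c fi). Qed.

Lemma rintegrableN f : rintegrable f -> rintegrable (fun x => - f x).
Proof. by move=> fi; exact: integrableN fi. Qed.

Lemma rintegrableB f g : rintegrable f -> rintegrable g ->
  rintegrable (fun x => f x - g x).
Proof. by move=> fi gi; apply: rintegrableD => //; exact: rintegrableN. Qed.

Lemma rintegrable_norm f : rintegrable f -> rintegrable (fun x => `|f x|).
Proof. by move=> /integrable_abse. Qed.

Lemma le_rintegrable f g : measurable_fun setT f ->
  (forall x, `|f x| <= g x) -> rintegrable g -> rintegrable f.
Proof.
move=> mf fg; apply: le_integrable => //; first exact/measurable_EFinP.
by move=> x _; rewrite /= lee_fin (le_trans (fg x))// ler_norm.
Qed.

Lemma rintD f g : rintegrable f -> rintegrable g ->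
  \int[mu]_x (f x + g x) = \int[mu]_x f x + \int[mu]_x g x.
Proof. by move=> fi gi; rewrite RintegralD. Qed.

Lemma rintZ c f : rintegrable f -> \int[mu]_x (c * f x) = c * \int[mu]_x f x.
Proof. by move=> fi; rewrite RintegralZl. Qed.

Lemma rintN f : rintegrable f -> \int[mu]_x (- f x) = - \int[mu]_x f x.
Proof.
move=> fi; rewrite -mulN1r -rintZ//.
by apply: eq_Rintegral => x _; rewrite mulN1r.
Qed.

Lemma rintB f g : rintegrable f -> rintegrable g ->
  \int[mu]_x (f x - g x) = \int[mu]_x f x - \int[mu]_x g x.
Proof. by move=> fi gi; rewrite RintegralB. Qed.

Lemma le_rint f g : rintegrable f -> rintegrable g -> (forall x, f x <= g x) ->
  \int[mu]_x f x <= \int[mu]_x g x.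
Proof. by move=> fi gi fg; exact: le_Rintegral. Qed.

Lemma EFin_rint f : rintegrable f ->
  (\int[mu]_x f x)%:E = (\int[mu]_x (f x)%:E)%E.
Proof. by move=> fi; rewrite /Rintegral fineK//; exact: integrable_fin_num. Qed.

Lemma le_norm_rint f g : rintegrable f -> rintegrable g ->
  (forall x, `|f x| <= g x) -> `|\int[mu]_x f x| <= \int[mu]_x g x.
Proof.
move=> fi gi fg; apply: le_trans (le_normr_Rintegral _ fi) _ => //.
by apply: le_rint => //; exact: rintegrable_norm.
Qed.

Lemma rint_cvg (f_ : nat -> Y -> R) f g :
  (forall n, measurable_fun setT (f_ n)) -> measurable_fun setT f ->
  rintegrable g -> (forall n x, `|f_ n x| <= g x) ->
  {ae mu, forall x, f_ n x @[n --> \oo] --> f x} ->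
  \int[mu]_x f_ n x @[n --> \oo] --> \int[mu]_x f x.
Proof.
move=> mf_ mf gi fg ff.
have [] := @dominated_convergence _ _ _ mu setT measurableT
  (fun n => EFin \o f_ n) (EFin \o f) (EFin \o g).
- by move=> n; exact/measurable_EFinP.
- exact/measurable_EFinP.
- by apply: filterS ff => x fx _; apply: cvg_EFin; [exact: nearW|exact: fx].
- exact: gi.
- by apply: aeW => x n _ /=; rewrite lee_fin.
move=> fi _ /=.
have fi_ n : rintegrable (f_ n) by apply: le_rintegrable gi => //.
rewrite -(EFin_rint fi).
rewrite (_ : (fun n => _) = EFin \o (fun n => \int[mu]_x f_ n x)); last first.
  by apply/funext => n /=; rewrite EFin_rint//; exact: fi_.
by move=> /fine_cvgP[].
Qed.

Lemma rint_ge0_eq0 f : rintegrable f -> (forall x, 0 <= f x) ->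
  \int[mu]_x f x = 0 -> {ae mu, forall x, f x = 0}.
Proof.
move=> fi f0 if0'; have if0 := EFin_rint fi; rewrite if0' in if0.
have : (\int[mu]_x `|(EFin \o f) x| = 0)%E.
  by rewrite [RHS]if0; apply: eq_integral => x _ /=; rewrite ger0_norm.
move/(ae_eq_integral_abs _ measurableT (measurable_int _ fi)).
by apply: filterS => x /(_ I)/= [].
Qed.

Lemma rint_ae f g : measurable_fun setT f -> measurable_fun setT g ->
  {ae mu, forall x, f x = g x} -> \int[mu]_x f x = \int[mu]_x g x.
Proof.
move=> mf mg fg; congr fine; apply: ae_eq_integral => //.
- exact/measurable_EFinP.
- exact/measurable_EFinP.
- by apply: filterS fg => x /= -> _.
Qed.

End RealIntegrable.

(** * Complex numbers: squared modulus and coordinatewise limits *)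

Section ComplexNumbers.
Context (R : realType).
Implicit Types z w : R[i].

(** The norm of [R[i]] takes its values in [R[i]]; this squared modulus is real and polynomial in
    the coordinates, so that bounds on it reduce to real arithmetic. *)
Definition nrm2 z : R := complex.Re z ^+ 2 + complex.Im z ^+ 2.

Lemma cReD z w : complex.Re (z + w) = complex.Re z + complex.Re w.
Proof. by case: z w => [? ?] [? ?]. Qed.
Lemma cImD z w : complex.Im (z + w) = complex.Im z + complex.Im w.
Proof. by case: z w => [? ?] [? ?]. Qed.
Lemma cReN z : complex.Re (- z) = - complex.Re z. Proof. by case: z. Qed.
Lemma cImN z : complex.Im (- z) = - complex.Im z. Proof. by case: z. Qed.
Lemma cReB z w : complex.Re (z - w) = complex.Re z - complex.Re w.
Proof. by rewrite cReD cReN. Qed.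
Lemma cImB z w : complex.Im (z - w) = complex.Im z - complex.Im w.
Proof. by rewrite cImD cImN. Qed.
Lemma cReM z w : complex.Re (z * w) =
  complex.Re z * complex.Re w - complex.Im z * complex.Im w.
Proof. by case: z w => [? ?] [? ?]. Qed.
Lemma cImM z w : complex.Im (z * w) =
  complex.Re z * complex.Im w + complex.Im z * complex.Re w.
Proof. by case: z w => [? ?] [? ?]. Qed.
Lemma cReJ z : complex.Re z^* = complex.Re z. Proof. by case: z. Qed.
Lemma cImJ z : complex.Im z^* = - complex.Im z. Proof. by case: z. Qed.

Definition ReImE := (cReD, cImD, cReN, cImN, cReM, cImM, cReJ, cImJ).

Lemma cplx_eq z w : complex.Re z = complex.Re w -> complex.Im z = complex.Im w ->
  z = w.
Proof. by case: z w => [? ?] [? ?] /= -> ->. Qed.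

Lemma nrm2_ge0 z : 0 <= nrm2 z. Proof. by rewrite addr_ge0 ?sqr_ge0. Qed.
Lemma nrm2M z w : nrm2 (z * w) = nrm2 z * nrm2 w.
Proof. by rewrite /nrm2 !ReImE; ring. Qed.
Lemma nrm2J z : nrm2 z^* = nrm2 z.
Proof. by rewrite /nrm2 !ReImE; ring. Qed.
Lemma nrm2N z : nrm2 (- z) = nrm2 z.
Proof. by rewrite /nrm2 !ReImE; ring. Qed.
Lemma mulCJ z : z * z^* = (nrm2 z)%:C%C.
Proof. by apply: cplx_eq; rewrite /nrm2 !ReImE /=; ring. Qed.
Lemma nrm2_eq0 z : nrm2 z = 0 -> z = 0.
Proof.
move/eqP; rewrite paddr_eq0 ?sqr_ge0// !sqrf_eq0 => /andP[/eqP r /eqP i].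
exact: cplx_eq.
Qed.
Lemma sqrRe_le z : complex.Re z ^+ 2 <= nrm2 z.
Proof. by rewrite lerDl sqr_ge0. Qed.
Lemma sqrIm_le z : complex.Im z ^+ 2 <= nrm2 z.
Proof. by rewrite lerDr sqr_ge0. Qed.

Lemma Re_le_nrm2 z w : `|complex.Re (z * w^*)| <= nrm2 z + nrm2 w.
Proof.
rewrite ler_norml /nrm2 !ReImE.
have := sqr_ge0 (complex.Re z + complex.Re w).
have := sqr_ge0 (complex.Im z + complex.Im w).
have := sqr_ge0 (complex.Re z - complex.Re w).
have := sqr_ge0 (complex.Im z - complex.Im w).
by move=> *; apply/andP; split; nra.
Qed.

Lemma Im_le_nrm2 z w : `|complex.Im (z * w^*)| <= nrm2 z + nrm2 w.
Proof.
rewrite ler_norml /nrm2 !ReImE.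
have := sqr_ge0 (complex.Re z + complex.Im w).
have := sqr_ge0 (complex.Im z + complex.Re w).
have := sqr_ge0 (complex.Re z - complex.Im w).
have := sqr_ge0 (complex.Im z - complex.Re w).
by move=> *; apply/andP; split; nra.
Qed.

(** The parallelogram identity with one term dropped. It stands in for the triangle inequality and
    spares square roots of norms. *)
Lemma nrm2D_le z w : nrm2 (z + w) <= 2 * nrm2 z + 2 * nrm2 w.
Proof.
rewrite /nrm2 !ReImE.
have := sqr_ge0 (complex.Re z - complex.Re w).
by have := sqr_ge0 (complex.Im z - complex.Im w); nra.
Qed.

Definition ccvg (z : nat -> R[i]) (l : R[i]) :=
  complex.Re (z n) @[n --> \oo] --> complex.Re l /\
  complex.Im (z n) @[n --> \oo] --> complex.Im l.

Lemma ccvg_cst z : ccvg (fun=> z) z.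
Proof. by split; exact: cvg_cst. Qed.

Lemma ccvgD (z w : nat -> R[i]) l k : ccvg z l -> ccvg w k -> ccvg (fun n => z n + w n) (l + k).
Proof.
move=> [zr zi] [wr wi]; split; rewrite !ReImE.
  by under eq_fun do rewrite cReD; exact: cvgD.
by under eq_fun do rewrite cImD; exact: cvgD.
Qed.

Lemma ccvgM (z w : nat -> R[i]) l k : ccvg z l -> ccvg w k -> ccvg (fun n => z n * w n) (l * k).
Proof.
move=> [zr zi] [wr wi]; split; rewrite !ReImE.
  by under eq_fun do rewrite cReM; apply: cvgB; exact: cvgM.
by under eq_fun do rewrite cImM; apply: cvgD; exact: cvgM.
Qed.

Lemma ccvgJ (z : nat -> R[i]) l : ccvg z l -> ccvg (fun n => (z n)^*) l^*.
Proof.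
move=> [zr zi]; split; rewrite ?ReImE.
  by under eq_fun do rewrite cReJ.
by under eq_fun do rewrite cImJ; exact: cvgN.
Qed.

Lemma ccvg_unique (z : nat -> R[i]) l k : ccvg z l -> ccvg z k -> l = k.
Proof.
by move=> [zr zi] [zr' zi']; apply: cplx_eq;
  [exact: (cvg_unique _ zr zr')|exact: (cvg_unique _ zi zi')].
Qed.

Lemma ccvg_nrm2P (z : nat -> R[i]) l : nrm2 (z n - l) @[n --> \oo] --> (0:R) -> ccvg z l.
Proof.
have sq0 (u v : R^nat) : (forall n, u n ^+ 2 <= v n) ->
    v n @[n --> \oo] --> (0:R) -> u n @[n --> \oo] --> (0:R).
  move=> uv /cvgrPdist_lt v0; apply/cvgrPdist_lt => e e0.
  near=> n; rewrite sub0r normrN -(@ltr_pXn2r _ 2)// ?nnegrE ?(ltW e0)//.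
  rewrite real_normK ?num_real// (le_lt_trans (uv n))//.
  have : `|0 - v n| < e ^+ 2 by near: n; apply: v0; rewrite exprn_gt0.
  by rewrite sub0r normrN => /(le_lt_trans (ler_norm _)).
move=> h; split; apply/subr_cvg0.
  by apply: sq0 h => n; rewrite -cReB sqrRe_le.
by apply: sq0 h => n; rewrite -cImB sqrIm_le.
Unshelve. all: end_near. Qed.

End ComplexNumbers.

(** * Complex integrals and the inner product of L_2 *)

Section ComplexIntegral.
Context d (Y : measurableType d) (R : realType).
Variable mu : {measure set Y -> \bar R}.
Implicit Types f g h : Y -> R[i].

Definition cmeasurable f := measurable_fun setT (fun x => complex.Re (f x)) /\
  measurable_fun setT (fun x => complex.Im (f x)).

Lemma cmeasurable_cst c : cmeasurable (fun=> c).
Proof. by split; exact: measurable_cst. Qed.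

Lemma cmeasurableD f g : cmeasurable f -> cmeasurable g ->
  cmeasurable (fun x => f x + g x).
Proof.
move=> [fr fi] [gr gi]; split.
  by under eq_fun do rewrite cReD; exact: measurable_funD.
by under eq_fun do rewrite cImD; exact: measurable_funD.
Qed.

Lemma cmeasurableM f g : cmeasurable f -> cmeasurable g ->
  cmeasurable (fun x => f x * g x).
Proof.
move=> [fr fi] [gr gi]; split.
  by under eq_fun do rewrite cReM; apply: measurable_funB; exact: measurable_funM.
by under eq_fun do rewrite cImM; apply: measurable_funD; exact: measurable_funM.
Qed.

Lemma cmeasurableN f : cmeasurable f -> cmeasurable (fun x => - f x).
Proof.
move=> [fr fi]; split.
  by under eq_fun do rewrite cReN; exact: measurableT_comp.
by under eq_fun do rewrite cImN; exact: measurableT_comp.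
Qed.

Lemma cmeasurableJ f : cmeasurable f -> cmeasurable (fun x => (f x)^*).
Proof.
move=> [fr fi]; split.
  by under eq_fun do rewrite cReJ.
by under eq_fun do rewrite cImJ; exact: measurableT_comp.
Qed.

Lemma cmeasurable_real (f : Y -> R) : measurable_fun setT f ->
  cmeasurable (fun x => (f x)%:C%C).
Proof. by move=> mf; split => //=; exact: measurable_cst. Qed.

Lemma measurable_nrm2 f : cmeasurable f -> measurable_fun setT (fun x => nrm2 (f x)).
Proof. by move=> [? ?]; apply: measurable_funD; exact: measurable_funX. Qed.

Definition cintegrable f := rintegrable mu (fun x => complex.Re (f x)) /\
  rintegrable mu (fun x => complex.Im (f x)).

Lemma cintegrable_meas f : cintegrable f -> cmeasurable f.
Proof. by move=> [fr fi]; split; [exact: (rintegrable_meas fr)|exact: (rintegrable_meas fi)]. Qed.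

Lemma le_cintegrable f (g : Y -> R) : cmeasurable f -> rintegrable mu g ->
  (forall x, `|complex.Re (f x)| <= g x) -> (forall x, `|complex.Im (f x)| <= g x) ->
  cintegrable f.
Proof. by move=> [? ?] ? ? ?; split; exact: (@le_rintegrable _ _ _ _ _ g). Qed.

Lemma cintegrableD f g : cintegrable f -> cintegrable g ->
  cintegrable (fun x => f x + g x).
Proof.
move=> [fr fi] [gr gi]; split.
  by under eq_fun do rewrite cReD; exact: rintegrableD.
by under eq_fun do rewrite cImD; exact: rintegrableD.
Qed.

Lemma cintegrableZ c f : cintegrable f -> cintegrable (fun x => c * f x).
Proof.
move=> [fr fi]; split.
  by under eq_fun do rewrite cReM; apply: rintegrableB; exact: rintegrableZ.
by under eq_fun do rewrite cImM; apply: rintegrableD; exact: rintegrableZ.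
Qed.

Lemma cintegrableN f : cintegrable f -> cintegrable (fun x => - f x).
Proof.
move=> [fr fi]; split.
  by under eq_fun do rewrite cReN; exact: rintegrableN.
by under eq_fun do rewrite cImN; exact: rintegrableN.
Qed.

Lemma cintegrableB f g : cintegrable f -> cintegrable g ->
  cintegrable (fun x => f x - g x).
Proof. by move=> ? ?; apply: cintegrableD => //; exact: cintegrableN. Qed.

Lemma cintegrableJ f : cintegrable f -> cintegrable (fun x => (f x)^*).
Proof.
move=> [fr fi]; split.
  by under eq_fun do rewrite cReJ.
by under eq_fun do rewrite cImJ; exact: rintegrableN.
Qed.

Lemma cintegrable_bM f g C : cmeasurable f -> (forall x, nrm2 (f x) <= C) ->
  cintegrable g -> cintegrable (fun x => f x * g x).
Proof.
move=> mf fC gi; have [gr gim] := gi.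
apply: (@le_cintegrable _ (fun x => (1 + C) * (`|complex.Re (g x)| + `|complex.Im (g x)|))).
- by apply: cmeasurableM => //; exact: cintegrable_meas.
- by apply: rintegrableZ; apply: rintegrableD; exact: rintegrable_norm.
all: move=> x; have := fC x; rewrite /nrm2 !ReImE; set a := complex.Re (f x);
  set b := complex.Im (f x); move=> abC.
(* [a ^+ 2 <= C] yields [1 + C] as a bound on the modulus without extracting a square root. *)
all: have a1 : `|a| <= 1 + C by rewrite ler_norml; apply/andP; split; nra.
all: have b1 : `|b| <= 1 + C by rewrite ler_norml; apply/andP; split; nra.
  apply: (le_trans (ler_normB _ _)); rewrite !normrM mulrDr.
  by apply: lerD; apply: ler_wpM2r.
apply: (le_trans (ler_normD _ _)); rewrite !normrM mulrDr addrC.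
by apply: lerD; apply: ler_wpM2r.
Qed.

Local Notation cint f := (cintegral mu setT f).

Lemma cintD f g : cintegrable f -> cintegrable g ->
  cint (fun x => f x + g x) = cint f + cint g.
Proof.
move=> [fr fi] [gr gi]; apply: cplx_eq; rewrite !ReImE /=.
  by rewrite -rintD//; apply: eq_Rintegral => x _; rewrite cReD.
by rewrite -rintD//; apply: eq_Rintegral => x _; rewrite cImD.
Qed.

Lemma cintZ c f : cintegrable f -> cint (fun x => c * f x) = c * cint f.
Proof.
move=> [fr fi]; apply: cplx_eq; rewrite !ReImE /=.
  rewrite -!rintZ// -rintB//; [|exact: rintegrableZ..].
  by apply: eq_Rintegral => x _; rewrite cReM.
rewrite -!rintZ// -rintD//; [|exact: rintegrableZ..].
by apply: eq_Rintegral => x _; rewrite cImM.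
Qed.

Lemma cintN f : cintegrable f -> cint (fun x => - f x) = - cint f.
Proof.
move=> fi; rewrite -mulN1r -cintZ//; congr (cintegral mu setT _).
by apply/funext => x; rewrite mulN1r.
Qed.

Lemma cintB f g : cintegrable f -> cintegrable g ->
  cint (fun x => f x - g x) = cint f - cint g.
Proof. by move=> fi gi; rewrite cintD// ?cintN//; exact: cintegrableN. Qed.

Lemma cintJ f : cintegrable f -> cint (fun x => (f x)^*) = (cint f)^*.
Proof.
move=> [fr fi]; apply: cplx_eq; rewrite ?ReImE /=.
  by apply: eq_Rintegral => x _; rewrite cReJ.
by rewrite -rintN//; apply: eq_Rintegral => x _; rewrite cImJ.
Qed.

Lemma cint_ae f g : cmeasurable f -> cmeasurable g ->
  {ae mu, forall x, f x = g x} -> cint f = cint g.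
Proof.
move=> [? ?] [? ?] fg.
by congr Complex; apply: rint_ae => //; apply: filterS fg => x ->.
Qed.

Lemma cint0 : cint (fun=> 0) = 0.
Proof. by apply: cplx_eq => /=; rewrite /Rintegral integral0. Qed.

Lemma cint_cvg (f_ : nat -> Y -> R[i]) f (g : Y -> R) :
  (forall n, cmeasurable (f_ n)) -> cmeasurable f ->
  rintegrable mu g -> (forall n x, `|complex.Re (f_ n x)| <= g x) ->
  (forall n x, `|complex.Im (f_ n x)| <= g x) ->
  {ae mu, forall x, ccvg (f_ ^~ x) (f x)} ->
  ccvg (fun n => cint (f_ n)) (cint f).
Proof.
move=> mf_ [mfr mfi] gi gr gim ff; split => /=.
  by apply: (rint_cvg _ mfr gi gr);
    [move=> n; case: (mf_ n)|apply: filterS ff => x []].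
by apply: (rint_cvg _ mfi gi gim);
  [move=> n; case: (mf_ n)|apply: filterS ff => x []].
Qed.

Lemma cintegrable_sum n (F : 'I_n -> Y -> R[i]) :
  (forall i, cintegrable (F i)) -> cintegrable (fun x => \sum_(i < n) F i x).
Proof.
elim: n F => [|n ih] F Fi.
  under eq_fun do rewrite big_ord0.
  by split; exact: integrable0.
under eq_fun do rewrite big_ord_recl.
by apply: cintegrableD => //; exact: ih.
Qed.

Lemma cint_sum n (F : 'I_n -> Y -> R[i]) : (forall i, cintegrable (F i)) ->
  cint (fun x => \sum_(i < n) F i x) = \sum_(i < n) cint (F i).
Proof.
elim: n F => [|n ih] F Fi.
  by rewrite big_ord0; under eq_fun do rewrite big_ord0; exact: cint0.
rewrite big_ord_recl -ih//; under eq_fun do rewrite big_ord_recl.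
by rewrite cintD//; exact: cintegrable_sum.
Qed.

Lemma Re_cint_le f (g : Y -> R) : cintegrable f -> rintegrable mu g ->
  (forall x, `|complex.Re (f x)| <= g x) -> `|complex.Re (cint f)| <= \int[mu]_x g x.
Proof. by move=> [fr _] gi fg; exact: le_norm_rint. Qed.

Lemma Im_cint_le f (g : Y -> R) : cintegrable f -> rintegrable mu g ->
  (forall x, `|complex.Im (f x)| <= g x) -> `|complex.Im (cint f)| <= \int[mu]_x g x.
Proof. by move=> [_ fi] gi fg; exact: le_norm_rint. Qed.

Lemma L2P f : L2 mu f <-> cmeasurable f /\ rintegrable mu (fun x => nrm2 (f x)).
Proof.
have Lfun2P (g : Y -> R) : g \in Lfun mu 2%:E <->
    measurable_fun setT g /\ rintegrable mu (fun x => g x ^+ 2).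
  split=> [g2|[mg g2]].
    split; last exact: Lfun2_integrable_sqr.
    by move: g2; rewrite inE => /andP[]; rewrite inE.
  rewrite inE; apply/andP; split; rewrite inE//= /finite_norm unlock poweR_lty//.
  have := integrable_lty measurableT g2; apply: le_lt_trans.
  rewrite le_eqVlt; apply/orP; left; apply/eqP; apply: eq_integral => x _ /=.
  by rewrite powR_mulrn// real_normK// num_real.
split=> [[/Lfun2P[mr r2] /Lfun2P[mi i2]]|[[mr mi] n2]].
  by split => //; exact: rintegrableD.
split; apply/Lfun2P; split => //; apply: le_rintegrable n2.
- exact: measurable_funX.
- by move=> x; rewrite ger0_norm ?sqr_ge0// sqrRe_le.
- exact: measurable_funX.
- by move=> x; rewrite ger0_norm ?sqr_ge0// sqrIm_le.
Qed.

Lemma L2_meas f : L2 mu f -> cmeasurable f. Proof. by move=> /L2P[]. Qed.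

Lemma L2_nrm2 f : L2 mu f -> rintegrable mu (fun x => nrm2 (f x)).
Proof. by move=> /L2P[]. Qed.

Lemma L2D f g : L2 mu f -> L2 mu g -> L2 mu (fun x => f x + g x).
Proof.
move=> /L2P[mf f2] /L2P[mg g2]; apply/L2P; split; first exact: cmeasurableD.
apply: (@le_rintegrable _ _ _ _ _ (fun x => 2 * nrm2 (f x) + 2 * nrm2 (g x))).
- by apply: measurable_nrm2; exact: cmeasurableD.
- by move=> x; rewrite ger0_norm ?nrm2_ge0// nrm2D_le.
- by apply: rintegrableD; exact: rintegrableZ.
Qed.

Lemma L2_bM f g C : cmeasurable f -> (forall x, nrm2 (f x) <= C) -> L2 mu g ->
  L2 mu (fun x => f x * g x).
Proof.
move=> mf fC /L2P[mg g2]; apply/L2P; split; first exact: cmeasurableM.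
apply: (@le_rintegrable _ _ _ _ _ (fun x => C * nrm2 (g x))).
- by apply: measurable_nrm2; exact: cmeasurableM.
- by move=> x; rewrite ger0_norm ?nrm2_ge0// nrm2M ler_wpM2r// nrm2_ge0.
- exact: rintegrableZ.
Qed.

Lemma L2Z c f : L2 mu f -> L2 mu (fun x => c * f x).
Proof. by apply: L2_bM (cmeasurable_cst c) _ => x; exact: lexx. Qed.

Lemma L2N f : L2 mu f -> L2 mu (fun x => - f x).
Proof. by move=> /(L2Z (-1)); under eq_fun do rewrite mulN1r. Qed.

Lemma L2B f g : L2 mu f -> L2 mu g -> L2 mu (fun x => f x - g x).
Proof. by move=> ? ?; apply: L2D => //; exact: L2N. Qed.

Lemma L2_0 : L2 mu (fun=> 0).
Proof.
apply/L2P; split; first exact: cmeasurable_cst.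
under eq_fun do rewrite /nrm2 /= expr0n addr0; exact: integrable0.
Qed.

Lemma L2_sum n (F : 'I_n -> Y -> R[i]) :
  (forall i, L2 mu (F i)) -> L2 mu (fun x => \sum_(i < n) F i x).
Proof.
elim: n F => [|n ih] F Fi; first by under eq_fun do rewrite big_ord0; exact: L2_0.
by under eq_fun do rewrite big_ord_recl; apply: L2D => //; exact: ih.
Qed.

Lemma L2_cintegrable f g : L2 mu f -> L2 mu g -> cintegrable (fun x => f x * (g x)^*).
Proof.
move=> /L2P[mf f2] /L2P[mg g2].
apply: (@le_cintegrable _ (fun x => nrm2 (f x) + nrm2 (g x))).
- by apply: cmeasurableM => //; exact: cmeasurableJ.
- exact: rintegrableD.
- by move=> x; exact: Re_le_nrm2.
- by move=> x; exact: Im_le_nrm2.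
Qed.

Local Notation "<[ f , g ]>" := (inner mu f g).

Lemma innerDl f g h : L2 mu f -> L2 mu g -> L2 mu h ->
  <[ fun x => f x + g x, h ]> = <[ f, h ]> + <[ g, h ]>.
Proof.
move=> f2 g2 h2; rewrite -cintD; [|exact: L2_cintegrable..].
by congr (cintegral mu setT _); apply/funext => x; rewrite mulrDl.
Qed.

Lemma innerZl c f h : L2 mu f -> L2 mu h ->
  <[ fun x => c * f x, h ]> = c * <[ f, h ]>.
Proof.
move=> f2 h2; rewrite -cintZ; last exact: L2_cintegrable.
by congr (cintegral mu setT _); apply/funext => x; rewrite mulrA.
Qed.

Lemma innerC f g : L2 mu f -> L2 mu g -> <[ g, f ]> = <[ f, g ]>^*.
Proof.
move=> f2 g2; rewrite -cintJ; last exact: L2_cintegrable.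
by congr (cintegral mu setT _); apply/funext => x; apply: cplx_eq; rewrite !ReImE; ring.
Qed.

Lemma innerNl f h : L2 mu f -> L2 mu h -> <[ fun x => - f x, h ]> = - <[ f, h ]>.
Proof.
move=> f2 h2; rewrite -mulN1r -innerZl//; congr inner.
by apply/funext => x; rewrite mulN1r.
Qed.

Lemma innerBl f g h : L2 mu f -> L2 mu g -> L2 mu h ->
  <[ fun x => f x - g x, h ]> = <[ f, h ]> - <[ g, h ]>.
Proof. by move=> ? ? ?; rewrite innerDl ?innerNl//; exact: L2N. Qed.

Lemma innerDr f g h : L2 mu f -> L2 mu g -> L2 mu h ->
  <[ h, fun x => f x + g x ]> = <[ h, f ]> + <[ h, g ]>.
Proof.
move=> ? ? ?; rewrite innerC ?innerDl// ?rmorphD/=; last exact: L2D.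
by rewrite -!innerC.
Qed.

Lemma innerZr c f h : L2 mu f -> L2 mu h ->
  <[ h, fun x => c * f x ]> = c^* * <[ h, f ]>.
Proof.
by move=> ? ?; rewrite innerC ?innerZl// ?rmorphM/= -?innerC//; exact: L2Z.
Qed.

Lemma innerNr f h : L2 mu f -> L2 mu h -> <[ h, fun x => - f x ]> = - <[ h, f ]>.
Proof.
by move=> ? ?; rewrite innerC ?innerNl// ?rmorphN/= -?innerC//; exact: L2N.
Qed.

Lemma innerBr f g h : L2 mu f -> L2 mu g -> L2 mu h ->
  <[ h, fun x => f x - g x ]> = <[ h, f ]> - <[ h, g ]>.
Proof. by move=> ? ? ?; rewrite innerDr ?innerNr//; exact: L2N. Qed.

Lemma inner_suml n (F : 'I_n -> Y -> R[i]) h : (forall i, L2 mu (F i)) -> L2 mu h ->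
  <[ fun x => \sum_(i < n) F i x, h ]> = \sum_(i < n) <[ F i, h ]>.
Proof.
move=> F2 h2; rewrite -cint_sum; last by move=> i; exact: L2_cintegrable.
by congr (cintegral mu setT _); apply/funext => x; rewrite mulr_suml.
Qed.

Lemma sqnormE f : sqnorm mu f = \int[mu]_x nrm2 (f x).
Proof. by apply: eq_Rintegral => x _; rewrite mulCJ. Qed.

Lemma inner_sqnorm f : <[ f, f ]> = (sqnorm mu f)%:C%C.
Proof.
apply: cplx_eq => //=; under eq_Rintegral do rewrite mulCJ /=.
by rewrite /Rintegral integral0.
Qed.

Lemma sqnorm_ge0 f : 0 <= sqnorm mu f.
Proof. by rewrite sqnormE; apply: Rintegral_ge0 => x _; exact: nrm2_ge0. Qed.

Lemma sqnormN f : sqnorm mu (fun x => - f x) = sqnorm mu f.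
Proof. by rewrite !sqnormE; apply: eq_Rintegral => x _; rewrite nrm2N. Qed.

Lemma sqnormD_le f g : L2 mu f -> L2 mu g ->
  sqnorm mu (fun x => f x + g x) <= 2 * sqnorm mu f + 2 * sqnorm mu g.
Proof.
move=> f2 g2; rewrite !sqnormE -!rintZ -?rintD; try exact: L2_nrm2.
- apply: le_rint; [exact/L2_nrm2/L2D|apply: rintegrableD; apply: rintegrableZ; exact: L2_nrm2|].
  by move=> x; exact: nrm2D_le.
- by apply: rintegrableZ; exact: L2_nrm2.
- by apply: rintegrableZ; exact: L2_nrm2.
Qed.

Lemma sqnormB_le f g : L2 mu f -> L2 mu g ->
  sqnorm mu (fun x => f x - g x) <= 2 * sqnorm mu f + 2 * sqnorm mu g.
Proof.
by move=> f2 g2; rewrite -(sqnormN g); apply: sqnormD_le => //; exact: L2N.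
Qed.

Lemma sqnormB_expand c f g : L2 mu f -> L2 mu g ->
  sqnorm mu (fun x => f x - c * g x) =
  sqnorm mu f - 2 * complex.Re (c^* * <[ f, g ]>) + nrm2 c * sqnorm mu g.
Proof.
move=> f2 g2; have cg2 := L2Z c g2.
rewrite /sqnorm innerBl ?innerBr//; [|exact: L2B].
rewrite !innerZr// !innerZl// (innerC f2 g2) (inner_sqnorm g) /sqnorm /nrm2 !ReImE /=.
ring.
Qed.

(** With w the inner product, f is compared with [t w g] for real t: the factor w absorbs the phase,
    which leaves a real quadratic in t. The best t is the inverse of the squared norm of g. *)
Lemma cauchy_schwarz f g : L2 mu f -> L2 mu g ->
  nrm2 <[ f, g ]> <= sqnorm mu f * sqnorm mu g.
Proof.
move=> f2 g2; set w := <[ f, g ]>; have w0 := nrm2_ge0 w.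
have h (t : R) : 0 <= sqnorm mu f - 2 * t * nrm2 w + t ^+ 2 * nrm2 w * sqnorm mu g.
  have := sqnorm_ge0 (fun x => f x - (t%:C%C * w) * g x).
  rewrite sqnormB_expand// -/w nrm2M.
  by rewrite /nrm2 !ReImE/=; congr (_ <= _); ring.
have := sqnorm_ge0 g; have := sqnorm_ge0 f.
move: h; move: (sqnorm mu f) (sqnorm mu g) (nrm2 w) w0 => a b c c0 h a0 b0.
have [b_gt0|] := ltP 0 b.
  have := h b^-1; rewrite -(@ler_pM2r _ b)// mul0r.
  rewrite (_ : (a - 2 * b^-1 * c + b^-1 ^+ 2 * c * b) * b = a * b - c); last by field; lra.
  by lra.
move=> b_le0; have {b_le0 b0}b0 : b = 0 by lra.
rewrite {}b0 in h *.
have [c_gt0|] := ltP 0 c; last by lra.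
(* When g has norm 0 the quadratic is affine in t. The value [a / c] forces a = 0, and then t = 1
   contradicts c > 0. *)
have := h (a / c); rewrite (_ : _ + _ = - a); last by field; lra.
move=> ?; have a00 : a = 0 by lra.
by have := h 1; rewrite a00; lra.
Qed.

Lemma inner_ae0 f g : L2 mu f -> {ae mu, forall x, f x = 0} -> L2 mu g -> <[ f, g ]> = 0.
Proof.
move=> f2 f0 g2; rewrite -[RHS]cint0; apply: cint_ae.
- exact/cintegrable_meas/L2_cintegrable.
- exact: cmeasurable_cst.
- by apply: filterS f0 => x ->; rewrite mul0r.
Qed.

Lemma sqnorm_eq0_ae f : L2 mu f -> sqnorm mu f = 0 -> {ae mu, forall x, f x = 0}.
Proof.
move=> f2; rewrite sqnormE => f0.
apply: filterS (rint_ge0_eq0 (L2_nrm2 f2) (fun x => nrm2_ge0 _) f0) => x.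
exact: nrm2_eq0.
Qed.

End ComplexIntegral.

(** * Completeness of L_2 (Riesz-Fischer) *)

Section Completeness.
Context d (Y : measurableType d) (R : realType).
Variable mu : {measure set Y -> \bar R}.

(** The integrals sum to at most 2, so the series is finite almost everywhere. [fine] replaces
    infinite values by 0, hence the domination holds only outside a null set. *)
Lemma series_dominated_ae (u : nat -> Y -> R) :
  (forall n, rintegrable mu (u n)) -> (forall n x, 0 <= u n x) ->
  (forall n, \int[mu]_x u n x <= 2^-1 ^+ n) ->
  exists h, [/\ rintegrable mu h, forall x, 0 <= h x &
    {ae mu, forall x, forall m, \sum_(0 <= k < m) u k x <= h x}].
Proof.
move=> ui u0 u2.
have mu_ n : measurable_fun setT (u n) := rintegrable_meas (ui n).
pose H x := (\sum_(n <oo) (u n x)%:E)%E.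
have H0 x : (0 <= H x)%E by apply: nneseries_ge0 => n _ _; rewrite lee_fin.
have mH : measurable_fun setT H.
  rewrite /H; apply: ge0_emeasurable_sum => [k x _ _|k _]; first by rewrite lee_fin.
  exact/measurable_EFinP.
have Hi : mu.-integrable setT H.
  apply/integrableP; split => //.
  under eq_integral => x _ do rewrite gee0_abs//.
  rewrite integral_nneseries//; [|by move=> n; exact/measurable_EFinP|by move=> n x _;
    rewrite lee_fin].
  apply: le_lt_trans (ltry 2); apply: le_trans (@epsilon_trick0 R 2 xpredT _) => //.
  apply: lee_nneseries => [n _ _|n _]; first by apply: integral_ge0 => x _; rewrite lee_fin.
  by rewrite -EFin_rint// lee_fin (le_trans (u2 n))// natrX exprS invfM mulrA divff
    ?pnatr_eq0// mul1r exprVn.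
exists (fine \o H); split => [|x|].
- apply: (le_integrable measurableT _ _ Hi).
    by apply/measurable_EFinP; exact: measurableT_comp.
  move=> x _ /=; have := H0 x; case: (H x) => [r||]//= r0.
  by rewrite normr0 leey.
- by rewrite /= fine_ge0.
- apply: filterS (integrable_ae measurableT Hi) => x /(_ I) Hfin m /=.
  rewrite -lee_fin fineK// -sumEFin.
  by apply: nneseries_lim_ge => k _ _; rewrite lee_fin.
Qed.

Lemma sqr_cauchy_cvg (u v : R^nat) : v n @[n --> \oo] --> (0:R) ->
  (forall n m, (n <= m)%N -> (u m - u n) ^+ 2 <= v n) -> cvgn u.
Proof.
move=> v0 uv; apply: cauchy_cvg; apply: cauchy_exP => e e0.
have [n _ vn] : \forall n \near \oo, v n < e ^+ 2.
  by apply: cvgr_lt v0 _ _; rewrite exprn_gt0.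
exists (u n); exists n => // m /= nm; rewrite /ball/= -(@ltr_pXn2r _ 2)// ?nnegrE ?(ltW e0)//.
rewrite real_normK ?num_real// -sqrrN opprB (le_lt_trans (uv n m nm))//.
exact: vn (leqnn n).
Qed.

(** The rate [4^-1 ^+ n] leaves room for a weight [2 ^+ n]: the weighted squared increments still
    have summable integrals, and their sum h bounds the squared distance to the limit by
    [2^-1 ^+ n * (2 * h x)], pointwise almost everywhere. *)
Lemma L2_complete (f_ : nat -> Y -> R[i]) : (forall n, L2 mu (f_ n)) ->
  (forall n, sqnorm mu (fun x => f_ n.+1 x - f_ n x) <= 4^-1 ^+ n) ->
  exists2 f, L2 mu f & sqnorm mu (fun x => f_ n x - f x) @[n --> \oo] --> (0:R).
Proof.
move=> f2 fC.
pose D n x := nrm2 (f_ n.+1 x - f_ n x).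
have Di n : rintegrable mu (D n) by apply: L2_nrm2; exact: L2B.
have D0 n x : 0 <= D n x by exact: nrm2_ge0.
have [h [hi h0 [N [mN N0 hN]]]] := @series_dominated_ae (fun n x => 2 ^+ n * D n x)
  (fun n => rintegrableZ _ (Di n)) (fun n x => mulr_ge0 (exprn_ge0 n (ler0n R 2)) (D0 n x))
  (fun n => ltac:(by rewrite rintZ// -sqnormE (le_trans (ler_wpM2l _ (fC n)))//
     -exprMn (_ : 2 * 4^-1 = 2^-1 :> R) //; lra)).
(* Cutting off the exceptional null set makes the sequence converge at every point, so the limit is
   measurable. *)
pose c x : R := \1_(~` N) x.
have mc : measurable_fun setT c by apply: measurable_indic; exact: measurableC.
have mcC : cmeasurable (fun x => (c x)%:C%C) by exact: cmeasurable_real.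
have c01 x : nrm2 (c x)%:C%C <= 1.
  by rewrite /nrm2 /= expr0n addr0 /c indicE; case: (_ \in _); rewrite ?expr1n ?expr0n.
pose g n x := (c x)%:C%C * f_ n x.
have g2 n : L2 mu (g n) by exact: L2_bM.
(* Each use of [nrm2D_le] costs a factor 2, which is exactly the growth of the weight from [2 ^+ n]
   to [2 ^+ n.+1]. *)
have telescope x n j : 2 ^+ n * nrm2 (f_ (n + j)%N x - f_ n x) <=
    2 * \sum_(n <= k < n + j) 2 ^+ k * D k x.
  elim: j n => [|j ih] n.
    by rewrite addn0 subrr big_geq// /nrm2 /= expr0n addr0 !mulr0.
  rewrite -addSnnS big_ltn ?addSn ?ltnS ?leq_addr// -addSn -(subrK (f_ n.+1 x) (f_ (n.+1 + j)%N
    x)) -addrA.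
  apply: le_trans (ler_wpM2l _ (nrm2D_le _ _)) _; first by rewrite exprn_ge0.
  by have := ih n.+1; rewrite exprS -/(D n x) => ?; nra.
have gC n m x : (n <= m)%N -> nrm2 (g m x - g n x) <= 2^-1 ^+ n * (2 * h x).
  move=> /subnKC <-; rewrite /g -mulrBr nrm2M /c indicE.
  have [xN|xN] := boolP (x \in ~` N); last first.
    by rewrite /nrm2 /= expr0n addr0 mul0r !mulr_ge0// exprn_ge0// invr_ge0.
  rewrite {1}/nrm2 /= expr1n expr0n addr0 mul1r exprVn ler_pdivlMl ?exprn_gt0//.
  apply: (le_trans (telescope _ _ _)); rewrite ler_wpM2l//.
  have /contra_not/(_ (set_mem xN))/contrapT/(_ (n + (m - n))%N) := hN x.
  apply: le_trans; rewrite [leRHS](@big_cat_nat _ _ _ n)//= ?leq_addr//.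
  by rewrite lerDr sumr_ge0// => k _; rewrite mulr_ge0 ?exprn_ge0.
have half0 (K : R) : 2^-1 ^+ n * K @[n --> \oo] --> (0:R).
  rewrite -[X in _ --> X](mul0r K); apply: cvgMl; apply: cvg_expr.
  by rewrite ger0_norm//; lra.
have [fr gr] : {fr : Y -> R & forall x, complex.Re (g n x) @[n --> \oo] --> fr x}.
  exists (fun x => limn (fun n => complex.Re (g n x))) => x.
  apply: (sqr_cauchy_cvg (half0 (2 * h x))) => n m nm.
  by rewrite -cReB; apply: le_trans (sqrRe_le _) (gC _ _ _ nm).
have [fi gi] : {fi : Y -> R & forall x, complex.Im (g n x) @[n --> \oo] --> fi x}.
  exists (fun x => limn (fun n => complex.Im (g n x))) => x.
  apply: (sqr_cauchy_cvg (half0 (2 * h x))) => n m nm.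
  by rewrite -cImB; apply: le_trans (sqrIm_le _) (gC _ _ _ nm).
pose f x := Complex (fr x) (fi x).
have mf : cmeasurable f.
  split; [apply: (measurable_fun_cvg (h := fun n x => complex.Re (g n x)))|
          apply: (measurable_fun_cvg (h := fun n x => complex.Im (g n x)))] => //.
  - by move=> n; case: (L2_meas (g2 n)).
  - by move=> n; case: (L2_meas (g2 n)).
have gf n x : nrm2 (g n x - f x) <= 2^-1 ^+ n * (2 * h x).
  have lim : nrm2 (g m x - g n x) @[m --> \oo] --> nrm2 (f x - g n x).
    rewrite /nrm2; apply: cvgD; under eq_fun do rewrite ?cReB ?cImB expr2;
    rewrite ?cReB ?cImB expr2; apply: cvgM; apply: cvgB => //; exact: cvg_cst.
  rewrite -nrm2N opprB; apply: (closed_cvg (fun y => y <= 2^-1 ^+ n * (2 * h x)) _ _ _ lim).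
    exact: closed_le.
  by near=> m; apply: gC; near: m; exact: nbhs_infty_ge.
have f2' : L2 mu f.
  apply/L2P; split => //.
  apply: (@le_rintegrable _ _ _ _ _ (fun x => 2 * nrm2 (g 0%N x) + 2 * (2 * h x))).
  - exact: measurable_nrm2.
  - move=> x; rewrite ger0_norm ?nrm2_ge0//.
    rewrite (_ : f x = g 0%N x - (g 0%N x - f x)); last by rewrite subKr.
    apply: le_trans (nrm2D_le _ _) _; rewrite nrm2N lerD2l ler_wpM2l//.
    by have := gf 0%N x; rewrite expr0 mul1r.
  - by apply: rintegrableD; do ?apply: rintegrableZ => //; exact: L2_nrm2.
exists f => //.
apply: (@squeeze_cvgr _ _ _ _ (fun=> 0) (fun n => 2^-1 ^+ n * (2 * \int[mu]_x h x)));
  last 2 first.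
- exact: cvg_cst.
- exact: half0.
near=> n; rewrite sqnorm_ge0/= sqnormE.
rewrite (@rint_ae _ _ _ _ _ (fun x => nrm2 (g n x - f x))).
- rewrite -!rintZ//; last exact: rintegrableZ.
  apply: le_rint => //; first exact/L2_nrm2/L2B.
  by do 2 apply: rintegrableZ.
- exact/measurable_nrm2/L2_meas/L2B.
- exact/measurable_nrm2/L2_meas/L2B.
- exists N; split => // x /= h1; apply: contrapT => xN; apply: h1.
  by rewrite /g /c indicE mem_set//= mul1r.
Unshelve. all: end_near. Qed.

End Completeness.

(** * Closed spans and Gram isometries *)

Section Hilbert.
Context d (Y : measurableType d) (R : realType).
Variable mu : {measure set Y -> \bar R}.
Implicit Types f g h : Y -> R[i].

Lemma inner_cvg (f_ : nat -> Y -> R[i]) f g : (forall n, L2 mu (f_ n)) ->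
  L2 mu f -> L2 mu g -> sqnorm mu (fun x => f_ n x - f x) @[n --> \oo] --> (0:R) ->
  ccvg (fun n => inner mu (f_ n) g) (inner mu f g).
Proof.
move=> fn2 f2 g2 ff; apply: ccvg_nrm2P.
apply: (@squeeze_cvgr _ _ _ _ (fun=> 0)
   (fun n => sqnorm mu (fun x => f_ n x - f x) * sqnorm mu g)).
- near=> n; rewrite nrm2_ge0/= -innerBl//; apply: cauchy_schwarz => //; exact: L2B.
- exact: cvg_cst.
- by rewrite -[X in _ --> X](mul0r (sqnorm mu g)); exact: cvgMl.
Unshelve. all: end_near. Qed.

Section Span.
Variable S : set (Y -> R[i]).
Hypothesis S2 : S `<=` L2 mu.

Definition lspan : set (Y -> R[i]) := [set f | exists n (c : 'I_n -> R[i])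
  (s : 'I_n -> (Y -> R[i])), (forall i, S (s i)) /\
  f = (fun x => \sum_(i < n) c i * s i x)].

Lemma lspan_L2 f : lspan f -> L2 mu f.
Proof.
by move=> [n [c [s [Ss ->]]]]; apply: L2_sum => i; apply: L2Z; exact/S2.
Qed.

Lemma lspanD f g : lspan f -> lspan g -> lspan (fun x => f x + g x).
Proof.
move=> [n [c [s [Ss ->]]]] [m [c' [s' [Ss' ->]]]].
exists (n + m)%N, (fun i => match fintype.split i with inl j => c j | inr j => c' j end),
  (fun i => match fintype.split i with inl j => s j | inr j => s' j end); split.
  by move=> i; case: fintype.split.
apply/funext => x; rewrite big_split_ord /=; congr (_ + _); apply: eq_bigr => i _.
  by rewrite (unsplitK (inl i)).
by rewrite (unsplitK (inr i)).
Qed.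

Lemma lspanZ a f : lspan f -> lspan (fun x => a * f x).
Proof.
move=> [n [c [s [Ss ->]]]]; exists n, (fun i => a * c i), s; split => //.
by apply/funext => x; rewrite mulr_sumr; apply: eq_bigr => i _; rewrite mulrA.
Qed.

Lemma lspan_gen f : S f -> lspan f.
Proof.
move=> Sf; exists 1%N, (fun=> 1), (fun=> f); split => //.
by apply/funext => x; rewrite big_ord1 mul1r.
Qed.

Lemma lspan0 : lspan (fun=> 0).
Proof.
exists 0%N, (fun=> 0), (fun=> (fun=> 0)); split; first by case.
by apply/funext => x; rewrite big_ord0.
Qed.

Lemma closed_spanP f : closed_span mu S f <->
  forall delta : R, 0 < delta -> exists2 g, lspan g & sqnorm mu (fun x => f x - g x) < delta.
Proof.
split=> h delta /h.
  move=> [n [c [s [Ss sd]]]]; exists (fun x => \sum_(i < n) c i * s i x) => //.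
  by exists n, c, s.
by move=> [g [n [c [s [Ss ->]]]] sd]; exists n, c, s.
Qed.

Lemma lspan_orth h f : L2 mu h -> (forall s, S s -> inner mu s h = 0) -> lspan f ->
  inner mu f h = 0.
Proof.
move=> h2 Sh [n [c [s [Ss ->]]]]; rewrite inner_suml//; last first.
  by move=> i; apply: L2Z; exact: S2.
by rewrite big1// => i _; rewrite innerZl ?Sh ?mulr0//; exact: S2.
Qed.

(** The rate is chosen for [L2_complete]: two consecutive approximants are then at squared distance
    at most [4 * 8^-1 ^+ n.+1], which is below [4^-1 ^+ n]. *)
Lemma closed_span_seq f : L2 mu f -> closed_span mu S f ->
  exists2 g : nat -> Y -> R[i], (forall n, lspan (g n)) &
    (forall n, sqnorm mu (fun x => f x - g n x) <= 8^-1 ^+ n.+1).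
Proof.
move=> f2 /closed_spanP fS.
have gP n : {g | lspan g /\ sqnorm mu (fun x => f x - g x) < 8^-1 ^+ n.+1}.
  by apply: cid; have [|g ? ?] := fS (8^-1 ^+ n.+1); [rewrite exprn_gt0// invr_gt0|exists g].
by exists (fun n => sval (gP n)) => n; have [g1 g2] := svalP (gP n); rewrite ?(ltW g2).
Qed.

Lemma expr8_cvg : 8^-1 ^+ n.+1 @[n --> \oo] --> (0 : R).
Proof.
rewrite (_ : (fun n => _) = (fun n => 8^-1 * 8^-1 ^+ n)); last first.
  by apply/funext => n; rewrite exprS.
rewrite -[X in _ --> X](mulr0 (8^-1 : R)); apply: cvgMr; apply: cvg_expr.
by rewrite ger0_norm// ?invr_ge0//; lra.
Qed.

Lemma sqnorm_squeeze (f_ : nat -> Y -> R[i]) f :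
  (forall n, sqnorm mu (fun x => f x - f_ n x) <= 8^-1 ^+ n.+1) ->
  sqnorm mu (fun x => f_ n x - f x) @[n --> \oo] --> (0:R).
Proof.
move=> h; apply: (@squeeze_cvgr _ _ _ _ (fun=> 0) (fun n => 8^-1 ^+ n.+1)).
- near=> n; rewrite sqnorm_ge0/= (le_trans _ (h n))// -sqnormN le_eqVlt.
  by apply/orP; left; apply/eqP; congr sqnorm; apply/funext => x; rewrite opprB.
- exact: cvg_cst.
- exact: expr8_cvg.
Unshelve. all: end_near. Qed.

Lemma closed_span_orth h f : L2 mu f -> L2 mu h -> (forall s, S s -> inner mu s h = 0) ->
  closed_span mu S f -> inner mu f h = 0.
Proof.
move=> f2 h2 Sh /(closed_span_seq f2)[g gS fg].
have gf := sqnorm_squeeze fg.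
have := inner_cvg (fun n => lspan_L2 (gS n)) f2 h2 gf.
rewrite (_ : (fun n => _) = (fun=> 0)); last first.
  by apply/funext => n; rewrite lspan_orth.
by move=> /ccvg_unique; apply; exact: ccvg_cst.
Qed.

Lemma sqnorm_parallelogram f g h : L2 mu f -> L2 mu g -> L2 mu h ->
  sqnorm mu (fun x => g x - h x) + 4 * sqnorm mu (fun x => f x - 2^-1 * (g x + h x)) =
  2 * sqnorm mu (fun x => f x - g x) + 2 * sqnorm mu (fun x => f x - h x).
Proof.
move=> f2 g2 h2; have fg := L2_nrm2 (L2B f2 g2); have fh := L2_nrm2 (L2B f2 h2).
have gh := L2_nrm2 (L2B g2 h2).
have m2 := L2_nrm2 (L2B f2 (L2Z 2^-1 (L2D g2 h2))).
rewrite !sqnormE -!rintZ// -!rintD//; [|exact: rintegrableZ..].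
apply: eq_Rintegral => x _.
have -> : f x - 2^-1 * (g x + h x) = (2^-1 : R)%:C%C * ((f x - g x) + (f x - h x)).
  have -> : (2^-1 : R)%:C%C = 2^-1 :> R[i] by rewrite fmorphV/= rmorph_nat.
  by field.
by rewrite nrm2M {2}/nrm2 /= /nrm2 !ReImE; field.
Qed.

(** Projection theorem. A minimising sequence of combinations converges by the parallelogram
    identity, and f minus its limit is orthogonal to S. The hypothesis then makes this difference
    orthogonal to f, hence to itself. *)
Lemma closed_span_dual f : L2 mu f ->
  (forall h, L2 mu h -> (forall s, S s -> inner mu s h = 0) -> inner mu f h = 0) ->
  closed_span mu S f.
Proof.
move=> f2 fS; apply/closed_spanP => delta delta0; apply: contrapT => nex.
have far g : lspan g -> delta <= sqnorm mu (fun x => f x - g x).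
  by move=> gS; rewrite leNgt; apply/negP => lt; apply: nex; exists g.
pose E : set R := [set sqnorm mu (fun x => f x - g x) | g in lspan].
have E0 : has_inf E.
  split; first by exists (sqnorm mu (fun x => f x - 0)); exists (fun=> 0) => //; exact: lspan0.
  by exists delta => _ [g gS <-]; exact: far.
pose D := inf E.
have leD g : lspan g -> D <= sqnorm mu (fun x => f x - g x).
  by move=> gS; apply: ge_inf; [case: E0|exists g].
(* The parallelogram identity bounds consecutive increments by [4 * e n], that is by the rate
   [4^-1 ^+ n] of [L2_complete]. *)
pose e n : R := 4^-1 * 4^-1 ^+ n.
have e0 n : 0 < e n by rewrite mulr_gt0// ?exprn_gt0// invr_gt0.
have gP n : {g | lspan g /\ sqnorm mu (fun x => f x - g x) < D + e n}.
  by apply: cid; have [_ [g gS <-] ?] := inf_adherent (e0 n) E0; exists g.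
pose g n := sval (gP n).
have gS n : lspan (g n) by rewrite /g; case: (gP n) => ? [].
have gD n : sqnorm mu (fun x => f x - g n x) < D + e n by rewrite /g; case: (gP n) => ? [].
have g2 n := lspan_L2 (gS n).
have [|k k2 gk] := L2_complete g2.
  move=> n; have := sqnorm_parallelogram f2 (g2 n.+1) (g2 n).
  have := leD _ (lspanZ 2^-1 (lspanD (gS n.+1) (gS n))).
  have := gD n; have := gD n.+1.
  have : e n.+1 <= e n.
    by rewrite /e exprS mulrCA ler_piMl// ?mulr_ge0 ?exprn_ge0 ?invr_ge0//; lra.
  have : 4 * e n = 4^-1 ^+ n by rewrite /e; field.
  by move=> <-; move: (e n) (e n.+1) => u v; lra.
pose h x := f x - k x.
have h2 : L2 mu h by exact: L2B.
(* Moving [g n] by the optimal multiple of s cannot bring the squared distance below the infimum D,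
   so the inner product with s is controlled by the excess [e n]. *)
have near_orth s n : lspan s -> nrm2 (inner mu (fun x => f x - g n x) s) <= e n * sqnorm mu s.
  move=> sS; have s2 := lspan_L2 sS.
  set w := inner _ _ _.
  have fg2 : L2 mu (fun x => f x - g n x) by exact: L2B.
  have [s_gt0|s_le0] := ltP 0 (sqnorm mu s); last first.
    have s0 : sqnorm mu s = 0 by apply/eqP; rewrite eq_le s_le0 sqnorm_ge0.
    by have := cauchy_schwarz fg2 s2; rewrite s0 !mulr0.
  pose c : R[i] := (sqnorm mu s)^-1%:C%C * w.
  have := leD _ (lspanD (gS n) (lspanZ c sS)).
  have -> : (fun x => f x - (g n x + c * s x)) = (fun x => (f x - g n x) - c * s x).
    by apply/funext => x; rewrite opprD addrA.
  rewrite sqnormB_expand// -/w nrm2M.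
  have := gD n; move: (sqnorm mu (fun x => f x - g n x)) => A.
  have -> : complex.Re (c^* * w) = (sqnorm mu s)^-1 * nrm2 w.
    by rewrite /c /nrm2 !ReImE /=; ring.
  have -> : nrm2 (sqnorm mu s)^-1%:C%C = (sqnorm mu s)^-1 ^+ 2.
    by rewrite /nrm2 /= expr0n addr0.
  move: (sqnorm mu s) s_gt0 => B B0 AD.
  have -> : B^-1 ^+ 2 * nrm2 w * B = nrm2 w / B by field; lra.
  rewrite [B^-1 * _]mulrC -ler_pdivrMr//; move: AD; move: (nrm2 w / B) (e n) => q en.
  by lra.
have hS s : S s -> inner mu s h = 0.
  move=> /[dup] Ss /lspan_gen sS; have s2 := lspan_L2 sS.
  rewrite innerC// (_ : inner mu h s = 0) ?rmorph0//.
  have := inner_cvg g2 k2 s2 gk => c1.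
  have c2 : ccvg (fun n => inner mu (g n) s) (inner mu f s).
    apply: ccvg_nrm2P.
    apply: (@squeeze_cvgr _ _ _ _ (fun=> 0) (fun n => e n * sqnorm mu s)).
    - near=> n; rewrite nrm2_ge0/= -nrm2N opprB -innerBl//; exact: near_orth.
    - exact: cvg_cst.
    - rewrite -[X in _ --> X](mul0r (sqnorm mu s)); apply: cvgMl.
      rewrite -[X in _ --> X](mulr0 (4^-1 : R)); apply: cvgMr; apply: cvg_expr.
      by rewrite ger0_norm// ?invr_ge0//; lra.
  by rewrite /h innerBl// (ccvg_unique c1 c2) subrr.
have fh0 := fS h h2 hS.
have kh0 : inner mu k h = 0.
  have := inner_cvg g2 k2 h2 gk; rewrite (_ : (fun n => _) = (fun=> 0)); last first.
    by apply/funext => n; rewrite lspan_orth.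
  by move=> /ccvg_unique; apply; exact: ccvg_cst.
have hh0 : sqnorm mu h = 0.
  by rewrite /sqnorm {1}/h innerBl// fh0 kh0 subrr.
have [n _ ] : \forall n \near \oo, sqnorm mu (fun x => g n x - k x) < delta / 2.
  by apply: cvgr_lt gk _ _; lra.
move=> /(_ n (leqnn n)) /= gkn.
have := far _ (gS n).
have -> : (fun x => f x - g n x) = (fun x => h x - (g n x - k x)).
  by apply/funext => x; rewrite /h; ring.
have := sqnormB_le h2 (L2B (g2 n) k2); rewrite hh0; lra.
Unshelve. all: end_near. Qed.

End Span.
End Hilbert.

Section GramIsometry.
Context d1 (Y1 : measurableType d1) d2 (Y2 : measurableType d2) (R : realType).
Variables (mu1 : {measure set Y1 -> \bar R}) (mu2 : {measure set Y2 -> \bar R}).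
Variables (J : Type) (a : J -> Y1 -> R[i]) (b : J -> Y2 -> R[i]).

Definition same_gram := [/\ forall j, L2 mu1 (a j), forall j, L2 mu2 (b j) &
  forall j k, inner mu1 (a j) (a k) = inner mu2 (b j) (b k)].

(** The graph of the unitary operator sending [a j] to [b j], described by coefficients. No quotient
    by null sets is formed: the relation is compatible with equality almost everywhere. *)
Definition corresp (f : Y1 -> R[i]) (g : Y2 -> R[i]) := [/\ L2 mu1 f, L2 mu2 g &
  forall j, inner mu1 f (a j) = inner mu2 g (b j)].

(** Totality is stated through orthogonal complements, the form in which uniqueness of Fourier
    coefficients provides it; [total_closed_span] turns it into density. *)
Definition total d (Y : measurableType d) (mu : {measure set Y -> \bar R})
    (I : Type) (v : I -> Y -> R[i]) :=
  forall h, L2 mu h -> (forall j, inner mu (v j) h = 0) -> {ae mu, forall x, h x = 0}.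

Lemma total_closed_span d (Y : measurableType d) (mu : {measure set Y -> \bar R})
    (I : Type) (v : I -> Y -> R[i]) f : (forall j, L2 mu (v j)) ->
  total mu v -> L2 mu f -> closed_span mu (range v) f.
Proof.
move=> v2 tv f2; apply: closed_span_dual => // [_ [j _ <-]//|h h2 hv].
rewrite innerC// inner_ae0 ?rmorph0//; apply: tv => // j.
by apply: hv; exists j.
Qed.

(** The coefficients and indices are bundled apart from the family, so that one combination can be
    evaluated on both families of a Gram isometry. *)
Definition comb d (Y : measurableType d) (I : Type) (v : I -> Y -> R[i])
    (p : {n & ('I_n -> R[i]) * ('I_n -> I)}%type) : Y -> R[i] :=
  fun x => \sum_(i < projT1 p) (projT2 p).1 i * v ((projT2 p).2 i) x.

Lemma comb_L2 d (Y : measurableType d) (mu : {measure set Y -> \bar R})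
    (I : Type) (v : I -> Y -> R[i]) p : (forall j, L2 mu (v j)) -> L2 mu (comb v p).
Proof. by move=> v2; apply: L2_sum => i; exact: L2Z. Qed.

Lemma inner_comb d (Y : measurableType d) (mu : {measure set Y -> \bar R})
    (I : Type) (v : I -> Y -> R[i]) p h : (forall j, L2 mu (v j)) -> L2 mu h ->
  inner mu (comb v p) h =
  \sum_(i < projT1 p) (projT2 p).1 i * inner mu (v ((projT2 p).2 i)) h.
Proof.
move=> v2 h2; rewrite inner_suml// => [|i]; last exact: L2Z.
by apply: eq_bigr => i _; rewrite innerZl.
Qed.

Lemma total_comb d (Y : measurableType d) (mu : {measure set Y -> \bar R})
    (I : Type) (v : I -> Y -> R[i]) f : (forall j, L2 mu (v j)) -> total mu v ->
  L2 mu f ->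
  exists p : nat -> {n & ('I_n -> R[i]) * ('I_n -> I)}%type,
    forall n, sqnorm mu (fun x => f x - comb v (p n) x) <= 8^-1 ^+ n.+1.
Proof.
move=> v2 tv f2; have := total_closed_span v2 tv f2.
move=> /(closed_span_seq f2)[g gS gf].
have pP n : {p | g n = comb v p}.
  apply: cid; have [m [c [s [Ss ->]]]] := gS n.
  have tP i : {t | v t = s i} by apply: cid; have [t _ ?] := Ss i; exists t.
  exists (existT _ m (c, fun i => sval (tP i))); apply/funext => x.
  by apply: eq_bigr => i _ /=; rewrite (svalP (tP i)).
by exists (fun n => sval (pP n)) => n; rewrite -(svalP (pP n)).
Qed.

Hypothesis gram : same_gram.
Hypotheses (ta : total mu1 a) (tb : total mu2 b).

Let a2 j : L2 mu1 (a j). Proof. by case: gram. Qed.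
Let b2 j : L2 mu2 (b j). Proof. by case: gram. Qed.

Lemma inner_comb_gram p q :
  inner mu1 (comb a p) (comb a q) = inner mu2 (comb b p) (comb b q).
Proof.
case: gram => _ _ ab; rewrite !inner_comb//; [|exact: comb_L2..].
apply: eq_bigr => i _; congr (_ * _); rewrite innerC ?[RHS]innerC//; try exact: comb_L2.
by congr (_ ^*); rewrite !inner_comb//; apply: eq_bigr => j _; rewrite ab.
Qed.

Lemma sqnormB_inner d (Y : measurableType d) (mu : {measure set Y -> \bar R})
    (f g : Y -> R[i]) : L2 mu f -> L2 mu g ->
  sqnorm mu (fun x => f x - g x) =
  complex.Re (inner mu f f - inner mu f g - (inner mu g f - inner mu g g)).
Proof.
by move=> f2 g2; rewrite /sqnorm innerBl ?innerBr//; exact: L2B.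
Qed.

Lemma sqnorm_comb_gram p q : sqnorm mu1 (fun x => comb a p x - comb a q x) =
  sqnorm mu2 (fun x => comb b p x - comb b q x).
Proof.
by rewrite !sqnormB_inner ?inner_comb_gram//; exact: comb_L2.
Qed.

(** Equal Gram matrices make combinations of the [a j] and of the [b j] isometric, so a fast
    approximation on the first side is a fast Cauchy sequence on the second. *)
Lemma corresp_lim f p : L2 mu1 f ->
  (forall n, sqnorm mu1 (fun x => f x - comb a (p n) x) <= 8^-1 ^+ n.+1) ->
  exists2 g, corresp f g &
    sqnorm mu2 (fun x => comb b (p n) x - g x) @[n --> \oo] --> (0:R).
Proof.
move=> f2 fp; have pa2 n : L2 mu1 (comb a (p n)) by exact: comb_L2.
have pb2 n : L2 mu2 (comb b (p n)) by exact: comb_L2.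
have [|g g2 pg] := L2_complete pb2.
  move=> n; rewrite -sqnorm_comb_gram.
  rewrite (_ : (fun x => _) = fun x => (f x - comb a (p n) x) - (f x - comb a (p n.+1) x));
    last first.
    by apply/funext => x; ring.
  apply: le_trans (sqnormB_le _ _) _; [exact: L2B|exact: L2B|].
  have := fp n; have := fp n.+1.
  have h : 8^-1 ^+ n.+2 <= 8^-1 ^+ n.+1 :> R.
    by rewrite [leLHS]exprS ler_piMl ?exprn_ge0 ?invr_ge0//; lra.
  have : 4 * 8^-1 ^+ n.+1 <= 4^-1 ^+ n :> R.
    rewrite exprS mulrA; have : 8^-1 ^+ n <= 4^-1 ^+ n :> R.
      by rewrite lerXn2r ?nnegrE//; lra.
    have : 0 <= 8^-1 ^+ n :> R by rewrite exprn_ge0// invr_ge0.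
    lra.
  by move: h; move: (8^-1 ^+ n.+1) (8^-1 ^+ n.+2) => u v; lra.
exists g => //; split => // j.
have c1 := inner_cvg pa2 f2 (a2 j) (sqnorm_squeeze fp).
have c2 := inner_cvg pb2 g2 (b2 j) pg.
apply: (ccvg_unique c1); rewrite (_ : (fun n => _) = (fun n => inner mu2 (comb b (p n)) (b j)))//.
apply/funext => n; rewrite !inner_comb//.
by case: gram => _ _ ab; apply: eq_bigr => i _; rewrite ab.
Qed.

Lemma corresp_ex f : L2 mu1 f -> exists g, corresp f g.
Proof.
move=> f2; have [p fp] := total_comb a2 ta f2.
by have [g fg _] := corresp_lim f2 fp; exists g.
Qed.

Lemma corresp_ae f g g' : corresp f g -> corresp f g' -> {ae mu2, forall x, g x = g' x}.
Proof.
move=> [_ g2 fg] [_ g2' fg'].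
have : {ae mu2, forall x, g x - g' x = 0}.
  apply: (tb (L2B g2 g2')) => j; rewrite innerC//; last exact: L2B.
  by rewrite innerBl// -fg fg' subrr rmorph0.
by apply: filterS => x /subr0_eq.
Qed.

(** Unitarity of the correspondence. A relation gives coefficients only on the generators; they
    determine inner products with combinations, and approximating g by combinations passes to the
    limit. *)
Lemma inner_corresp f f' g g' : corresp f f' -> corresp g g' ->
  inner mu1 f g = inner mu2 f' g'.
Proof.
move=> [f2 f2' ff] gg; have [g2 g2' _] := gg.
have [p gp] := total_comb a2 ta g2.
have [k gk pk] := corresp_lim g2 gp.
have [_ k2 _] := gk.
have c1 := inner_cvg (fun n => comb_L2 (p n) a2) g2 f2 (sqnorm_squeeze gp).
have c2 := inner_cvg (fun n => comb_L2 (p n) b2) k2 f2' pk.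
have e : inner mu1 g f = inner mu2 k f'.
  apply: (ccvg_unique c1); rewrite (_ : (fun n => _) = (fun n => inner mu2 (comb b (p n)) f'))//.
  apply/funext => n; rewrite !inner_comb//; apply: eq_bigr => i _; congr (_ * _).
  by rewrite innerC// ff -innerC.
rewrite (innerC g2 f2) e -innerC//.
apply: cint_ae; [exact: (cintegrable_meas (L2_cintegrable f2' k2))|
  exact: (cintegrable_meas (L2_cintegrable f2' g2'))|].
by apply: filterS (corresp_ae gk gg) => x ->.
Qed.

Lemma corresp_gen j : corresp (a j) (b j).
Proof. by case: gram => _ _ ab; split. Qed.

End GramIsometry.

Lemma corresp_sym d1 (Y1 : measurableType d1) d2 (Y2 : measurableType d2)
    (R : realType) (mu1 : {measure set Y1 -> \bar R})
    (mu2 : {measure set Y2 -> \bar R}) (J : Type) (a : J -> Y1 -> R[i])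
    (b : J -> Y2 -> R[i]) f g : corresp mu1 mu2 a b f g -> corresp mu2 mu1 b a g f.
Proof. by case=> f2 g2 fg; split. Qed.

Lemma same_gram_sym d1 (Y1 : measurableType d1) d2 (Y2 : measurableType d2)
    (R : realType) (mu1 : {measure set Y1 -> \bar R})
    (mu2 : {measure set Y2 -> \bar R}) (J : Type) (a : J -> Y1 -> R[i])
    (b : J -> Y2 -> R[i]) : same_gram mu1 mu2 a b -> same_gram mu2 mu1 b a.
Proof. by case=> a2 b2 ab; split. Qed.

(** * A functional monotone class theorem *)

Section BoundedlyClosed.
Context d (T : measurableType d) (R : realType).

(** Membership in such a class propagates from trigonometric functions to Borel indicators. The
    properties to be propagated are limits or identities of integrals, to which dominated
    convergence applies. *)
Definition boundedly_closed (B : set (T -> R)) :=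
  (forall c f g, B f -> B g -> B (fun x => c * f x + g x)) /\
  (forall (f_ : nat -> T -> R) (f : T -> R) (C : R), (forall n, B (f_ n)) ->
    (forall n x, `|f_ n x| <= C) -> (forall x, f_ n x @[n --> \oo] --> f x) -> B f).

Variable B : set (T -> R).
Hypothesis Bcl : boundedly_closed B.

(** The zero function is not given beforehand, so the multiple is reached as [(c - 1) * f + f]. *)
Lemma boundedly_closedZ c f : B f -> B (fun x => c * f x).
Proof.
move=> Bf; have [lin _] := Bcl.
rewrite (_ : (fun x => _) = (fun x => (c - 1) * f x + f x)); first exact: lin.
by apply/funext => x; ring.
Qed.

Lemma boundedly_closedD f g : B f -> B g -> B (fun x => f x + g x).
Proof.
move=> Bf Bg; have [lin _] := Bcl; have := lin 1 f g Bf Bg.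
by under eq_fun do rewrite mul1r.
Qed.

Lemma boundedly_closedB f g : B f -> B g -> B (fun x => f x - g x).
Proof.
move=> Bf Bg; have [lin _] := Bcl; have := lin (-1) g f Bg Bf.
by under eq_fun do rewrite mulN1r addrC.
Qed.

Lemma indic_eventually_cvg (F : nat -> set T) (E : set T) x :
  (\forall n \near \oo, F n x <-> E x) -> \1_(F n) x @[n --> \oo] --> (\1_E x : R).
Proof.
move=> FE; apply: cvg_near_cst; apply: filterS FE => n FE.
by rewrite !indicE; congr (nat_of_bool _)%:R; apply/idP/idP; rewrite !inE => /FE.
Qed.

Lemma boundedly_closed_indic (G : set (set T)) : @measurable _ T = <<s G >> ->
  setI_closed G -> B (cst 1) -> (forall A, G A -> B (\1_A)) ->
  forall A, measurable A -> B (\1_A).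
Proof.
move=> GT GI B1 BG A; rewrite GT.
apply: (dynkin_induction (P := fun A => B (\1_A)) GT GI) => //.
- by rewrite indicT.
- move=> S mS BS; rewrite (_ : \1_(~` S) = (fun x => cst 1 x - \1_S x :> R)).
    exact: boundedly_closedB.
  apply/funext => x; rewrite !indicE in_setC; case: (x \in S) => /=; ring.
- move=> F mF tF BF.
  have BU n : B (\1_(\big[setU/set0]_(k < n) F k)).
    elim: n => [|n ih].
      rewrite big_ord0 (_ : \1_set0 = (fun x => 0 * cst 1 x)).
        exact: boundedly_closedZ.
      by apply/funext => x; rewrite indicE in_set0 mul0r.
    rewrite big_ord_recr/= (_ : \1_(_ `|` _) = (fun x =>
       \1_(\big[setU/set0]_(k < n) F k) x + \1_(F n) x :> R)).
      exact: boundedly_closedD.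
    apply/funext => x; rewrite !indicE in_setU.
    have [xF|xF] := boolP (x \in F n); last by rewrite orbF addr0.
    rewrite orbT (_ : (x \in _) = false) ?add0r//.
    apply/negbTE/negP; rewrite inE -bigcup_mkord => -[k /= kn Fk].
    have := tF k n I I; rewrite (_ : k = n)// in kn; first by rewrite ltnn in kn.
    by apply: tF => //; exists x; split => //; exact: set_mem.
  have [_ lim] := Bcl.
  apply: (lim (fun n => \1_(\big[setU/set0]_(k < n) F k)) _ 1) => //.
    by move=> n x; rewrite indicE; case: (_ \in _); rewrite ?normr1 ?normr0.
  move=> x; apply: indic_eventually_cvg.
  have [[k _ Fk]|nF] := pselect ((\bigcup_k F k) x).
    exists k.+1 => // n /= kn; split=> _; first by exists k.
    by rewrite -bigcup_mkord; exists k.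
  by near=> n; split=> // ; rewrite -bigcup_mkord => -[k _ Fk]; exists k.
Unshelve. all: end_near. Qed.

End BoundedlyClosed.

(** * Indicators of half-lines and Borel sets from trigonometric polynomials *)

Section Trigonometric.
Context (R : realType).
Local Notation MR := (measurableTypeR R).

(** Only rational frequencies are allowed. A property then has to be checked on countably many
    characters, which is what allows a sequence of times to be extracted from a weak closure. *)
Inductive trigpoly : (MR -> R) -> Prop :=
| trigpoly_cos (q : rat) : trigpoly (fun x => cos (ratr q * x))
| trigpoly_sin (q : rat) : trigpoly (fun x => sin (ratr q * x))
| trigpoly_lin c f g : trigpoly f -> trigpoly g -> trigpoly (fun x => c * f x + g x).

Lemma trigpoly1 : trigpoly (fun=> 1).
Proof.
by have := trigpoly_cos 0; under eq_fun do rewrite rmorph0 mul0r cos0.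
Qed.

Lemma trigpolyZ c f : trigpoly f -> trigpoly (fun x => c * f x).
Proof.
move=> tf; rewrite (_ : (fun x => _) = (fun x => (c - 1) * f x + f x)).
  exact: trigpoly_lin.
by apply/funext => x; ring.
Qed.

Lemma trigpolyD f g : trigpoly f -> trigpoly g -> trigpoly (fun x => f x + g x).
Proof.
by move=> tf tg; have := trigpoly_lin 1 tf tg; under eq_fun do rewrite mul1r.
Qed.

Lemma trigpolyB f g : trigpoly f -> trigpoly g -> trigpoly (fun x => f x - g x).
Proof.
by move=> tf tg; have := trigpoly_lin (-1) tg tf; under eq_fun do rewrite mulN1r addrC.
Qed.

Lemma trigpolyM f g : trigpoly f -> trigpoly g -> trigpoly (fun x => f x * g x).
Proof.
move=> tf tg; elim: tf => [p|p|c f1 f2 _ ih1 _ ih2]; last first.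
- rewrite (_ : (fun x => _) = (fun x => c * (f1 x * g x) + f2 x * g x)).
    exact: trigpoly_lin.
  by apply/funext => x; ring.
- elim: tg => [q|q|c g1 g2 _ ih1 _ ih2]; last first.
  + rewrite (_ : (fun x => _) = (fun x => c * (sin (ratr p * x) * g1 x) +
        sin (ratr p * x) * g2 x)); first exact: trigpoly_lin.
    by apply/funext => x; ring.
  + rewrite (_ : (fun x => _) = (fun x => 2^-1 * (cos (ratr (p - q) * x) -
        cos (ratr (p + q) * x)))).
      by apply: trigpolyZ; apply: trigpolyB; exact: trigpoly_cos.
    by apply/funext => x; rewrite rmorphB rmorphD/= mulrBl mulrDl cosB cosD; field.
  + rewrite (_ : (fun x => _) = (fun x => 2^-1 * (sin (ratr (p - q) * x) +
        sin (ratr (p + q) * x)))).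
      by apply: trigpolyZ; apply: trigpolyD; exact: trigpoly_sin.
    by apply/funext => x; rewrite rmorphB rmorphD/= mulrBl mulrDl sinB sinD; field.
- elim: tg => [q|q|c g1 g2 _ ih1 _ ih2]; last first.
  + rewrite (_ : (fun x => _) = (fun x => c * (cos (ratr p * x) * g1 x) +
        cos (ratr p * x) * g2 x)); first exact: trigpoly_lin.
    by apply/funext => x; ring.
  + rewrite (_ : (fun x => _) = (fun x => 2^-1 * (sin (ratr (p + q) * x) -
        sin (ratr (p - q) * x)))).
      by apply: trigpolyZ; apply: trigpolyB; exact: trigpoly_sin.
    by apply/funext => x; rewrite rmorphB rmorphD/= mulrBl mulrDl sinB sinD; field.
  + rewrite (_ : (fun x => _) = (fun x => 2^-1 * (cos (ratr (p - q) * x) +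
        cos (ratr (p + q) * x)))).
      by apply: trigpolyZ; apply: trigpolyD; exact: trigpoly_cos.
    by apply/funext => x; rewrite rmorphB rmorphD/= mulrBl mulrDl cosB cosD; field.
Qed.

Lemma trigpolyX f n : trigpoly f -> trigpoly (fun x => f x ^+ n).
Proof.
move=> tf; elim: n => [|n ih].
  by under eq_fun do rewrite expr0; exact: trigpoly1.
by under eq_fun do rewrite exprS; exact: trigpolyM.
Qed.

Lemma bernoulli (t : R) n : -1 <= t -> 1 + n%:R * t <= (1 + t) ^+ n.
Proof.
move=> t1; elim: n => [|n ih]; first by rewrite mul0r addr0 expr0.
rewrite exprS; have : (1 + t) * (1 + n%:R * t) <= (1 + t) * (1 + t) ^+ n.
  by rewrite ler_wpM2l//; lra.
apply: le_trans; rewrite -natr1; have := sqr_ge0 t; have := ler0n R n.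
by nra.
Qed.

(* Tends to 1 for [0 <= y < 1/2] and to 0 for [1/2 <= y <= 1], by the two
   Bernoulli bounds on [(1 - y ^+ n) ^+ (n * 2 ^ n)]. *)
Definition step_poly n (y : R) := (1 - y ^+ n) ^+ (n * 2 ^ n).

Lemma step_poly_01 n y : 0 <= y <= 1 -> 0 <= step_poly n y <= 1.
Proof.
move=> /andP[y0 y1]; have y01 : 0 <= 1 - y ^+ n <= 1.
  by rewrite subr_ge0 exprn_ile1//= gerBl exprn_ge0.
by case/andP: y01 => a b; rewrite /step_poly exprn_ge0//= exprn_ile1.
Qed.

(** With s the square root of r, [n%:R * s ^+ n] stays below [(1 - s)^-1], and the other factor
    [s ^+ n] tends to 0. *)
Lemma natr_expr_cvg0 (r : R) : 0 <= r < 1 -> n%:R * r ^+ n @[n --> \oo] --> (0:R).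
Proof.
move=> /andP[r0 r1]; pose s := Num.sqrt r.
have s0 : 0 <= s by exact: sqrtr_ge0.
have s1 : s < 1 by rewrite -sqrtr1 ltr_sqrt.
have rs : r = s * s by rewrite -expr2 sqr_sqrtr.
have ns n : n%:R * s ^+ n <= (1 - s)^-1.
  rewrite -[leLHS](mulfK (_ : 1 - s != 0)); last by lra.
  rewrite ler_piMl ?invr_ge0 ?subr_ge0 ?(ltW s1)//.
  have : n%:R * s ^+ n * (1 - s) <= 1 - s ^+ n.
    elim: n => [|n]; first by rewrite !mul0r expr0 subrr.
    rewrite -natr1 exprS; have := exprn_ge0 n s0; have := ler0n R n.
    move: (n%:R) (s ^+ n) => a b a0 b0 ?.
    have : s * (a * b * (1 - s)) <= s * (1 - b) by rewrite ler_wpM2l.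
    have : 0 <= b * (1 - s) * (1 - s) by rewrite !mulr_ge0//; lra.
    by nra.
  by move/le_trans; apply; rewrite gerBl exprn_ge0.
apply: (@squeeze_cvgr _ _ _ _ (fun=> 0) (fun n => (1 - s)^-1 * s ^+ n)).
- near=> n; rewrite mulr_ge0 ?exprn_ge0//= rs exprMn mulrA ler_wpM2r//.
  exact: exprn_ge0.
- exact: cvg_cst.
- rewrite -[X in _ --> X](mulr0 (1 - s)^-1); apply: cvgMr; apply: cvg_expr.
  by rewrite ger0_norm.
Unshelve. all: end_near. Qed.

Lemma step_poly_cvg1 y : 0 <= y < 2^-1 -> step_poly n y @[n --> \oo] --> (1:R).
Proof.
move=> /andP[y0 y2]; apply: (@squeeze_cvgr _ _ _ _ (fun n => 1 - n%:R * (2 * y) ^+ n) (fun=> 1)).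
- near=> n; apply/andP; split; last by have /andP[] : 0 <= step_poly n y <= 1 by apply:
  step_poly_01; lra.
  apply: le_trans (@bernoulli (- y ^+ n) _ _); last by rewrite lerN2 exprn_ile1//; lra.
  by rewrite natrM natrX exprMn mulrN mulrA.
- rewrite -[X in _ --> X](subr0 (1:R)); apply: cvgB; first exact: cvg_cst.
  by apply: natr_expr_cvg0; lra.
- exact: cvg_cst.
Unshelve. all: end_near. Qed.

Lemma step_poly_cvg0 y : 2^-1 <= y <= 1 -> step_poly n y @[n --> \oo] --> (0:R).
Proof.
move=> /andP[y2 y1]; have y0 : 0 <= y by lra.
apply: (@squeeze_cvgr _ _ _ _ (fun=> 0) (fun n => n.+1%:R^-1)).
- near=> n; have /andP[-> _]/= : 0 <= step_poly n y <= 1 by apply: step_poly_01; lra.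
  set t := y ^+ n; have t0 : 0 <= t by exact: exprn_ge0.
  have t1 : t <= 1 by exact: exprn_ile1.
  (* Since 2y >= 1, Bernoulli makes [(1 + t) ^+ (n * 2 ^ n)] at least n + 1, while the product of
     the powers of 1 - t and 1 + t is at most 1. *)
  have h : n%:R <= (n * 2 ^ n)%:R * t.
    rewrite natrM natrX -mulrA ler_peMr// /t -exprMn exprn_ege1//; lra.
  have := @bernoulli t (n * 2 ^ n) (le_trans (lerN10 R) t0).
  rewrite /step_poly -/t => b.
  rewrite -[leLHS]mulr1 -[leRHS]mul1r ler_pdivlMr ?ltr0n// mulr1.
  apply: (@le_trans _ _ ((1 - t) ^+ (n * 2 ^ n) * (1 + t) ^+ (n * 2 ^ n))).
    rewrite ler_wpM2l ?exprn_ge0 ?subr_ge0//; apply: le_trans b.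
    by rewrite -natr1 addrC lerD2l.
  by rewrite -exprMn exprn_ile1//; nra.
- exact: cvg_cst.
- exact: cvg_harmonic.
Unshelve. all: end_near. Qed.

Variable B : set (MR -> R).
Hypothesis Bcl : boundedly_closed B.
Hypothesis Bcos : forall q : rat, B (fun x => cos (ratr q * x)).
Hypothesis Bsin : forall q : rat, B (fun x => sin (ratr q * x)).

Lemma trigpoly_sub f : trigpoly f -> B f.
Proof.
by elim=> // c f1 f2 _ Bf1 _ Bf2; case: Bcl => lin _; exact: lin.
Qed.

(** [step_poly] at (1 + sin) / 2 converges to the indicator of a negative sine. For a sine of large
    period centred at a, its sign at a given x is eventually the sign of x - a. The frequency
    [M.+1%:R^-1] is rational; the possibly irrational phase enters only as coefficients, through the
    addition formula. *)
Lemma boundedly_closed_lt (a : R) : B (\1_[set x | x < a]).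
Proof.
have [_ lim] := Bcl.
have BM (M : nat) : B (\1_[set x : MR | sin ((x - a) / M.+1%:R) < 0]).
  pose y x : R := 2^-1 * (1 + sin ((x - a) / M.+1%:R)).
  have y01 x : 0 <= y x <= 1.
    have := sin_geN1 ((x - a) / M.+1%:R); have := sin_le1 ((x - a) / M.+1%:R).
    by rewrite /y; lra.
  apply: (lim (fun n x => step_poly n (y x)) _ 1).
  - move=> n; apply: trigpoly_sub; apply: trigpolyX; apply: trigpolyB.
      exact: trigpoly1.
    apply: trigpolyX; apply: trigpolyZ; apply: trigpolyD; first exact: trigpoly1.
    rewrite (_ : (fun x => _) = (fun x => cos (a / M.+1%:R) * sin (ratr M.+1%:R^-1 * x)
        - sin (a / M.+1%:R) * cos (ratr M.+1%:R^-1 * x))).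
      by apply: trigpolyB; apply: trigpolyZ; [exact: trigpoly_sin|exact: trigpoly_cos].
    apply/funext => x; rewrite mulrBl sinB fmorphV/= ratr_nat.
    by rewrite ![_^-1 * x]mulrC; ring.
  - by move=> n x; have /andP[h0 h1] := step_poly_01 n (y01 x); rewrite ger0_norm.
  - move=> x; rewrite indicE; have [s0|s0] := ltP (sin ((x - a) / M.+1%:R)) 0.
      rewrite mem_set//; apply: step_poly_cvg1.
      by have := y01 x; rewrite /y; lra.
    rewrite memNset/=; last by apply/negP; rewrite -leNgt.
    apply: step_poly_cvg0; have := y01 x; rewrite /y; lra.
apply: (lim (fun M => \1_[set x : MR | sin ((x - a) / M.+1%:R) < 0]) _ 1) => //.
  by move=> n x; rewrite indicE; case: (_ \in _); rewrite ?normr1 ?normr0.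
move=> x; apply: indic_eventually_cvg => /=.
have [->|xa] := eqVneq x a.
  by near=> n; rewrite subrr mul0r sin0 !ltxx.
near=> n.
have n0 : 0 < n.+1%:R :> R by rewrite ltr0n.
have npi : `|x - a| < pi * n.+1%:R.
  rewrite -ltr_pdivrMl ?pi_gt0// -natr1 ltr_pwDr//.
  by near: n; exact: nbhs_infty_ger.
have [ax|xlea] := ltP a x.
  have : 0 < sin ((x - a) / n.+1%:R).
    apply: sin_gt0_pi; rewrite divr_gt0 ?subr_gt0//= ltr_pdivrMr//.
    by rewrite (le_lt_trans (ler_norm _) npi).
  by move=> ?; split => ?; lra.
have {xlea}xlta : x < a by rewrite lt_neqAle xa.
have : 0 < sin ((a - x) / n.+1%:R).
  apply: sin_gt0_pi; rewrite divr_gt0 ?subr_gt0//= ltr_pdivrMr//.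
  by rewrite (le_lt_trans (ler_norm _))// distrC.
by rewrite -(opprB x a) mulNr sinN => ?; split => ?; lra.
Unshelve. all: end_near. Qed.

Lemma boundedly_closed_borel (A : set MR) : measurable A -> B (\1_A).
Proof.
have B1 : B (cst 1).
  by have := Bcos 0; under eq_fun do rewrite rmorph0 mul0r cos0.
have Ble (a : R) : B (\1_[set x | x <= a]).
  have [_ lim] := Bcl.
  apply: (lim (fun n => \1_[set x : MR | x < a + n.+1%:R^-1]) _ 1).
  - by move=> n; exact: boundedly_closed_lt.
  - by move=> n x; rewrite indicE; case: (_ \in _); rewrite ?normr1 ?normr0.
  - move=> x; apply: indic_eventually_cvg => /=.
    have [xa|ax] := leP x a.
      by near=> n; split => // _; rewrite (le_lt_trans xa)// ltrDl invr_gt0 ltr0n.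
    near=> n; split=> //.
    rewrite -ltrBlDl => h; have : n.+1%:R^-1 < x - a.
      near: n; apply: (cvgr_lt (0:R)); last by rewrite subr_gt0.
      exact: cvg_harmonic.
    by move/(lt_trans h); rewrite ltxx.
move=> mA; apply: (boundedly_closed_indic Bcl (G := @ocitv R) _ _ B1 _ mA) => //.
  exact: ocitvI.
move=> A' /ocitvP [->|[[a b] /= ab ->]].
  rewrite (_ : \1_set0 = (fun x => 0 * cst 1 x)); first exact: (boundedly_closedZ Bcl).
  by apply/funext => x; rewrite indicE in_set0 mul0r.
rewrite (_ : \1__ = (fun x => \1_[set x | x <= b] x - \1_[set x | x <= a] x :> R)).
  exact: (boundedly_closedB Bcl).
apply/funext => x; rewrite !indicE.
have -> : (x \in `]a, b]%classic) = (a < x <= b) by apply/idP/idP; rewrite inE/= in_itv.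
have le_in c : (x \in [set x : MR | x <= c]) = (x <= c) by apply/idP/idP; rewrite inE.
rewrite !le_in; have [ax|xa] /= := ltP a x; first by rewrite subr0.
by rewrite (le_trans xa (ltW ab)) subrr.
Unshelve. all: end_near. Qed.

End Trigonometric.

(** * Borel sets of the plane *)

Section Plane.
Context (R : realType).
Local Notation MR := (measurableTypeR R).
Variable B : set (MR * MR -> R).
Hypothesis Bcl : boundedly_closed B.
Hypothesis Bcos : forall p q : rat, B (fun z => cos (ratr p * z.1 + ratr q * z.2)).
Hypothesis Bsin : forall p q : rat, B (fun z => sin (ratr p * z.1 + ratr q * z.2)).

Lemma boundedly_closed_slice1 (g : MR -> R) C : (forall y, `|g y| <= C) ->
  boundedly_closed [set f : MR -> R | B (fun z => f z.1 * g z.2)].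
Proof.
move=> gC; have [lin lim] := Bcl; split.
  move=> c f h /= Bf Bh; rewrite (_ : (fun z => _) =
    (fun z => c * (f z.1 * g z.2) + h z.1 * g z.2)); first exact: lin.
  by apply/funext => z; ring.
move=> f_ f D Bf fD ff /=; apply: (lim (fun n z => f_ n z.1 * g z.2) _ (D * C)) => //.
  by move=> n z; rewrite normrM ler_pM.
by move=> z; apply: cvgMl; exact: ff.
Qed.

Lemma boundedly_closed_slice2 (f : MR -> R) C : (forall y, `|f y| <= C) ->
  boundedly_closed [set g : MR -> R | B (fun z => f z.1 * g z.2)].
Proof.
move=> gC; have [lin lim] := Bcl; split.
  move=> c g h /= Bf Bh; rewrite (_ : (fun z => _) =
    (fun z => c * (f z.1 * g z.2) + f z.1 * h z.2)); first exact: lin.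
  by apply/funext => z; ring.
move=> g_ g D Bg gD gg /=; apply: (lim (fun n z => f z.1 * g_ n z.2) _ (C * D)) => //.
  by move=> n z; rewrite normrM ler_pM.
by move=> z; apply: cvgMr; exact: gg.
Qed.

Lemma indic_le1 T (A : set T) x : `|\1_A x : R| <= 1.
Proof. by rewrite indicE; case: (_ \in _); rewrite ?normr1 ?normr0. Qed.

Lemma norm_cos_le1 (x : R) : `|cos x| <= 1.
Proof. by rewrite ler_norml cos_geN1 cos_le1. Qed.

Lemma norm_sin_le1 (x : R) : `|sin x| <= 1.
Proof. by rewrite ler_norml sin_geN1 sin_le1. Qed.

(** Product formulas give products of one-variable trigonometric functions. Freezing one factor
    leaves a class of functions on the line with the same closure properties, so the one-dimensional
    result applies once in each variable. *)
Lemma boundedly_closed_rect (A A' : set MR) : measurable A -> measurable A' ->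
  B (fun z => \1_A z.1 * \1_A' z.2).
Proof.
have avg f g : B f -> B g -> B (fun z => 2^-1 * (f z + g z)).
  by move=> Bf Bg; apply: (boundedly_closedZ Bcl); exact: (boundedly_closedD Bcl).
have avgB f g : B f -> B g -> B (fun z => 2^-1 * (f z - g z)).
  by move=> Bf Bg; apply: (boundedly_closedZ Bcl); exact: (boundedly_closedB Bcl).
have cc p q : B (fun z => cos (ratr p * z.1) * cos (ratr q * z.2)).
  rewrite (_ : (fun z => _) = (fun z => 2^-1 *
    (cos (ratr p * z.1 + ratr q * z.2) + cos (ratr p * z.1 + ratr (- q) * z.2))));
      first exact: avg.
  by apply/funext => z; rewrite rmorphN/= mulNr cosB cosD; field.
have ss p q : B (fun z => sin (ratr p * z.1) * sin (ratr q * z.2)).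
  rewrite (_ : (fun z => _) = (fun z => 2^-1 *
    (cos (ratr p * z.1 + ratr (- q) * z.2) - cos (ratr p * z.1 + ratr q * z.2))));
      first exact: avgB.
  by apply/funext => z; rewrite rmorphN/= mulNr cosB cosD; field.
have sc p q : B (fun z => sin (ratr p * z.1) * cos (ratr q * z.2)).
  rewrite (_ : (fun z => _) = (fun z => 2^-1 *
    (sin (ratr p * z.1 + ratr q * z.2) + sin (ratr p * z.1 + ratr (- q) * z.2))));
      first exact: avg.
  by apply/funext => z; rewrite rmorphN/= mulNr sinB sinD; field.
have cs p q : B (fun z => cos (ratr p * z.1) * sin (ratr q * z.2)).
  rewrite (_ : (fun z => _) = (fun z => 2^-1 *
    (sin (ratr p * z.1 + ratr q * z.2) - sin (ratr p * z.1 + ratr (- q) * z.2))));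
      first exact: avgB.
  by apply/funext => z; rewrite rmorphN/= mulNr sinB sinD; field.
move=> mA mA'.
apply: (@boundedly_closed_borel R _ (boundedly_closed_slice2 (indic_le1 A))) mA' => q /=.
  exact: (@boundedly_closed_borel R _ (@boundedly_closed_slice1
    (fun y => cos (ratr q * y)) 1 (fun y => norm_cos_le1 _)) (cc^~ q) (sc^~ q) A mA).
exact: (@boundedly_closed_borel R _ (@boundedly_closed_slice1
  (fun y => sin (ratr q * y)) 1 (fun y => norm_sin_le1 _)) (cs^~ q) (ss^~ q) A mA).
Qed.

Lemma boundedly_closed_borel2 (A : set (MR * MR)) : measurable A -> B (\1_A).
Proof.
move=> mA; apply: (boundedly_closed_indic Bcl
  (G := [set A `*` B | A in @measurable _ MR & B in @measurable _ MR]) _ _ _ _ mA).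
- exact: measurable_prod_measurableType.
- move=> _ _ [C mC [D mD <-]] [C' mC' [D' mD' <-]]; rewrite -setXI.
  by exists (C `&` C'); [exact: measurableI|exists (D `&` D') => //; exact: measurableI].
- have := Bcos 0 0; rewrite (_ : (fun z => _) = cst 1)//.
  by apply/funext => z; rewrite rmorph0 !mul0r addr0 cos0.
- move=> _ [C mC [D mD <-]]; have := boundedly_closed_rect mC mD.
  rewrite (_ : (fun z => _) = \1_(C `*` D))//.
  by apply/funext => z; rewrite !indicE in_setX -natrM mulnb.
Qed.

End Plane.

(** * Characters and weak-star limits of bounded symbols *)

Section Cexp.
Context (R : realType).
Implicit Types x y t : R.

Definition cexp x : R[i] := Complex (cos x) (sin x).

Lemma cexp0 : cexp 0 = 1. Proof. by rewrite /cexp cos0 sin0. Qed.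
Lemma cexpD x y : cexp (x + y) = cexp x * cexp y.
Proof. by apply: cplx_eq; rewrite ?ReImE /= ?cosD ?sinD//; ring. Qed.
Lemma cexpN x : cexp (- x) = (cexp x)^*.
Proof. by apply: cplx_eq; rewrite ?ReImE /= ?cosN ?sinN. Qed.
Lemma nrm2_cexp x : nrm2 (cexp x) = 1. Proof. exact: cos2Dsin2. Qed.

Lemma cmeasurable_cexp d (T : measurableType d) (f : T -> R) :
  measurable_fun setT f -> cmeasurable (fun z => cexp (f z)).
Proof.
move=> mf; split => /=.
  by apply: measurableT_comp mf; apply: continuous_measurable_fun; exact: continuous_cos.
by apply: measurableT_comp mf; apply: continuous_measurable_fun; exact: continuous_sin.
Qed.

End Cexp.

Import HBSimple.

Section FiniteMeasure.
Context d (T : measurableType d) (R : realType).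
Variable mu : {measure set T -> \bar R}.
Hypothesis mufin : (mu setT < +oo)%E.

Lemma rintegrable_cst c : rintegrable mu (fun=> c).
Proof.
apply/integrableP; split; first exact: measurable_cst.
by rewrite /= integral_cst// lte_mul_pinfty// lee_fin.
Qed.

Lemma rintegrable_bounded (f : T -> R) C :
  measurable_fun setT f -> (forall x, `|f x| <= C) -> rintegrable mu f.
Proof. by move=> mf fC; apply: le_rintegrable mf fC _; exact: rintegrable_cst. Qed.

Lemma cintegrable_bounded (f : T -> R[i]) C :
  cmeasurable f -> (forall x, nrm2 (f x) <= C) -> cintegrable mu f.
Proof.
move=> mf fC; rewrite (_ : f = (fun x => f x * 1)).
  apply: cintegrable_bM mf fC _; split => /=; exact: rintegrable_cst.
by apply/funext => x; rewrite mulr1.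
Qed.

Lemma L2_bounded (f : T -> R[i]) C :
  cmeasurable f -> (forall x, nrm2 (f x) <= C) -> L2 mu f.
Proof.
move=> mf fC; apply/L2P; split => //; apply: (@rintegrable_bounded _ C).
  exact: measurable_nrm2.
by move=> x; rewrite ger0_norm ?nrm2_ge0.
Qed.

Lemma L2_cst c : L2 mu (cst c).
Proof. by apply: (L2_bounded (C := nrm2 c)) => //; exact: cmeasurable_cst. Qed.

Lemma L2_cintegrable1 (f : T -> R[i]) : L2 mu f -> cintegrable mu f.
Proof.
move=> f2; rewrite (_ : f = (fun x => f x * (1 : R[i])^*)).
  apply: L2_cintegrable => //; apply: (@L2_bounded _ 1).
    exact: cmeasurable_cst.
  by move=> x; rewrite /nrm2 /= expr1n expr0n addr0.
by apply/funext => x; rewrite rmorph1 mulr1.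
Qed.

Section WeakLimit.
Variables (psi_ : nat -> T -> R[i]) (psi : T -> R[i]).
Hypothesis mpsi_ : forall n, cmeasurable (psi_ n).
Hypothesis mpsi : cmeasurable psi.
Hypothesis psi_1 : forall n x, nrm2 (psi_ n x) <= 1.
Hypothesis psi1 : forall x, nrm2 (psi x) <= 1.
Local Notation cint f := (cintegral mu setT f).

(** Convergence is tested against one function g at a time, so that the set of admissible g is
    itself an object to which closure arguments apply. *)
Definition weak_lim (g : T -> R[i]) := ccvg (fun n => cint (fun x => psi_ n x * g x))
  (cint (fun x => psi x * g x)).

Lemma weak_limD f g : cintegrable mu f -> cintegrable mu g -> weak_lim f ->
  weak_lim g -> weak_lim (fun x => f x + g x).
Proof.
move=> fi gi wf wg; have := ccvgD wf wg; rewrite /weak_lim.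
rewrite -cintD; [|exact: cintegrable_bM (psi1) _|exact: cintegrable_bM (psi1) _] => //.
under [X in ccvg X]eq_fun => n.
  rewrite -cintD; [|exact: cintegrable_bM (psi_1 n) _|exact: cintegrable_bM (psi_1 n) _] => //.
  under eq_fun do rewrite -mulrDr.
  over.
by under [X in ccvg _ (cintegral _ _ X)]eq_fun do rewrite -mulrDr.
Qed.

Lemma weak_limZ c f : cintegrable mu f -> weak_lim f -> weak_lim (fun x => c * f x).
Proof.
move=> fi wf; have := ccvgM (ccvg_cst c) wf; rewrite /weak_lim.
rewrite -cintZ; [|exact: cintegrable_bM (psi1) _] => //.
under [X in ccvg X]eq_fun => n.
  rewrite -cintZ; [|exact: cintegrable_bM (psi_1 n) _] => //.
  under eq_fun do rewrite mulrCA.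
  over.
by under [X in ccvg _ (cintegral _ _ X)]eq_fun do rewrite mulrCA.
Qed.

Let absr_le1 (a b : R) : a ^+ 2 + b ^+ 2 <= 1 -> `|a| <= 1 /\ `|b| <= 1.
Proof. by move=> h; split; rewrite ler_norml; apply/andP; split; nra. Qed.

Lemma mul_bound (z w : R[i]) : nrm2 z <= 1 ->
  `|complex.Re (z * w)| <= `|complex.Re w| + `|complex.Im w| /\
  `|complex.Im (z * w)| <= `|complex.Re w| + `|complex.Im w|.
Proof.
move=> /absr_le1[z1 z2]; rewrite !ReImE; split.
  by apply: (le_trans (ler_normB _ _)); rewrite !normrM lerD// ler_piMl.
apply: (le_trans (ler_normD _ _)); rewrite !normrM addrC lerD// ler_piMl//.
Qed.

(** The uniform bound on the symbols makes the integrals equicontinuous in g for the L_1 distance,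
    here measured by coordinates. *)
Lemma weak_lim_approx g : cintegrable mu g -> (forall e : R, 0 < e ->
  exists h, [/\ cintegrable mu h, weak_lim h &
    \int[mu]_x (`|complex.Re (g x - h x)| + `|complex.Im (g x - h x)|) <= e]) ->
  weak_lim g.
Proof.
move=> gi gh.
have close (p : T -> R[i]) h e : cmeasurable p -> (forall x, nrm2 (p x) <= 1) ->
    cintegrable mu h ->
    \int[mu]_x (`|complex.Re (g x - h x)| + `|complex.Im (g x - h x)|) <= e ->
    `|complex.Re (cint (fun x => p x * g x)) - complex.Re (cint (fun x => p x * h x))| <= e /\
    `|complex.Im (cint (fun x => p x * g x)) - complex.Im (cint (fun x => p x * h x))| <= e.
  move=> mp p1 hi ghe.
  have pgi : cintegrable mu (fun x => p x * g x) by exact: cintegrable_bM p1 _.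
  have phi : cintegrable mu (fun x => p x * h x) by exact: cintegrable_bM p1 _.
  have [gr gm] := cintegrableB gi hi.
  have i := rintegrableD (rintegrable_norm gr) (rintegrable_norm gm).
  rewrite -cReB -cImB -cintB//; split; apply: le_trans ghe.
    apply: Re_cint_le => //; first exact: cintegrableB.
    by move=> x; rewrite -mulrBr; have [] := mul_bound (g x - h x) (p1 x).
  apply: Im_cint_le => //; first exact: cintegrableB.
  by move=> x; rewrite -mulrBr; have [] := mul_bound (g x - h x) (p1 x).
have three (x y z w e : R) : `|x - y| <= e / 3 -> `|w - z| <= e / 3 ->
    `|y - z| <= e / 3 -> `|x - w| <= e.
  by rewrite !ler_norml => /andP[? ?] /andP[? ?] /andP[? ?]; apply/andP; split; lra.
split; apply/cvgrPdist_le => e e0.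
  have [|h [hi [hr _] ghe]] := gh (e / 3); first by lra.
  have [c1 _] := close _ _ _ mpsi psi1 hi ghe.
  near=> n; have [c2 _] := close _ _ _ (mpsi_ n) (psi_1 n) hi ghe.
  apply: (three _ _ _ _ _ c1 c2).
  by near: n; move/cvgrPdist_le : hr; apply; lra.
have [|h [hi [_ hr] ghe]] := gh (e / 3); first by lra.
have [_ c1] := close _ _ _ mpsi psi1 hi ghe.
near=> n; have [_ c2] := close _ _ _ (mpsi_ n) (psi_1 n) hi ghe.
apply: (three _ _ _ _ _ c1 c2).
by near: n; move/cvgrPdist_le : hr; apply; lra.
Unshelve. all: end_near. Qed.

Lemma cintegrable_real (f : T -> R) : rintegrable mu f ->
  cintegrable mu (fun x => (f x)%:C%C).
Proof. by move=> fi; split => //=; exact: rintegrable_cst. Qed.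

Lemma weak_lim_approx_real (g : T -> R) (h : nat -> T -> R) :
  rintegrable mu g -> (forall n, rintegrable mu (h n)) ->
  (forall n, weak_lim (fun x => (h n x)%:C%C)) ->
  \int[mu]_x `|g x - h n x| @[n --> \oo] --> (0:R) -> weak_lim (fun x => (g x)%:C%C).
Proof.
move=> gi hi wh gh; apply: weak_lim_approx; first exact: cintegrable_real.
move=> e e0; have [n _ ghe] : \forall n \near \oo, \int[mu]_x `|g x - h n x| < e.
  exact: cvgr_lt gh _ _.
exists (fun x => (h n x)%:C%C); split => //; first exact: cintegrable_real.
under eq_Rintegral do rewrite -rmorphB/= normr0 addr0.
exact: ltW (ghe n (leqnn n)).
Qed.

Lemma weak_lim_bclosed : boundedly_closed [set g : T -> R | [/\ measurable_fun setT g,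
  exists C, forall x, `|g x| <= C & weak_lim (fun x => (g x)%:C%C)]].
Proof.
split=> [c f g [mf [C fC] wf] [mg [D gD] wg]|f_ f C Bf fC ff].
  have fi := rintegrable_bounded mf fC; have gi := rintegrable_bounded mg gD.
  split; first by apply: measurable_funD => //; exact: measurable_funM.
    by exists (`|c| * C + D) => x; rewrite (le_trans (ler_normD _ _))// lerD// normrM ler_wpM2l.
  rewrite (_ : (fun x => _) = (fun x => c%:C%C * (f x)%:C%C + (g x)%:C%C)).
    apply: weak_limD => //; [apply: cintegrableZ| | apply: weak_limZ => //];
      exact: cintegrable_real.
  by apply/funext => x; rewrite rmorphD rmorphM.
have mf : measurable_fun setT f.
  by apply: (measurable_fun_cvg (h := f_)) => [m|x _]; [case: (Bf m)|exact: ff].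
have fC' x : `|f x| <= C.
  apply: (closed_cvg (fun y => `|y| <= C) _ _ _ (ff x)); last exact: nearW.
  rewrite (_ : (fun y => _) = `[- C, C]%classic); first exact: itv_closed.
  by apply/funext => y; apply/propext; rewrite /= in_itv/= ler_norml.
split => //; first by exists C.
have fi := rintegrable_bounded mf fC'.
have fi_ n : rintegrable mu (f_ n).
  by case: (Bf n) => mfn _ _; exact: rintegrable_bounded mfn (fC n).
apply: (@weak_lim_approx_real f f_) => //; first by move=> n; case: (Bf n).
rewrite (_ : 0 = \int[mu]_x (fun=> 0 : R) x); last by rewrite /Rintegral integral0.
apply: (@rint_cvg _ _ _ _ _ _ (fun=> 2 * C)) => //.
- move=> n; apply: measurableT_comp => //; apply: measurable_funB => //.
  by case: (Bf n).
- exact: rintegrable_cst.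
- move=> n x; rewrite normr_id (le_trans (ler_normB _ _))//.
  by have := fC' x; have := fC n x; lra.
- apply: aeW => x; rewrite -(normr0 R) -(subrr (f x)); apply: cvg_norm.
  by apply: cvgB; [exact: cvg_cst|exact: ff].
Qed.

Hypothesis windic : forall A, measurable A -> weak_lim (fun x => (\1_A x)%:C%C).

(** Indicators give simple functions by linearity, and simple functions are dense in L_1. *)
Lemma weak_lim_cintegrable g : cintegrable mu g -> weak_lim g.
Proof.
have wsfun (f : {sfun T >-> R}) : weak_lim (fun x => (f x)%:C%C).
  have -> : (fun x => (f x)%:C%C) = fun x => \sum_(y <- finmap.enum_fset (fset_set (range f)))
     (y%:C%C * (\1_(f @^-1` [set y]) x)%:C%C).
    by apply/funext => x; rewrite {1}(fimfunE f x) fsbig_finite//= rmorph_sum/=;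
       apply: eq_bigr => y _; rewrite rmorphM.
  elim: (finmap.enum_fset _) => [|y s ih].
    under eq_fun do rewrite big_nil.
    rewrite (_ : (fun=> 0) = (fun x => 0 * (\1_(@set0 T) x)%:C%C)); last first.
      by apply/funext => x; rewrite mul0r.
    apply: weak_limZ (windic measurable0); apply: cintegrable_real.
    by apply: rintegrable_bounded (indic_le1 _ _) => //; exact: measurable_indic.
  have yi z : cintegrable mu (fun x => z%:C%C * (\1_(f @^-1` [set z]) x)%:C%C).
    by apply: cintegrableZ; apply: cintegrable_real;
      apply: rintegrable_bounded (indic_le1 _ _); apply: measurable_indic;
      exact: measurable_funPTI.
  under eq_fun do rewrite big_cons; apply: weak_limD => //.
    elim: s {ih} => [|z s ih].
      by under eq_fun do rewrite big_nil; have [] := cintegrable_real (rintegrable_cst 0).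
    by under eq_fun do rewrite big_cons; exact: cintegrableD.
  apply: weak_limZ; last exact: windic.
  by apply: cintegrable_real; apply: rintegrable_bounded (indic_le1 _ _);
    apply: measurable_indic; exact: measurable_funPTI.
have wreal (f : T -> R) : rintegrable mu f -> weak_lim (fun x => (f x)%:C%C).
  move=> fi; have [h [hi _ fh]] := approximation_sfun_integrable measurableT fi.
  apply: (@weak_lim_approx_real f h) => //.
  have {}fh : (\int[mu]_x `|f x - h n x|)%:E @[n --> \oo] --> 0%E.
    move: fh; rewrite (_ : (fun n => _) = (fun n => (\int[mu]_x `|f x - h n x|)%:E))//.
    apply/funext => n; rewrite EFin_rint; first exact: eq_integral.
    apply: rintegrable_norm; apply: (rintegrableB fi); exact: hi.
  by move/fine_cvgP : fh => [].
move=> [gr gm].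
rewrite (_ : g = fun x => (complex.Re (g x))%:C%C + 'i%C * (complex.Im (g x))%:C%C).
  apply: weak_limD; [exact: cintegrable_real| |exact: wreal|].
    by apply: cintegrableZ; exact: cintegrable_real.
  by apply: weak_limZ; [exact: cintegrable_real|exact: wreal].
by apply/funext => x; rewrite -complexE.
Qed.

End WeakLimit.
End FiniteMeasure.

(** * The symbol of an average over a time interval *)

Section Psi.
Context (R : realType).
Implicit Types u a : R.

Lemma norm_sin_le (x : R) : `|sin x| <= `|x|.
Proof.
wlog x0 : x / 0 < x => [h|].
  have [|x0|->] := ltgtP x 0; last by rewrite sin0 normr0.
    by rewrite -oppr_gt0 => /h; rewrite sinN !normrN.
  exact: h.
have [c _] := MVT x0 (fun z _ => is_derive_sin z)
  (continuous_subspaceT (@continuous_sin R)).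
rewrite sin0 !subr0 => ->; rewrite normrM ler_piMl//; exact: norm_cos_le1.
Qed.

Lemma nrm2_cexpB1E u : nrm2 (cexp u - 1) = 4 * sin (u / 2) ^+ 2.
Proof.
have e : u = u / 2 + u / 2 by field.
rewrite /nrm2 !ReImE /= subr0 {1 2}e cosD sinD.
have := cos2Dsin2 (u / 2); move: (cos (u / 2)) (sin (u / 2)) => c s h.
have c2 : c ^+ 2 = 1 - s ^+ 2 by rewrite -h; ring.
rewrite (_ : (s * c + c * s) ^+ 2 = 4 * s ^+ 2 * c ^+ 2); last by ring.
by rewrite -expr2 c2; ring.
Qed.

Lemma nrm2_cexpB1 u : nrm2 (cexp u - 1) <= u ^+ 2.
Proof.
rewrite nrm2_cexpB1E.
have := norm_sin_le (u / 2); rewrite -(@ler_pXn2r _ 2)// ?nnegrE// !real_normK ?num_real//.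
by move=> h; rewrite (_ : u ^+ 2 = 4 * (u / 2) ^+ 2) ?ler_pM2l//; field.
Qed.

(* [(e^{iu} - 1) / (iu)], with value 1 at [u = 0], where the quotients below are
   [0] and the indicator contributes the [1]. *)
Definition psi u : R[i] :=
  Complex (\1_[set 0] u + sin u / u) ((1 - cos u) / u).

Lemma psi0 : psi 0 = 1.
Proof.
by apply: cplx_eq => //=; rewrite invr0 ?mulr0// addr0 indicE mem_set.
Qed.

Lemma psi_neq0 u : u != 0 -> psi u = Complex (sin u / u) ((1 - cos u) / u).
Proof.
move=> u0; congr Complex; rewrite indicE memNset ?add0r//=.
by move=> /eqP; rewrite (negbTE u0).
Qed.

Lemma mul_psi u : 'i%C * u%:C%C * psi u = cexp u - 1.
Proof.
have [->|u0] := eqVneq u 0; first by rewrite mulr0 mul0r cexp0 subrr.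
by rewrite psi_neq0//; apply: cplx_eq; rewrite !ReImE /=; field.
Qed.

(** A chord of the unit circle is no longer than its arc. *)
Lemma nrm2_psi_le1 u : nrm2 (psi u) <= 1.
Proof.
have [->|u0] := eqVneq u 0; first by rewrite psi0 /nrm2 /= expr1n expr0n addr0.
have u2 : 0 < u ^+ 2 by rewrite exprn_even_gt0.
have := nrm2_cexpB1 u; rewrite -mul_psi !nrm2M.
have -> : nrm2 'i%C = 1 :> R by rewrite /nrm2 /= expr0n expr1n add0r.
have -> : nrm2 u%:C%C = u ^+ 2 by rewrite /nrm2 /= expr0n addr0.
by rewrite mul1r ger_pMr.
Qed.

(** Real powers behave as inverses only on a nonnegative base, so 1/f is written as f times the
    inverse of its square. Both sides are 0 where f vanishes. *)
Lemma measurable_inv d (T : measurableType d) (f : T -> R) :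
  measurable_fun setT f -> measurable_fun setT (fun x => (f x)^-1).
Proof.
move=> mf; rewrite (_ : (fun x => _) = (fun x => f x * (f x ^+ 2) `^ (-1))).
  apply: measurable_funM => //.
  apply: (measurableT_comp (f := fun y : R => y `^ (-1)) (measurable_powR _)).
  exact: measurable_funX.
apply/funext => x; rewrite powR_inv1 ?sqr_ge0//.
have [->|fx0] := eqVneq (f x) 0; first by rewrite invr0 mul0r.
by field.
Qed.

Lemma cmeasurable_psi d (T : measurableType d) (f : T -> R) :
  measurable_fun setT f -> cmeasurable (fun x => psi (f x)).
Proof.
move=> mf.
have [ms mc] := cmeasurable_cexp mf.
have mi := measurable_inv mf.
split => /=; last by apply: measurable_funM => //; exact: measurable_funB.
apply: measurable_funD; last exact: measurable_funM.
by apply: measurableT_comp mf; apply: measurable_indic; exact: measurable_set1.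
Qed.

Lemma psi_cvg (x : R) : ccvg (fun n => psi (n.+1%:R^-1 * x)) 1.
Proof.
have [->|x0] := eqVneq x 0.
  by under eq_fun do rewrite mulr0 psi0; exact: ccvg_cst.
pose u n := n.+1%:R^-1 * x.
have un0 n : u n != 0 by rewrite mulf_neq0 ?invr_neq0.
have u0 : u n @[n --> \oo] --> (0 : R).
  by rewrite -[X in _ --> X](mul0r x); apply: cvgMl; exact: cvg_harmonic.
have sc : sin (u n) / u n @[n --> \oo] --> (1:R).
  have ds : (fun h : R => h^-1 *: ((@sin R \o shift 0) (h *: 1) - sin 0)) @ 0^' --> (1:R).
    have e : 'D_1 sin (0:R) = 1 by rewrite derive_val cos0.
    by rewrite -[X in _ --> X]e; exact: derivable_sin.
  move/cvgr_dnbhsP : ds => /(_ u (conj un0 u0)).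
  under eq_fun do rewrite /= sin0 subr0 addr0 /GRing.scale/= mulr1 mulrC.
  by [].
have cc : (1 - cos (u n)) / u n @[n --> \oo] --> (0:R).
  apply: (@squeeze_cvgr _ _ _ _ (fun n => - `|u n|) (fun n => `|u n|)).
  - near=> n; rewrite -ler_norml normrM normfV ler_pdivrMr ?normr_gt0// -expr2.
    rewrite real_normK ?num_real// ger0_norm ?subr_ge0 ?cos_le1//.
    have := nrm2_cexpB1 (u n); rewrite /nrm2 !ReImE /= subr0.
    have := cos2Dsin2 (u n); have := cos_geN1 (u n); have := cos_le1 (u n).
    by nra.
  - by rewrite -oppr0 -(normr0 R); apply: cvgN; exact: cvg_norm.
  - by rewrite -(normr0 R); exact: cvg_norm.
split; under eq_fun do rewrite psi_neq0 ?un0//=; [exact: sc|exact: cc].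
Unshelve. all: end_near. Qed.

End Psi.

(** * Measure-preserving maps and products of finite measures *)

Section MeasurePreserving.
Context d1 d2 (T1 : measurableType d1) (T2 : measurableType d2) (R : realType).
Variables (mu1 : {measure set T1 -> \bar R}) (mu2 : {measure set T2 -> \bar R}).
Variable tau : T1 -> T2.
Hypothesis mtau : measurable_fun setT tau.
Hypothesis pres : forall A, measurable A -> mu1 (tau @^-1` A) = mu2 A.

Lemma ge0_integral_mp (f : T2 -> \bar R) : measurable_fun setT f ->
  (forall x, (0 <= f x)%E) -> (\int[mu1]_x f (tau x) = \int[mu2]_x f x)%E.
Proof.
move=> mf f0; have := @ge0_integral_pushforward _ _ _ _ _ _ mtau mu1 setT f.
rewrite preimage_setT => <- //.
by apply: eq_measure_integral => A mA _; exact: pres.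
Qed.

Lemma rintegrable_mp (f : T2 -> R) : rintegrable mu2 f ->
  rintegrable mu1 (fun x => f (tau x)).
Proof.
move=> fi; have mf := rintegrable_meas fi.
apply/integrableP; split; first exact/measurable_EFinP/measurableT_comp.
have /integrableP[_] := fi; rewrite -(@ge0_integral_mp (fun x => `|(EFin \o f) x|%E))//.
by apply: measurableT_comp => //; exact/measurable_EFinP.
Qed.

Lemma rint_mp (f : T2 -> R) : rintegrable mu2 f ->
  \int[mu1]_x f (tau x) = \int[mu2]_x f x.
Proof.
move=> fi; have mf := rintegrable_meas fi; congr fine.
rewrite -[LHS](@integral_pushforward _ _ _ _ _ _ mtau mu1 setT (EFin \o f))//.
- by apply: eq_measure_integral => A mA _; exact: pres.
- exact/measurable_EFinP.
- exact: rintegrable_mp.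
Qed.

Lemma cmeasurable_mp (f : T2 -> R[i]) : cmeasurable f -> cmeasurable (fun x => f (tau x)).
Proof. by move=> [fr fi]; split; [exact: (measurableT_comp fr)|exact: (measurableT_comp fi)]. Qed.

Lemma cintegrable_mp (f : T2 -> R[i]) : cintegrable mu2 f ->
  cintegrable mu1 (fun x => f (tau x)).
Proof. by move=> [fr fi]; split; [exact: (rintegrable_mp fr)|exact: (rintegrable_mp fi)]. Qed.

Lemma cint_mp (f : T2 -> R[i]) : cintegrable mu2 f ->
  cintegral mu1 setT (fun x => f (tau x)) = cintegral mu2 setT f.
Proof. by move=> [fr fi]; congr Complex; [exact: (rint_mp fr)|exact: (rint_mp fi)]. Qed.

Lemma L2_mp (f : T2 -> R[i]) : L2 mu2 f -> L2 mu1 (fun x => f (tau x)).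
Proof.
by move=> /L2P[mf f2]; apply/L2P; split; [exact: cmeasurable_mp|exact: (rintegrable_mp f2)].
Qed.

Lemma inner_mp (f g : T2 -> R[i]) : L2 mu2 f -> L2 mu2 g ->
  inner mu1 (fun x => f (tau x)) (fun x => g (tau x)) = inner mu2 f g.
Proof. by move=> f2 g2; exact: (cint_mp (L2_cintegrable f2 g2)). Qed.

Lemma sqnorm_mp (f : T2 -> R[i]) : L2 mu2 f ->
  sqnorm mu1 (fun x => f (tau x)) = sqnorm mu2 f.
Proof. by move=> f2; rewrite /sqnorm inner_mp. Qed.

Lemma ae_mp (Q : T2 -> Prop) : {ae mu2, forall x, Q x} -> {ae mu1, forall x, Q (tau x)}.
Proof.
move=> [N [mN N0 NQ]]; exists (tau @^-1` N); split.
- by rewrite -[X in measurable X]setTI; exact: mtau.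
- by rewrite pres.
- by move=> x /= nQ; exact: NQ.
Qed.

End MeasurePreserving.

Section FiniteProduct.
Context d1 d2 (T1 : measurableType d1) (T2 : measurableType d2) (R : realType).
Variables (m1 : {finite_measure set T1 -> \bar R}) (m2 : {finite_measure set T2 -> \bar R}).

Lemma finite_measure_lty d (T : measurableType d) (m : {finite_measure set T -> \bar R}) :
  (m setT < +oo)%E.
Proof. by rewrite ltey_eq fin_num_measure. Qed.

Lemma finite_prod_lty : ((m1 \x m2) setT < +oo)%E.
Proof.
by rewrite -setXTT product_measure1E// lte_mul_pinfty ?fin_num_measure// finite_measure_lty.
Qed.

Local Notation mm := (m1 \x m2)%E.

Definition tensor (f : T1 -> R[i]) (g : T2 -> R[i]) (z : T1 * T2) : R[i] := f z.1 * g z.2.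

Lemma rintegrable_tensor (f : T1 -> R) (g : T2 -> R) : rintegrable m1 f ->
  rintegrable m2 g -> rintegrable mm (fun z => f z.1 * g z.2).
Proof.
move=> fi gi; have mf := rintegrable_meas fi; have mg := rintegrable_meas gi.
have mfg : measurable_fun setT (fun z : T1 * T2 => f z.1 * g z.2).
  by apply: measurable_funM; apply: measurableT_comp.
apply/integrableP; split; first exact/measurable_EFinP.
have mn : measurable_fun setT (fun z : T1 * T2 => `|(f z.1 * g z.2)%:E|%E).
  by apply/measurable_EFinP; apply: measurableT_comp.
rewrite (@fubini_tonelli1 _ _ T1 T2 R m1 m2 (fun z => `|(f z.1 * g z.2)%:E|%E) mn)//.
have -> : fubini_F m2 (fun z : T1 * T2 => `|(f z.1 * g z.2)%:E|%E) =
    (fun x => ((\int[m2]_y `|g y|) * `|f x|)%:E).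
  apply/funext => x; rewrite /fubini_F /= mulrC -(rintZ `|f x| (rintegrable_norm gi)).
  rewrite (EFin_rint (rintegrableZ _ (rintegrable_norm gi))).
  by apply: eq_integral => y _; rewrite /= normrM.
by rewrite -(EFin_rint (rintegrableZ _ (rintegrable_norm fi))) ltry.
Qed.

Lemma rint_tensor (f : T1 -> R) (g : T2 -> R) : rintegrable m1 f -> rintegrable m2 g ->
  \int[mm]_z (f z.1 * g z.2) = (\int[m1]_x f x) * (\int[m2]_y g y).
Proof.
move=> fi gi; have fgi := rintegrable_tensor fi gi.
apply: EFin_inj; rewrite EFin_rint// -integral12_prod_meas1//.
have -> : fubini_F m2 (fun z => (f z.1 * g z.2)%:E) =
    (fun x => ((\int[m2]_y g y) * f x)%:E).
  apply/funext => x; rewrite /fubini_F /=; under eq_integral do rewrite EFinM.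
  by rewrite integralZl// -EFin_rint// -EFinM mulrC.
by rewrite -(EFin_rint (rintegrableZ _ fi)) rintZ// mulrC.
Qed.

Lemma cint_tensor (f : T1 -> R[i]) (g : T2 -> R[i]) : cintegrable m1 f -> cintegrable m2 g ->
  cintegral mm setT (tensor f g) = cintegral m1 setT f * cintegral m2 setT g.
Proof.
move=> [fr fi] [gr gi]; apply: cplx_eq; rewrite !ReImE /=.
  rewrite -!rint_tensor// -rintB; [|exact: (rintegrable_tensor fr gr)|exact:
    (rintegrable_tensor fi gi)].
  by apply: eq_Rintegral => z _; rewrite cReM.
rewrite -!rint_tensor// -rintD; [|exact: (rintegrable_tensor fr gi)|exact: (rintegrable_tensor
  fi gr)].
by apply: eq_Rintegral => z _; rewrite cImM.
Qed.

Lemma L2_tensor f g : L2 m1 f -> L2 m2 g -> L2 mm (tensor f g).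
Proof.
move=> f2 g2; apply/L2P; split.
  apply: cmeasurableM.
    case: (L2_meas f2) => fr fi.
    by split; [exact: (measurableT_comp fr measurable_fst)|exact: (measurableT_comp fi
      measurable_fst)].
  case: (L2_meas g2) => gr gi.
  by split; [exact: (measurableT_comp gr measurable_snd)|exact: (measurableT_comp gi
    measurable_snd)].
rewrite (_ : (fun z => _) = (fun z => nrm2 (f z.1) * nrm2 (g z.2))).
  exact: (rintegrable_tensor (L2_nrm2 f2) (L2_nrm2 g2)).
by apply/funext => z; rewrite nrm2M.
Qed.

Lemma inner_tensor f g f' g' : L2 m1 f -> L2 m2 g -> L2 m1 f' -> L2 m2 g' ->
  inner mm (tensor f g) (tensor f' g') = inner m1 f f' * inner m2 g g'.
Proof.
move=> f2 g2 f'2 g'2; rewrite /inner -cint_tensor; [|exact: L2_cintegrable..].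
by congr cintegral; apply/funext => z; rewrite /tensor rmorphM/= mulrACA.
Qed.

Lemma sqnorm_tensor f g : L2 m1 f -> L2 m2 g ->
  sqnorm mm (tensor f g) = sqnorm m1 f * sqnorm m2 g.
Proof.
move=> f2 g2; rewrite /sqnorm inner_tensor// !inner_sqnorm /=.
by rewrite mulr0 subr0.
Qed.

End FiniteProduct.

Section ProductMaps.
Context d (T : measurableType d) (R : realType).
Variable m : {finite_measure set T -> \bar R}.

Definition pswap (U V : Type) (z : U * V) : V * U := (z.2, z.1).

Lemma measurable_pswap : measurable_fun setT (@pswap T T).
Proof. exact: measurable_fun_pair. Qed.

Lemma measure_unique_prod d' (T' : measurableType d') (nu : {measure set T' -> \bar R})
    (phi : T' -> T * T) : measurable_fun setT phi ->
  (forall A B, measurable A -> measurable B -> nu (phi @^-1` (A `*` B)) = m A * m B)%E ->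
  forall A, measurable A -> nu (phi @^-1` A) = (m \x m)%E A.
Proof.
move=> mphi phiE A mA.
pose mphi_mixin := isMeasurableFun.Build _ _ _ _ _ mphi.
pose phi' : {mfun T' >-> (T * T)%type} := HB.pack phi mphi_mixin.
by rewrite (@product_measure_unique _ _ _ _ _ m m (pushforward nu phi')).
Qed.

Lemma pswap_pres A : measurable A -> (m \x m)%E (@pswap T T @^-1` A) = (m \x m)%E A.
Proof.
apply: measure_unique_prod; first exact: measurable_pswap.
move=> B C mB mC; rewrite (_ : _ @^-1` _ = C `*` B).
  by rewrite [LHS]product_measure1E// muleC.
by apply/seteqP; split => z /= [].
Qed.

Lemma pair_map_pres (tau : T -> T) : measurable_fun setT tau ->
  (forall A, measurable A -> m (tau @^-1` A) = m A) ->
  let tau2 := (fun z : T * T => (tau z.1, tau z.2)) in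
  measurable_fun setT tau2 /\
  forall A, measurable A -> (m \x m)%E (tau2 @^-1` A) = (m \x m)%E A.
Proof.
move=> mt pres tau2.
have mt2 : measurable_fun setT tau2.
  by apply/measurable_fun_pair; apply: measurableT_comp.
split => //; apply: measure_unique_prod => // B C mB mC.
rewrite (_ : _ @^-1` _ = (tau @^-1` B) `*` (tau @^-1` C))//.
rewrite [LHS]product_measure1E.
- by congr (_ * _)%E; exact: pres.
- by rewrite -[X in measurable X]setTI; exact: mt.
- by rewrite -[X in measurable X]setTI; exact: mt.
Qed.

End ProductMaps.

Section ProductWeakLimit.
Context d (T : measurableType d) (R : realType).
Variable m : {finite_measure set T -> \bar R}.
Variables (psi_ : nat -> T -> R[i]) (psi : T -> R[i]).
Hypothesis mpsi_ : forall n, cmeasurable (psi_ n).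
Hypothesis mpsi : cmeasurable psi.
Hypothesis psi_1 : forall n x, nrm2 (psi_ n x) <= 1.
Hypothesis psi1 : forall x, nrm2 (psi x) <= 1.

(** On the indicator of a rectangle the integral splits into two one-variable integrals, each of
    which converges along the same index n. Uniform boundedness then carries the convergence to
    every integrable function of two variables. *)
Lemma weak_lim_tensor :
  (forall g, cintegrable m g -> weak_lim m psi_ psi g) ->
  forall g, cintegrable (m \x m)%E g ->
    weak_lim (m \x m)%E (fun n z => psi_ n z.1 * psi_ n z.2)
      (fun z => psi z.1 * psi z.2) g.
Proof.
move=> w.
have mpp (p : T -> R[i]) : cmeasurable p -> cmeasurable (fun z : T * T => p z.1 * p z.2).
  by move=> mp; apply: cmeasurableM; apply: cmeasurable_mp mp.
have pp1 (p : T -> R[i]) : (forall x, nrm2 (p x) <= 1) ->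
    forall z : T * T, nrm2 (p z.1 * p z.2) <= 1.
  by move=> p1 z; rewrite nrm2M mulr_ile1 ?nrm2_ge0.
apply: weak_lim_cintegrable => //.
- exact: finite_prod_lty.
- by move=> n; exact: mpp.
- exact: mpp.
- by move=> n; exact: pp1.
- exact: pp1.
have rect A B : measurable A -> measurable B -> weak_lim (m \x m)%E
    (fun n z => psi_ n z.1 * psi_ n z.2) (fun z => psi z.1 * psi z.2)
    (fun z => (\1_(A `*` B) z)%:C%C).
  move=> mA mB.
  have mi C : measurable C -> cmeasurable (fun x : T => (\1_C x)%:C%C : R[i]).
    by move=> mC; apply: cmeasurable_real; exact: measurable_indic.
  have i1 (C : set T) x : nrm2 (\1_C x : R)%:C%C <= 1.
    by rewrite /nrm2 /= expr0n addr0 indicE; case: (_ \in _); rewrite ?expr1n ?expr0n.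
  have wi C : measurable C -> weak_lim m psi_ psi (fun x => (\1_C x)%:C%C).
    move=> mC; apply: w; apply: cintegrable_bounded (i1 C); last exact: mi.
    exact: finite_measure_lty.
  have E (p : T -> R[i]) : cmeasurable p -> (forall x, nrm2 (p x) <= 1) ->
      cintegral (m \x m)%E setT (fun z => p z.1 * p z.2 * (\1_(A `*` B) z)%:C%C) =
      cintegral m setT (fun x => p x * (\1_A x)%:C%C) *
      cintegral m setT (fun x => p x * (\1_B x)%:C%C).
    move=> mp p1; have ip C : measurable C -> cintegrable m (fun x => p x * (\1_C x)%:C%C).
      move=> mC; apply: (cintegrable_bounded (finite_measure_lty m) (C := 1)) => [|x].
        by apply: cmeasurableM => //; exact: mi.
      by rewrite nrm2M mulr_ile1 ?nrm2_ge0.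
    rewrite -(cint_tensor (ip _ mA) (ip _ mB)); congr (cintegral _ _ _); apply/funext => z.
    by rewrite /tensor !indicE in_setX -mulnb natrM rmorphM/=; ring.
  have := ccvgM (wi A mA) (wi B mB); rewrite /weak_lim -E//.
  by under [X in ccvg X]eq_fun do rewrite -E//.
move=> A mA.
have := @boundedly_closed_indic _ _ _ _ (@weak_lim_bclosed _ _ _ _ (finite_prod_lty m m)
  (fun n z => psi_ n z.1 * psi_ n z.2) (fun z => psi z.1 * psi z.2)
  (fun n => mpp _ (mpsi_ n)) (mpp _ mpsi) (fun n => pp1 _ (psi_1 n)) (pp1 _ psi1))
  _ (measurable_prod_measurableType T T).
case/(_ _ _ _ A mA) => //.
- move=> _ _ [C mC [D mD <-]] [C' mC' [D' mD' <-]]; rewrite -setXI.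
  by exists (C `&` C'); [exact: measurableI|exists (D `&` D') => //; exact: measurableI].
- split => //; first by exists 1 => z; rewrite normr1.
  have := rect setT setT measurableT measurableT; rewrite setXTT.
  by under [X in weak_lim _ _ _ X]eq_fun do rewrite indicT.
- move=> _ [C mC [D mD <-]]; split; last exact: rect.
    by apply: measurable_indic; exact: measurableX.
  by exists 1 => z; exact: indic_le1.
Qed.

End ProductWeakLimit.

(** * Annihilators of the diagonal characters *)

Section Annihilator.
Context d (T : measurableType d) (R : realType).
Variable mu : {measure set T -> \bar R}.
Variable kappa : T -> R[i].
Hypothesis ki : cintegrable mu kappa.
Local Notation cint f := (cintegral mu setT f).

Lemma cintegrable_rM (g : T -> R) C : measurable_fun setT g ->
  (forall x, `|g x| <= C) -> cintegrable mu (fun x => (g x)%:C%C * kappa x).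
Proof.
move=> mg gC; apply: (@cintegrable_bM _ _ _ _ _ _ (C ^+ 2)) => //.
move=> x; rewrite /nrm2 /= expr0n addr0 -real_normK ?num_real// lerXn2r ?nnegrE//.
exact: le_trans (gC x).
Qed.

Lemma annihilator_bclosed : boundedly_closed [set g : T -> R |
  [/\ measurable_fun setT g, exists C, forall x, `|g x| <= C &
      cint (fun x => (g x)%:C%C * kappa x) = 0]].
Proof.
split=> [c f g [mf [C fC] f0] [mg [D gD] g0]|f_ f C Bf fC ff].
  split; first by apply: measurable_funD => //; exact: measurable_funM.
    by exists (`|c| * C + D) => x; rewrite (le_trans (ler_normD _ _))// lerD// normrM ler_wpM2l.
  have fk := cintegrable_rM mf fC; have gk := cintegrable_rM mg gD.
  rewrite (_ : (fun x => _) =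
    (fun x => c%:C%C * ((f x)%:C%C * kappa x) + (g x)%:C%C * kappa x)).
    by rewrite cintD ?cintZ ?f0 ?g0 ?mulr0 ?addr0//; exact: cintegrableZ.
  by apply/funext => x; rewrite rmorphD rmorphM/=; ring.
have mf : measurable_fun setT f.
  by apply: (measurable_fun_cvg (h := f_)) => [m|x _]; [case: (Bf m)|exact: ff].
have fC' x : `|f x| <= C.
  apply: (closed_cvg (fun y => `|y| <= C) _ _ _ (ff x)); last exact: nearW.
  rewrite (_ : (fun y => _) = `[- C, C]%classic); first exact: itv_closed.
  by apply/funext => y; apply/propext; rewrite /= in_itv/= ler_norml.
split => //; first by exists C.
have [kr km] := ki.
have mk := cintegrable_meas ki.
have Cx x : `|complex.Re (kappa x)| <= `|complex.Re (kappa x)| by [].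
have := @cint_cvg _ _ _ mu (fun n x => (f_ n x)%:C%C * kappa x)
  (fun x => (f x)%:C%C * kappa x)
  (fun x => C * (`|complex.Re (kappa x)| + `|complex.Im (kappa x)|)).
have -> : (fun n => cint (fun x => (f_ n x)%:C%C * kappa x)) = (fun=> 0).
  by apply/funext => n; case: (Bf n).
have C0 (x : T) : 0 <= C by rewrite (le_trans (normr_ge0 (f_ 0%N x))).
move=> h; apply/esym; apply: (ccvg_unique (ccvg_cst 0)) => //; apply: h.
- by move=> n; apply: cmeasurableM => //; apply: cmeasurable_real; case: (Bf n).
- by apply: cmeasurableM => //; exact: cmeasurable_real.
- by apply: rintegrableZ; apply: rintegrableD; exact: rintegrable_norm.
- move=> n x; rewrite cReM /= mul0r subr0 normrM mulrDr.
  by rewrite -[leLHS]addr0 lerD ?ler_wpM2r// mulr_ge0// (C0 x).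
- move=> n x; rewrite cImM /= mul0r addr0 normrM mulrDr addrC.
  by rewrite -[leLHS]addr0 lerD ?ler_wpM2r// mulr_ge0// (C0 x).
- apply: aeW => x; apply: ccvgM; last exact: ccvg_cst.
  by split => /=; [exact: ff|exact: cvg_cst].
Qed.

Lemma annihilator_ae :
  (forall A, measurable A -> cint (fun x => (\1_A x)%:C%C * kappa x) = 0) ->
  {ae mu, forall x, kappa x = 0}.
Proof.
move=> k0.
have vanish (f : T -> R) : rintegrable mu f ->
    (forall A, measurable A -> \int[mu]_x (\1_A x * f x) = 0) ->
    {ae mu, forall x, f x = 0}.
  move=> fi f0; have mf := rintegrable_meas fi.
  pose A := [set x | 0 <= f x].
  have mA : measurable A.
    rewrite -[A]setTI (_ : A = f @^-1` `[0, +oo[%classic); first exact: mf.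
    by apply/seteqP; split=> x /=; rewrite in_itv/= andbT.
  have bi B : measurable B -> rintegrable mu (fun x => \1_B x * f x).
    move=> mB; apply: le_rintegrable (rintegrable_norm fi).
      by apply: measurable_funM => //; exact: measurable_indic.
    by move=> x; rewrite normrM ler_piMl// indic_le1.
  have fA x : `|f x| = \1_A x * f x - \1_(~` A) x * f x.
    rewrite !indicE in_setC; have [xA|xA] := boolP (x \in A).
      by rewrite ger0_norm ?mul1r ?mul0r ?subr0//; move: xA; rewrite inE.
    rewrite mul1r mul0r sub0r ler0_norm//.
    by move: xA; rewrite notin_setE /A/= => /negP; rewrite -ltNge => /ltW.
  have : {ae mu, forall x, `|f x| = 0}.
    apply: rint_ge0_eq0 => //; first exact: rintegrable_norm.
    under eq_Rintegral do rewrite fA.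
    by rewrite rintB ?f0 ?subr0//; [exact: measurableC|exact: bi|apply: bi; exact: measurableC].
  by apply: filterS => x /normr0_eq0.
have [kr km] := ki.
have hr : {ae mu, forall x, complex.Re (kappa x) = 0}.
  apply: vanish => // A mA; have := congr1 (@complex.Re R) (k0 A mA) => /= <-.
  by apply: eq_Rintegral => x _; rewrite cReM /= mul0r subr0.
have hm : {ae mu, forall x, complex.Im (kappa x) = 0}.
  apply: vanish => // A mA; have := congr1 (@complex.Im R) (k0 A mA) => /= <-.
  by apply: eq_Rintegral => x _; rewrite cImM /= mul0r addr0.
by apply: filterS2 hr hm => x ? ?; exact: cplx_eq.
Qed.

End Annihilator.

(** The monotone class argument handles real functions; the two conjugate characters together give
    the cosine and the sine. *)
Lemma cexp_annihilates d (T : measurableType d) (R : realType)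
  (mu : {measure set T -> \bar R}) (kappa : T -> R[i]) (th : T -> R) :
  cintegrable mu kappa -> measurable_fun setT th ->
  cintegral mu setT (fun x => cexp (th x) * kappa x) = 0 ->
  cintegral mu setT (fun x => cexp (- th x) * kappa x) = 0 ->
  cintegral mu setT (fun x => (cos (th x))%:C%C * kappa x) = 0 /\
  cintegral mu setT (fun x => (sin (th x))%:C%C * kappa x) = 0.
Proof.
move=> ki mth e1 e2.
have h2 : 2^-1 = (2^-1 : R)%:C%C :> R[i] by rewrite fmorphV/= rmorph_nat.
have i (f : T -> R) : measurable_fun setT f -> cintegrable mu (fun x => cexp (f x) * kappa x).
  by move=> mf; apply: (cintegrable_bM (C := 1)) ki => [|x];
    [exact: cmeasurable_cexp|rewrite nrm2_cexp].
have i1 := i _ mth; have i2 : cintegrable mu (fun x => cexp (- th x) * kappa x).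
  by apply: i; exact: measurable_funN.
split.
  rewrite (_ : (fun x => _) = (fun x => 2^-1 * (cexp (th x) * kappa x + cexp (- th x) * kappa
    x))).
    by rewrite cintZ ?cintD ?e1 ?e2 ?addr0 ?mulr0//; exact: cintegrableD.
  apply/funext => x; rewrite cexpN -mulrDl mulrA; congr (_ * _).
  by rewrite h2; apply: cplx_eq; rewrite !ReImE /=; field.
rewrite (_ : (fun x => _) = (fun x => (2^-1 * - 'i%C) * (cexp (th x) * kappa x - cexp (- th x)
  * kappa x))).
  by rewrite cintZ ?cintB ?e1 ?e2 ?subr0 ?mulr0//; exact: cintegrableB.
apply/funext => x; rewrite cexpN -mulrBl mulrA; congr (_ * _).
by rewrite h2; apply: cplx_eq; rewrite !ReImE /=; field.
Qed.

Section TrigTotal.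
Context (R : realType).
Local Notation MR := (measurableTypeR R).

Definition char2 (p q : R) (z : MR * MR) : R[i] := cexp (p * z.1 + q * z.2).

Lemma char2E p q z : char2 p q z = cexp (p * z.1) * cexp (q * z.2).
Proof. exact: cexpD. Qed.

Lemma cmeasurable_char2 p q : cmeasurable (char2 p q).
Proof.
apply: cmeasurable_cexp; apply: measurable_funD; apply: measurable_funM => //.
Qed.

Lemma nrm2_char2 p q z : nrm2 (char2 p q z) <= 1.
Proof. by rewrite nrm2_cexp. Qed.

Lemma char2_annihilator_ae (mu : {measure set (MR * MR) -> \bar R}) kappa :
  cintegrable mu kappa ->
  (forall p q, cintegral mu setT (fun z => char2 p q z * kappa z) = 0) ->
  {ae mu, forall z, kappa z = 0}.
Proof.
move=> ki k0; apply: annihilator_ae => // A mA.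
have ml (p q : R) : measurable_fun setT (fun z : MR * MR => p * z.1 + q * z.2).
  by apply: measurable_funD; apply: measurable_funM.
have cs p q : cintegral mu setT (fun z => (cos (p * z.1 + q * z.2))%:C%C * kappa z) = 0 /\
    cintegral mu setT (fun z => (sin (p * z.1 + q * z.2))%:C%C * kappa z) = 0.
  apply: (cexp_annihilates ki (ml p q)); first exact: k0.
  rewrite -(k0 (- p) (- q)); congr (cintegral _ _ _); apply/funext => z.
  by rewrite /char2 !mulNr opprD.
have [] // := @boundedly_closed_borel2 R _ (annihilator_bclosed ki) _ _ A mA.
- move=> p q; split; last by case: (cs (ratr p) (ratr q)).
  + apply: measurableT_comp (ml _ _); exact: (continuous_measurable_fun (@continuous_cos R)).
  + by exists 1 => z; exact: norm_cos_le1.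
- move=> p q; split; last by case: (cs (ratr p) (ratr q)).
  + apply: measurableT_comp (ml _ _); exact: (continuous_measurable_fun (@continuous_sin R)).
  + by exists 1 => z; exact: norm_sin_le1.
Qed.

End TrigTotal.

Lemma cint_dominated_cvg d (T : measurableType d) (R : realType)
  (mu : {measure set T -> \bar R}) (w_ : nat -> T -> R[i]) w k : cintegrable mu k ->
  (forall n, cmeasurable (w_ n)) -> cmeasurable w ->
  (forall n z, nrm2 (w_ n z) <= 1) -> (forall z, ccvg (w_ ^~ z) (w z)) ->
  ccvg (fun n => cintegral mu setT (fun z => w_ n z * k z))
       (cintegral mu setT (fun z => w z * k z)).
Proof.
move=> ki mw_ mw w1 ww; have [kr km] := ki; have mk := cintegrable_meas ki.
apply: (cint_cvg (g := fun z => `|complex.Re (k z)| + `|complex.Im (k z)|)).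
- by move=> n; exact: cmeasurableM.
- exact: cmeasurableM.
- by apply: rintegrableD; exact: rintegrable_norm.
- by move=> n z; case: (mul_bound (k z) (w1 n z)).
- by move=> n z; case: (mul_bound (k z) (w1 n z)).
- by apply: aeW => z; apply: ccvgM; [exact: ww|exact: ccvg_cst].
Qed.

Section DiagonalCharacters.
Context (R : realType).
Local Notation MR := (measurableTypeR R).
Variable s : {finite_measure set MR -> \bar R}.
Variable eps : R.
Hypotheses (eps0 : 0 < eps) (eps1 : eps < 1).
Local Notation ss := (s \x s)%E.
Local Notation cint f := (cintegral (s \x s)%E setT f).

Definition limit_symbol (a : R) (x : MR) : R[i] :=
  (1 - eps)%:C%C * (\1_[set 0] x : R)%:C%C + eps%:C%C * psi (a * x).

Lemma limit_symbol0 a : limit_symbol a 0 = 1.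
Proof.
rewrite /limit_symbol mulr0 psi0 indicE mem_set// !mulr1 -rmorphD/=.
by rewrite subrK.
Qed.

Lemma limit_symbol_neq0 a x : x != 0 -> limit_symbol a x = eps%:C%C * psi (a * x).
Proof.
move=> x0; rewrite /limit_symbol indicE memNset ?mulr0 ?add0r//=.
by move=> /eqP; rewrite (negbTE x0).
Qed.

Lemma nrm2_real (r : R) : nrm2 r%:C%C = r ^+ 2.
Proof. by rewrite /nrm2 /= expr0n addr0. Qed.

Lemma nrm2_limit_symbol a x : nrm2 (limit_symbol a x) <= 1.
Proof.
have [->|x0] := eqVneq x 0; first by rewrite limit_symbol0 (nrm2_real 1) expr1n.
rewrite limit_symbol_neq0// nrm2M nrm2_real mulr_ile1 ?nrm2_ge0 ?sqr_ge0//.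
  by rewrite exprn_ile1// ltW.
exact: nrm2_psi_le1.
Qed.

Lemma cmeasurable_limit_symbol a : cmeasurable (limit_symbol a).
Proof.
apply: cmeasurableD; apply: cmeasurableM; try exact: cmeasurable_cst.
  by apply: cmeasurable_real; apply: measurable_indic; exact: measurable_set1.
by apply: cmeasurable_psi; exact: measurable_funM.
Qed.

Hypothesis weak_limits : forall a, 0 < a -> exists t_ : nat -> R,
  forall g, cintegrable s g ->
    weak_lim s (fun n x => cexp (t_ n * x)) (limit_symbol a) g.

Definition diag_ann (kappa : MR * MR -> R[i]) := cintegrable ss kappa /\
  forall t, cint (fun z => char2 t t z * kappa z) = 0.

Lemma cint_char2i p q kappa : cintegrable ss kappa ->
  cintegrable ss (fun z => char2 p q z * kappa z).
Proof. exact: cintegrable_bM (cmeasurable_char2 p q) (nrm2_char2 p q). Qed.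

Lemma diag_annD k1 k2 : diag_ann k1 -> diag_ann k2 -> diag_ann (fun z => k1 z + k2 z).
Proof.
move=> [i1 k10] [i2 k20]; split => [|t]; first exact: cintegrableD.
under [X in cintegral _ _ X]eq_fun do rewrite mulrDr.
by rewrite cintD ?k10 ?k20 ?addr0//; exact: cint_char2i.
Qed.

Lemma diag_annZ c k : diag_ann k -> diag_ann (fun z => c * k z).
Proof.
move=> [i0 k0]; split => [|t]; first exact: cintegrableZ.
under [X in cintegral _ _ X]eq_fun do rewrite mulrCA.
by rewrite cintZ ?k0 ?mulr0//; exact: cint_char2i.
Qed.

Definition symbol2 a (z : MR * MR) := limit_symbol a z.1 * limit_symbol a z.2.

Lemma cmeasurable_tensor (f g : MR -> R[i]) : cmeasurable f -> cmeasurable g ->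
  cmeasurable (fun z : MR * MR => f z.1 * g z.2).
Proof. by move=> mf mg; apply: cmeasurableM;
  [exact: cmeasurable_mp mf|exact: cmeasurable_mp mg]. Qed.

Lemma nrm2_symbol2 a z : nrm2 (symbol2 a z) <= 1.
Proof. by rewrite nrm2M mulr_ile1 ?nrm2_ge0// nrm2_limit_symbol. Qed.

Lemma cmeasurable_symbol2 a : cmeasurable (symbol2 a).
Proof. by apply: cmeasurable_tensor; exact: cmeasurable_limit_symbol. Qed.

(** Multiplying the character at time t by the one at time [t_ n] gives the character at time
    [t_ n + t]. The integrals along the sequence are therefore all 0, and so is their limit. *)
Lemma diag_ann_symbol2 a k : 0 < a -> diag_ann k -> diag_ann (fun z => symbol2 a z * k z).
Proof.
move=> a0 [ki k0]; split => [|t].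
  exact: cintegrable_bM (cmeasurable_symbol2 a) (nrm2_symbol2 a) ki.
have [t_ tw] := weak_limits a0.
have := @weak_lim_tensor _ _ _ s (fun n x => cexp (t_ n * x)) (limit_symbol a) _ _ _ _ tw
  (fun z => char2 t t z * k z) (cint_char2i t t ki).
rewrite /weak_lim.
have -> : (fun n => cint (fun z : MR * MR =>
    cexp (t_ n * z.1) * cexp (t_ n * z.2) * (char2 t t z * k z))) = (fun=> 0).
  apply/funext => n; rewrite -[RHS](k0 (t_ n + t)); congr (cintegral _ _ _).
  by apply/funext => z; rewrite -cexpD mulrA -cexpD; congr (cexp _ * _); ring.
move=> h; apply/esym; apply: (ccvg_unique (ccvg_cst 0)).
rewrite (_ : (fun z => _) = (fun z => limit_symbol a z.1 * limit_symbol a z.2 *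
    (char2 t t z * k z))); last by apply/funext => z; rewrite /symbol2 mulrCA.
apply: h.
- by move=> n; apply: cmeasurable_cexp; exact: measurable_funM.
- exact: cmeasurable_limit_symbol.
- by move=> n x; rewrite nrm2_cexp.
- by move=> x; exact: nrm2_limit_symbol.
Qed.

Definition unit_symbol (x : MR) : R := if x == 0 then 1 else eps.

Lemma limit_symbol_cvg x :
  ccvg (fun n => limit_symbol n.+1%:R^-1 x) (unit_symbol x)%:C%C.
Proof.
rewrite /unit_symbol; have [->|x0] := eqVneq x 0.
  by under eq_fun do rewrite limit_symbol0; exact: ccvg_cst.
under eq_fun do rewrite limit_symbol_neq0//.
by rewrite -[X in ccvg _ X]mulr1; apply: ccvgM (ccvg_cst _) (psi_cvg x).
Qed.

Lemma measurable_unit_symbol : measurable_fun setT unit_symbol.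
Proof.
rewrite (_ : unit_symbol = (fun x => (1 - eps) * \1_[set 0] x + eps)).
  by apply: measurable_funD => //; apply: measurable_funM => //.
apply/funext => x; rewrite /unit_symbol indicE; have [->|x0] := eqVneq x 0.
  by rewrite mem_set// mulr1 subrK.
by rewrite memNset ?mulr0 ?add0r//= => /eqP; rewrite (negbTE x0).
Qed.

(** Taking a = 1/(n+1) and letting n grow, psi tends to 1 pointwise, and only the jump of the symbol
    at 0 survives. *)
Lemma diag_ann_unit k : diag_ann k ->
  diag_ann (fun z => (unit_symbol z.1 * unit_symbol z.2)%:C%C * k z).
Proof.
move=> /[dup] kd [ki k0].
have mu : cmeasurable (fun z : MR * MR => (unit_symbol z.1 * unit_symbol z.2)%:C%C : R[i]).
  apply: cmeasurable_real; apply: measurable_funM;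
    apply: (measurableT_comp measurable_unit_symbol) => //.
have u1 x : 0 <= unit_symbol x <= 1.
  by rewrite /unit_symbol; case: ifP => _; rewrite ?ler01 ?lexx// !ltW.
have uu1 z : nrm2 (unit_symbol z.1 * unit_symbol z.2)%:C%C <= 1.
  rewrite nrm2_real exprMn mulr_ile1 ?sqr_ge0// exprn_ile1//.
  - by have /andP[] := u1 z.1.
  - by have /andP[] := u1 z.1.
  - by have /andP[] := u1 z.2.
  - by have /andP[] := u1 z.2.
split => [|t]; first exact: cintegrable_bM mu uu1 ki.
have eki := cint_char2i t t ki.
have := @cint_dominated_cvg _ _ _ ss (fun n => symbol2 n.+1%:R^-1) _ _ eki
   (fun n => cmeasurable_symbol2 _) mu (fun n => nrm2_symbol2 _).
have -> : (fun n => cint (fun z => symbol2 n.+1%:R^-1 z * (char2 t t z * k z))) = (fun=> 0).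
  apply/funext => n; have [|_ h] := @diag_ann_symbol2 n.+1%:R^-1 k _ kd.
    by rewrite invr_gt0 ltr0n.
  by rewrite -[RHS](h t); congr (cintegral _ _ _); apply/funext => z; rewrite mulrCA.
move=> h; apply/esym; apply: (ccvg_unique (ccvg_cst 0)).
under [X in ccvg _ (cintegral _ _ X)]eq_fun do rewrite mulrCA.
apply: h => z; rewrite rmorphM/=.
by apply: ccvgM; exact: limit_symbol_cvg.
Qed.

Definition off_axes (z : MR * MR) : R := ((z.1 != 0) && (z.2 != 0))%:R.

(** Lagrange interpolation in the product u of the two unit symbols, whose values are 1 at the
    origin, eps on the rest of the axes and eps^2 elsewhere. The polynomial (u - 1)(u - eps) kills
    the first two and equals (1 - eps^2)(eps - eps^2) at the third. *)
Lemma diag_ann_off_axes k : diag_ann k -> diag_ann (fun z => (off_axes z)%:C%C * k z).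
Proof.
move=> kd; pose u (z : MR * MR) := unit_symbol z.1 * unit_symbol z.2.
have ukd := diag_ann_unit kd; have uukd := diag_ann_unit ukd.
have c0 : (1 - eps ^+ 2) * (eps - eps ^+ 2) != 0.
  by rewrite mulf_neq0 ?gt_eqF// subr_gt0 ?exprn_ilt1 ?ltW// expr2 gtr_pMr.
have := diag_annZ ((1 - eps ^+ 2) * (eps - eps ^+ 2))^-1%:C%C
  (diag_annD (diag_annD (diag_annZ eps%:C%C kd) (diag_annZ (- (1 + eps)%:C%C) ukd)) uukd).
congr diag_ann; apply/funext => z.
rewrite -/(u z) !mulrA -!mulrDl mulrA; congr (_ * _).
rewrite -rmorphN -!rmorphM -!rmorphD/= -rmorphM/=; congr (_%:C)%C.
apply: (mulfI c0); rewrite mulVKf// /u /off_axes /unit_symbol.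
by case: eqP => _; case: eqP => _ /=; ring.
Qed.

(* The integral of [e^{ivx}] over [v] from [p] to [q]. *)
Definition exp_int (p q : R) (x : MR) : R[i] :=
  (q - p)%:C%C * (cexp (p * x) * psi ((q - p) * x)).

Lemma exp_intE p q x : 'i%C * x%:C%C * exp_int p q x = cexp (q * x) - cexp (p * x).
Proof.
have -> : 'i%C * x%:C%C * exp_int p q x =
   cexp (p * x) * ('i%C * ((q - p) * x)%:C%C * psi ((q - p) * x)).
  by rewrite /exp_int rmorphM/=; ring.
by rewrite mul_psi mulrBr mulr1 -cexpD -mulrDl [p + _]addrC subrK.
Qed.

Lemma exp_intD p q r x : exp_int p r x = exp_int p q x + exp_int q r x.
Proof.
have [->|x0] := eqVneq x 0.
  by rewrite /exp_int !mulr0 psi0 cexp0 !mulr1 -rmorphD/=; congr (_%:C)%C; ring.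
have ix0 : 'i%C * x%:C%C != 0 :> R[i].
  rewrite mulf_neq0//; first by rewrite eq_complex/= eqxx/= oner_eq0.
  by rewrite eq_complex/= eqxx andbT.
by apply: (mulfI ix0); rewrite mulrDr !exp_intE; ring.
Qed.

Definition cbounded (f : MR -> R[i]) := cmeasurable f /\ exists C, forall x, nrm2 (f x) <= C.

Lemma cbounded_exp_psi p h : cbounded (fun x => cexp (p * x) * psi (h * x)).
Proof.
split; last by exists 1 => x; rewrite nrm2M nrm2_cexp mul1r nrm2_psi_le1.
by apply: cmeasurableM; [apply: cmeasurable_cexp|apply: cmeasurable_psi];
  exact: measurable_funM.
Qed.

Lemma cboundedZ c f : cbounded f -> cbounded (fun x => c * f x).
Proof.
move=> [mf [C fC]]; split.
  by apply: cmeasurableM => //; exact: cmeasurable_cst.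
by exists (nrm2 c * C) => x; rewrite nrm2M ler_wpM2l ?nrm2_ge0.
Qed.

Lemma cbounded_exp_int p q : cbounded (exp_int p q).
Proof. by apply: cboundedZ; exact: cbounded_exp_psi. Qed.

Section BilinearForm.
Variable k : MR * MR -> R[i].
Hypothesis kd : diag_ann k.
Hypothesis k_off : forall z, k z = (off_axes z)%:C%C * k z.

Definition tensor_pairing f g := cint (fun z => f z.1 * g z.2 * k z).

Lemma cintegrable_pairing f g : cbounded f -> cbounded g ->
  cintegrable ss (fun z => f z.1 * g z.2 * k z).
Proof.
move=> [mf [C fC]] [mg [D gD]]; have [ki _] := kd.
apply: (@cintegrable_bM _ _ _ _ _ _ (C * D)) ki; first exact: cmeasurable_tensor.
by move=> z; rewrite nrm2M ler_pM ?nrm2_ge0.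
Qed.

Lemma tensor_pairingDl f f' g : cbounded f -> cbounded f' -> cbounded g ->
  tensor_pairing (fun x => f x + f' x) g = tensor_pairing f g + tensor_pairing f' g.
Proof.
move=> bf bf' bg; rewrite /tensor_pairing -cintD; [|exact: cintegrable_pairing..].
by congr (cintegral _ _ _); apply/funext => z; rewrite !mulrDl.
Qed.

Lemma tensor_pairingDr f g g' : cbounded f -> cbounded g -> cbounded g' ->
  tensor_pairing f (fun x => g x + g' x) = tensor_pairing f g + tensor_pairing f g'.
Proof.
move=> bf bg bg'; rewrite /tensor_pairing -cintD; [|exact: cintegrable_pairing..].
by congr (cintegral _ _ _); apply/funext => z; rewrite !mulrDr !mulrDl.
Qed.

Lemma tensor_pairingZ c d f g : cbounded f -> cbounded g ->
  tensor_pairing (fun x => c * f x) (fun x => d * g x) = c * d * tensor_pairing f g.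
Proof.
move=> bf bg; rewrite /tensor_pairing -cintZ; last exact: cintegrable_pairing.
by congr (cintegral _ _ _); apply/funext => z; ring.
Qed.

(** The averaging length is taken equal to q - p. Off the axes, the symbol times the diagonal
    character at p is eps^2 times the product of the means of [e^{ivx}] and [e^{ivy}] over v in
    [p, q]. *)
Lemma pairing_square p q : p < q -> tensor_pairing (exp_int p q) (exp_int p q) = 0.
Proof.
move=> pq; have h0 : 0 < q - p by rewrite subr_gt0.
rewrite tensor_pairingZ; [|exact: cbounded_exp_psi..].
have [_ /(_ p)] := diag_ann_symbol2 h0 kd.
suff -> : cint (fun z => char2 p p z * (symbol2 (q - p) z * k z)) = (eps%:C%C * eps%:C%C) *
    tensor_pairing (fun x => cexp (p * x) * psi ((q - p) * x))
      (fun x => cexp (p * x) * psi ((q - p) * x)).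
  move/eqP; rewrite mulf_eq0 => /orP[|/eqP->]; last by rewrite mulr0.
  by rewrite mulf_eq0 orbb eq_complex/= eqxx andbT gt_eqF.
rewrite -tensor_pairingZ; [|exact: cbounded_exp_psi..].
congr (cintegral _ _ _); apply/funext => z; rewrite k_off /off_axes.
have [z1|z1] := eqVneq z.1 0; first by rewrite !mul0r !mulr0.
have [z2|z2] := eqVneq z.2 0; first by rewrite !mul0r !mulr0.
by rewrite /symbol2 !limit_symbol_neq0// char2E; ring.
Qed.

Definition sym_pairing f g := tensor_pairing f g + tensor_pairing g f.

Lemma sym_pairing_adjacent p q r : p < q -> q < r ->
  sym_pairing (exp_int p q) (exp_int q r) = 0.
Proof.
move=> pq qr; have := pairing_square (lt_trans pq qr).
have -> : exp_int p r = (fun x => exp_int p q x + exp_int q r x).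
  by apply/funext => x; rewrite -exp_intD.
have b := cbounded_exp_int.
have bD : cbounded (fun x => exp_int p q x + exp_int q r x).
  rewrite (_ : (fun x => _) = exp_int p r) //; apply/funext => x; rewrite -exp_intD//.
rewrite tensor_pairingDl// !tensor_pairingDr// !pairing_square// addr0 add0r.
by [].
Qed.

(** The gap is filled: [q, u] and its initial piece [q, r] are both adjacent to [p, q], and the
    pairing with [r, u] is the difference of the two. *)
Lemma sym_pairing_separated p q r u : p < q -> q <= r -> r < u ->
  sym_pairing (exp_int p q) (exp_int r u) = 0.
Proof.
move=> pq; rewrite le_eqVlt => /predU1P[<-|qr] ru; first exact: sym_pairing_adjacent.
have := sym_pairing_adjacent pq (lt_trans qr ru).
have -> : exp_int q u = (fun x => exp_int q r x + exp_int r u x).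
  by apply/funext => x; rewrite -exp_intD.
have b := cbounded_exp_int.
rewrite /sym_pairing tensor_pairingDr// tensor_pairingDl// addrACA.
by have := sym_pairing_adjacent pq qr; rewrite /sym_pairing => ->; rewrite add0r.
Qed.

Lemma sym_pairing_char_lt p r : p < r -> sym_pairing (fun x => cexp (p * x)) (fun x =>
  cexp (r * x)) = 0.
Proof.
(* The lengths are fractions of [r - p], so that the interval starting at p never reaches past r. *)
move=> pr; pose h n : R := n.+1%:R^-1 * (r - p).
have h0 n : 0 < h n by rewrite mulr_gt0 ?subr_gt0// invr_gt0.
have hr n : p + h n <= r.
  rewrite -lerBrDl ler_piMl ?subr_ge0 ?(ltW pr)// invf_le1// ler1n//.
pose f n x := cexp (p * x) * psi (h n * x).
pose g n x := cexp (r * x) * psi (h n * x).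
have fg n : sym_pairing (f n) (g n) = 0.
  have := sym_pairing_separated (_ : p < p + h n) (hr n) (_ : r < r + h n).
  rewrite !ltrDl => /(_ (h0 n) (h0 n)); rewrite /sym_pairing /exp_int.
  have -> : p + h n - p = h n by ring.
  have -> : r + h n - r = h n by ring.
  rewrite !tensor_pairingZ; try exact: cbounded_exp_psi.
  rewrite -mulrDr => /eqP; rewrite mulf_eq0 => /orP[|/eqP//].
  by rewrite mulf_eq0 orbb eq_complex/= eqxx andbT gt_eqF.
have [ki _] := kd.
have fc (a : R) x : ccvg (fun n => cexp (a * x) * psi (h n * x)) (cexp (a * x)).
  rewrite -[X in ccvg _ X]mulr1; apply: ccvgM (ccvg_cst _) _.
  by under eq_fun do rewrite -mulrA; exact: psi_cvg.
have mc (a : R) : cmeasurable (fun x : MR => cexp (a * x)).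
  by apply: cmeasurable_cexp; exact: measurable_funM.
have mp (a : R) n : cmeasurable (fun x : MR => cexp (a * x) * psi (h n * x)).
  by have [] := cbounded_exp_psi a (h n).
have lim (a b : R) : ccvg (fun n => tensor_pairing (fun x => cexp (a * x) * psi (h n * x))
     (fun x => cexp (b * x) * psi (h n * x)))
    (tensor_pairing (fun x => cexp (a * x)) (fun x => cexp (b * x))).
  apply: cint_dominated_cvg ki _ _ _ _.
  - by move=> n; apply: (@cmeasurable_tensor (fun x : MR =>
    cexp (a * x) * psi (h n * x)) (fun x : MR => cexp (b * x) * psi (h n * x))).
  - exact: (@cmeasurable_tensor (fun x : MR => cexp (a * x)) (fun x : MR => cexp (b * x))).
  - by move=> n z; rewrite !nrm2M !nrm2_cexp !mul1r mulr_ile1 ?nrm2_ge0 ?nrm2_psi_le1.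
  - by move=> z; apply: ccvgM; exact: fc.
apply: (ccvg_unique (ccvgD (lim p r) (lim r p))).
suff: ccvg (fun n => sym_pairing (f n) (g n)) 0 by [].
by under eq_fun do rewrite fg; exact: ccvg_cst.
Qed.

Lemma sym_pairing_char p r : sym_pairing (fun x => cexp (p * x)) (fun x => cexp (r * x)) = 0.
Proof.
have [pr|rp|<-] := ltgtP p r; first exact: sym_pairing_char_lt.
  by rewrite /sym_pairing addrC; exact: sym_pairing_char_lt.
have [_ /(_ p) k0] := kd.
suff h : tensor_pairing (fun x => cexp (p * x)) (fun x => cexp (p * x)) = 0.
  by rewrite /sym_pairing h addr0.
by rewrite -[RHS]k0; congr (cintegral _ _ _); apply/funext => z; rewrite char2E.
Qed.

End BilinearForm.

(* [k] splits into its part off the axes, handled through squares, and its part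
   on the axes, where [e^{i(px+ry)} + e^{i(rx+py)} = e^{ip(x+y)} + e^{ir(x+y)}]. *)
Theorem diag_ann_antisymmetric k : diag_ann k ->
  {ae ss, forall z, k z + k (pswap z) = 0}.
Proof.
move=> kd; have [ki k0] := kd.
have mk := cintegrable_meas ki.
have ksi : cintegrable ss (fun z => k (pswap z)).
  exact: (cintegrable_mp (@measurable_pswap _ MR) (pswap_pres s) ki).
apply: char2_annihilator_ae; first exact: cintegrableD.
move=> p r.
have -> : cint (fun z => char2 p r z * (k z + k (pswap z))) =
    cint (fun z => char2 p r z * k z) + cint (fun z => char2 r p z * k z).
  rewrite -(cint_mp (@measurable_pswap _ MR) (pswap_pres s) (cint_char2i r p ki)).
  rewrite -cintD; last 2 first.
  - exact: cint_char2i.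
  - exact: (cintegrable_mp (@measurable_pswap _ MR) (pswap_pres s) (cint_char2i r p ki)).
  congr (cintegral _ _ _); apply/funext => z; rewrite mulrDr /char2 /pswap /=.
  by rewrite [r * _ + _]addrC.
pose k2 z := (off_axes z)%:C%C * k z.
pose k3 z := k z + (-1) * k2 z.
have k2d : diag_ann k2 by exact: diag_ann_off_axes.
have k3d : diag_ann k3 by apply: diag_annD => //; exact: diag_annZ.
have kE z : k z = k2 z + k3 z by rewrite /k3; ring.
have split23 a b : cint (fun z => char2 a b z * k z) =
    cint (fun z => char2 a b z * k2 z) + cint (fun z => char2 a b z * k3 z).
  have [i2 _] := k2d; have [i3 _] := k3d.
  rewrite -cintD; [|exact: cint_char2i..].
  by congr (cintegral _ _ _); apply/funext => z; rewrite kE mulrDr.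
rewrite !split23 addrACA.
have -> : cint (fun z => char2 p r z * k2 z) + cint (fun z => char2 r p z * k2 z) = 0.
  have koff z : k2 z = (off_axes z)%:C%C * k2 z.
    rewrite /k2 mulrA -rmorphM/=; congr (_%:C%C * _).
    by rewrite /off_axes; case: (_ && _); rewrite ?mulr1 ?mulr0.
  have := sym_pairing_char k2d koff p r; rewrite /sym_pairing /tensor_pairing.
  by congr (_ + _ = _); congr (cintegral _ _ _); apply/funext => z; rewrite char2E.
rewrite add0r.
have [i3 k30] := k3d.
rewrite -cintD; [|exact: cint_char2i..].
rewrite (_ : (fun z => _) = (fun z => char2 p p z * k3 z + char2 r r z * k3 z)).
  by rewrite cintD ?k30 ?addr0//; exact: cint_char2i.
apply/funext => z; rewrite -!mulrDl.
have [[z1 z2]|k3z] := pselect (z.1 != 0 /\ z.2 != 0).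
  by rewrite /k3 /k2 /off_axes z1 z2 mul1r mulN1r subrr !mulr0.
congr (_ * _); rewrite !char2E.
have [z1|z1] := eqVneq z.1 0; first by rewrite z1 !mulr0 cexp0 !mul1r addrC.
have [z2|z2] := eqVneq z.2 0; first by rewrite z2 !mulr0 cexp0 !mulr1.
by exfalso; apply: k3z.
Qed.

End DiagonalCharacters.

(** * Bochner's theorem *)

Section FiniteFourier.
Context (R : realType).

Lemma cexp_sum_pow (x : R) n : cexp (n%:R * x) = cexp x ^+ n.
Proof.
elim: n => [|n ih]; first by rewrite mul0r cexp0 expr0.
by rewrite -natr1 mulrDl mul1r cexpD ih exprSr.
Qed.

Lemma cexp_neq1 (x : R) : 0 < `|x| -> `|x| < 2 * pi -> cexp x != 1.
Proof.
move=> x0 xpi; apply/eqP => /(congr1 (@complex.Re R)) /= c1.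
have s0 : 0 < sin (`|x| / 2) by apply: sin_gt0_pi; apply/andP; split; lra.
have := cos_norm x; rewrite c1 (_ : `|x| = `|x| / 2 + `|x| / 2); last by field.
rewrite cosD; have := cos2Dsin2 (`|x| / 2); move: (cos _) (sin _) s0 => c s s0 h1 h2.
by nra.
Qed.

Lemma cexp_2pi_nat n : cexp (n%:R * (2 * pi)) = 1 :> R[i].
Proof.
rewrite cexp_sum_pow (_ : cexp (2 * pi) = 1) ?expr1n//.
by rewrite /cexp mulr_natl cos2pi sin2pi.
Qed.

Lemma cexp_2pi_int (m n : nat) : cexp ((m%:R - n%:R) * (2 * pi)) = 1 :> R[i].
Proof.
by rewrite mulrBl cexpD cexpN !cexp_2pi_nat rmorph1 mulr1.
Qed.

(** The exponentials run through all the 2N-th roots of unity, shifted by half a turn. The two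
    bounds say that m and n differ by less than 2N, so that they agree modulo 2N only when equal;
    otherwise the geometric sum vanishes. *)
Lemma dft_orthogonality (N m n : nat) : (0 < N)%N -> (m < n + 2 * N)%N ->
  (n < m + 2 * N)%N ->
  \sum_(j < 2 * N) cexp (pi * (j%:R - N%:R) / N%:R * (m%:R - n%:R)) =
  (if m == n then (2 * N)%:R else 0) :> R[i].
Proof.
move=> N0 mn nm; have [->|mneq] := eqVneq m n.
  under eq_bigr do rewrite subrr mulr0 cexp0.
  by rewrite sumr_const card_ord.
have NR : 0 < N%:R :> R by rewrite ltr0n.
pose x : R := pi * (m%:R - n%:R) / N%:R.
have mn' : m%:R - n%:R != 0 :> R by rewrite subr_eq0 eqr_nat.
have -> : \sum_(j < 2 * N) cexp (pi * (j%:R - N%:R) / N%:R * (m%:R - n%:R)) =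
    cexp (- (pi * (m%:R - n%:R))) * \sum_(j < 2 * N) cexp x ^+ j :> R[i].
  rewrite mulr_sumr; apply: eq_bigr => j _.
  by rewrite -cexp_sum_pow -cexpD /x; congr cexp; field; rewrite gt_eqF.
have z1 : cexp x != 1.
  apply: cexp_neq1; rewrite /x !normrM normfV (ger0_norm (pi_ge0 R)) (gtr0_norm NR).
    by rewrite !mulr_gt0 ?pi_gt0 ?invr_gt0 ?normr_gt0.
  rewrite -mulrA [2 * pi]mulrC ltr_pM2l ?pi_gt0// ltr_pdivrMr//.
  rewrite ltr_norml ltrBrDl ltrBlDl -natrM -!natrD !ltr_nat -!(ltr_nat R) !natrD.
  by move: mn nm; rewrite -!(ltr_nat R) !natrD; lra.
have : (cexp x - 1) * \sum_(j < 2 * N) cexp x ^+ j = 0.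
  rewrite -subrX1 -cexp_sum_pow (_ : _ * x = (m%:R - n%:R) * (2 * pi)).
    by rewrite cexp_2pi_int subrr.
  by rewrite /x natrM; field; rewrite gt_eqF.
by move/eqP; rewrite mulf_eq0 subr_eq0 (negbTE z1)/= => /eqP ->; rewrite mulr0.
Qed.

Variable phi : R -> R[i].
Hypothesis phiN : forall t, phi (- t) = (phi t)^*.
Hypothesis phi_pd : forall n (c : 'I_n -> R[i]) (t : 'I_n -> R),
  0 <= complex.Re (\sum_(a < n) \sum_(b < n) c a * (c b)^* * phi (t a - t b)).

Variables (N : nat) (h : R).
Hypothesis N0 : (0 < N)%N.

Definition dft_angle (j : nat) : R := pi * (j%:R - N%:R) / N%:R.

Definition dft_sum (j : nat) : R[i] := \sum_(a < N) \sum_(b < N)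
  cexp (- (dft_angle j * (a%:R - b%:R))) * phi ((a%:R - b%:R) * h).

(* Positivity of [phi] makes these Fejer weights nonnegative; they are the masses
   that approximate the spectral measure at the points [dft_angle j / h]. *)
Definition dft_weight (j : nat) : R := (2 * N%:R ^+ 2)^-1 * complex.Re (dft_sum j).

Lemma dft_weight_ge0 j : 0 <= dft_weight j.
Proof.
rewrite mulr_ge0 ?invr_ge0 ?mulr_ge0 ?exprn_ge0//.
have := phi_pd (fun a : 'I_N => cexp (- (dft_angle j * a%:R))) (fun a => a%:R * h).
congr (0 <= complex.Re _); apply: eq_bigr => a _; apply: eq_bigr => b _.
by rewrite -cexpN -cexpD -mulrBl; congr (cexp _ * _); ring.
Qed.

Lemma dft_sum_conj j : (dft_sum j)^* = dft_sum j.
Proof.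
rewrite /dft_sum rmorph_sum/= exchange_big/=; apply: eq_bigr => a _.
rewrite rmorph_sum/=; apply: eq_bigr => b _.
by rewrite rmorphM/= -cexpN -phiN; congr (cexp _ * phi _); ring.
Qed.

Lemma dft_weightE j : (dft_weight j)%:C%C = (2 * N%:R ^+ 2)^-1 * dft_sum j.
Proof.
have i0 : complex.Im (dft_sum j) = 0.
  by have := congr1 (@complex.Im R) (dft_sum_conj j); rewrite cImJ; lra.
have -> : (2 * N%:R ^+ 2)^-1 = ((2 * N%:R ^+ 2)^-1 : R)%:C%C :> R[i].
  by rewrite fmorphV/= rmorphM rmorphXn/= !rmorph_nat.
by apply: cplx_eq; rewrite !ReImE /= ?i0 /dft_weight; ring.
Qed.

(** Orthogonality keeps the pairs of indices below N with difference l. There are N - l of them,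
    whence the Fejer factor 1 - l/N. *)
Lemma dft_inversion (l : nat) : (l <= N)%N ->
  \sum_(j < 2 * N) (dft_weight j)%:C%C * cexp (dft_angle j * l%:R) =
  (1 - l%:R / N%:R) * phi (l%:R * h).
Proof.
move=> lN; have NR : N%:R != 0 :> R[i] by rewrite pnatr_eq0 -lt0n.
under eq_bigr => j _.
  rewrite dft_weightE /dft_sum -mulrA mulr_suml.
  under eq_bigr => a _.
    rewrite mulr_suml.
    under eq_bigr => b _.
      rewrite mulrAC -cexpD.
      rewrite (_ : _ + _ = dft_angle j * ((l + b)%N%:R - a%:R)); last by rewrite natrD; ring.
      over.
    over.
  over.
rewrite -mulr_sumr exchange_big/=.
have -> : \sum_(a < N) \sum_(j < 2 * N) \sum_(b < N)
     cexp (dft_angle j * ((l + b)%N%:R - a%:R)) * phi ((a%:R - b%:R) * h) =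
   \sum_(a < N) \sum_(b < N) (if (l + b == a)%N then (2 * N)%:R * phi (l%:R * h) else 0).
  apply: eq_bigr => a _; rewrite exchange_big/=; apply: eq_bigr => b _.
  rewrite -mulr_suml dft_orthogonality//; last first.
  - by have := ltn_ord a; lia.
  - by have := ltn_ord b; lia.
  case: eqP => [<-|_]; last by rewrite mul0r.
  by congr (_ * phi _); rewrite natrD; ring.
rewrite exchange_big/=.
under eq_bigr => b _.
  rewrite -big_mkcond/= (_ : \sum_(a < N | _) _ = if (l + b < N)%N then (2 * N)%:R * phi (l%:R
    * h) else 0).
    over.
  case: ifP => [lbN|/negbT]; first by rewrite (big_pred1 (Ordinal lbN))// => a; rewrite eq_sym.
  rewrite -leqNgt => Nlb; rewrite big_pred0// => a.
  by apply/negbTE; rewrite gtn_eqF// (leq_trans (ltn_ord a)).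
rewrite -big_mkcond/= (eq_bigl (fun b : 'I_N => (b < N - l)%N)); last first.
  by move=> b; rewrite ltn_subRL.
rewrite (big_ord_narrow (leq_subr l N)) sumr_const card_ord -[(_ * phi _) *+ _]mulr_natl.
by rewrite natrB// natrM; field; rewrite NR.
Qed.

Lemma sum_dft_weight : \sum_(j < 2 * N) dft_weight j = complex.Re (phi 0).
Proof.
have := dft_inversion (leq0n N); rewrite !mul0r subr0 mul1r => <-.
rewrite (raddf_sum (@complex.Re R : Rcomplex R -> R))/=.
by apply: eq_bigr => j _; rewrite mulr0 cos0 mulr1 mul0r subr0.
Qed.

(** Concavity of the sine. Its mean slopes over [0, y] and [y, pi/2] are values of the cosine at
    points c < e, and the cosine decreases. *)
Lemma jordan (y : R) : 0 <= y <= pi / 2 -> 2 / pi * y <= sin y.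
Proof.
have pi0 := pi_gt0 R.
move=> /andP[]; rewrite le_eqVlt => /predU1P[<- _|y0]; first by rewrite mulr0 sin0.
rewrite le_eqVlt => /predU1P[->|yp].
  rewrite sin_pihalf le_eqVlt; apply/orP; left; apply/eqP.
  by move: (@pi R) (lt0r_neq0 pi0) => p pn; field.
have [c /[!in_itv]/= /andP[c0 cy]] := MVT y0 (fun z _ => is_derive_sin z)
  (continuous_subspaceT (@continuous_sin R)).
have [e /[!in_itv]/= /andP[ye ep]] := MVT yp (fun z _ => is_derive_sin z)
  (continuous_subspaceT (@continuous_sin R)).
rewrite sin0 !subr0 sin_pihalf => se sc.
have ce : cos e <= cos c.
  by rewrite ltW// ltr_cos ?in_itv/=; [lra|apply/andP; split; lra..].
rewrite mulrC mulrA ler_pdivrMr//.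
have : (1 - sin y) * y <= sin y * (pi / 2 - y).
  have k0 : 0 <= (pi / 2 - y) * y by rewrite mulr_ge0 ?subr_ge0 ?(ltW yp) ?(ltW y0).
  have := ler_wpM2r k0 ce; rewrite se sc; congr (_ <= _); ring.
by lra.
Qed.

Lemma nrm2_cexpB1_ge (x : R) : `|x| <= pi -> 4 / pi ^+ 2 * x ^+ 2 <= nrm2 (cexp x - 1).
Proof.
move=> xpi; have pi0 := pi_gt0 R.
have nE : nrm2 (cexp x - 1) = 4 * sin (`|x| / 2) ^+ 2.
  rewrite nrm2_cexpB1E; congr (_ * _).
  have [x0|x0] := ger0P x; first by [].
  by rewrite mulNr sinN sqrrN.
rewrite nE -[x ^+ 2]real_normK ?num_real//.
have /jordan : 0 <= `|x| / 2 <= pi / 2 by rewrite divr_ge0//=; lra.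
rewrite -(@ler_pXn2r _ 2)// ?nnegrE; last 2 first.
- by rewrite mulr_ge0 ?divr_ge0 ?(ltW pi0).
- by apply: sin_ge0_pi; rewrite divr_ge0//=; lra.
move: (sin _) => s; rewrite (_ : (2 / pi * (`|x| / 2)) ^+ 2 = `|x| ^+ 2 / pi ^+ 2); last first.
  by move: (@pi R) (lt0r_neq0 pi0) => p pn; field.
by rewrite (_ : 4 / pi ^+ 2 * _ = 4 * (`|x| ^+ 2 / pi ^+ 2)) ?ler_pM2l//; ring.
Qed.

(** A normalised Dirichlet sum: it equals 1 at x = 0 and is small for x far from 0, so that 1 -
    [cexp_mean] detects the mass away from 0. *)
Definition cexp_mean (L : nat) (x : R) : R :=
  L%:R^-1 * complex.Re (\sum_(l < L) cexp (x * l%:R)).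

Lemma cexp_mean_le1 L x : (0 < L)%N -> cexp_mean L x <= 1.
Proof.
move=> L0; rewrite /cexp_mean ler_pdivrMl ?ltr0n// mulr1.
rewrite (raddf_sum (@complex.Re R : Rcomplex R -> R))/=.
apply: (@le_trans _ _ (\sum_(l < L) 1)); last by rewrite sumr_const card_ord.
by apply: ler_sum => l _; exact: cos_le1.
Qed.

(** The geometric sum has modulus at most 2 divided by the chord, hence at most pi / |x| by Jordan's
    inequality; the condition on L makes this at most L/2. *)
Lemma cexp_mean_le_half L x : (0 < L)%N -> 2 * pi <= L%:R * `|x| -> `|x| <= pi ->
  cexp_mean L x <= 2^-1.
Proof.
move=> L0 Lx xpi; have pi0 := pi_gt0 R; have LR : 0 < L%:R :> R by rewrite ltr0n.
rewrite /cexp_mean ler_pdivrMl//; set S := \sum_(l < L) _.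
have SE : (cexp x - 1) * S = cexp (L%:R * x) - 1.
  rewrite /S cexp_sum_pow subrX1; congr (_ * _); apply: eq_bigr => i _.
  by rewrite mulrC cexp_sum_pow.
have S4 : nrm2 (cexp x - 1) * nrm2 S <= 4.
  rewrite -nrm2M SE nrm2_cexpB1E; have := sin_le1 (L%:R * x / 2).
  by have := sin_geN1 (L%:R * x / 2); nra.
have x0 : 0 < `|x|.
  rewrite lt_neqAle normr_ge0 andbT eq_sym; apply/eqP => xx.
  by move: Lx; rewrite xx mulr0; lra.
have S2 : nrm2 S <= (L%:R / 2) ^+ 2.
  have : 4 / pi ^+ 2 * x ^+ 2 * nrm2 S <= 4.
    by apply: le_trans S4; rewrite ler_wpM2r ?nrm2_ge0// nrm2_cexpB1_ge.
  rewrite -[x ^+ 2]real_normK ?num_real// => hb.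
  have : (2 * pi) ^+ 2 * nrm2 S <= (L%:R * pi) ^+ 2.
    have : (2 * pi) ^+ 2 * nrm2 S <= (L%:R * `|x|) ^+ 2 * nrm2 S.
      by rewrite ler_wpM2r ?nrm2_ge0// lerXn2r ?nnegrE// ?mulr_ge0 ?(ltW pi0).
    move/le_trans; apply.
    have -> : (L%:R * `|x|) ^+ 2 * nrm2 S =
        (L%:R * pi) ^+ 2 / 4 * (4 / pi ^+ 2 * `|x| ^+ 2 * nrm2 S).
      by move: (@pi R) (lt0r_neq0 pi0) => p pn; field.
    rewrite -[leRHS](mulfVK (_ : 4 != 0))// ler_wpM2l// divr_ge0 ?sqr_ge0//.
  rewrite (_ : (L%:R * pi) ^+ 2 = (2 * pi) ^+ 2 * (L%:R / 2) ^+ 2); last by field.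
  by rewrite ler_pM2l// exprn_gt0// mulr_gt0.
have /le_trans := sqrRe_le S; move/(_ _ S2) => rS.
have [|r0] := leP (complex.Re S) 0; first by move/le_trans; apply; rewrite mulr_ge0 ?invr_ge0.
by rewrite -(@ler_pXn2r _ 2)// ?nnegrE ?mulr_ge0 ?invr_ge0 ?(ltW LR) ?(ltW r0).
Qed.

Lemma dft_angle_le j : (j < 2 * N)%N -> `|dft_angle j| <= pi.
Proof.
move=> jN; have NR : 0 < N%:R :> R by rewrite ltr0n.
rewrite /dft_angle !normrM normfV (ger0_norm (pi_ge0 R)) (gtr0_norm NR).
rewrite ler_pdivrMr// ler_wpM2l ?pi_ge0// ler_norml; apply/andP.
have := ler0n R j; have : j%:R <= 2 * N%:R :> R by rewrite -natrM ler_nat ltnW.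
by move=> ? ?; split; lra.
Qed.

(** A Chebyshev bound. The function 1 - [cexp_mean] is nonnegative, and at least 1/2 on the tail.
    Its total weighted sum is, by inversion, the total mass minus an average of
    [(1 - l/N) Re phi(lh)] over l < L, which is small when phi varies little near 0 and L/N is
    small. *)
Lemma dft_tail (L : nat) (eta : R) : (0 < L <= N)%N -> 0 <= eta ->
  (forall l : nat, (l < L)%N -> complex.Re (phi 0) - eta <= complex.Re (phi (l%:R * h))) ->
  \sum_(j < 2 * N | 2 * pi <= L%:R * `|dft_angle j|) dft_weight j <=
  2 * (eta + L%:R / N%:R * complex.Re (phi 0)).
Proof.
move=> /andP[L0 LN] eta0 near0; set M := complex.Re (phi 0).
have NR : 0 < N%:R :> R by rewrite ltr0n.
have LR : 0 < L%:R :> R by rewrite ltr0n.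
have M0 : 0 <= M by rewrite /M -sum_dft_weight sumr_ge0// => j _; exact: dft_weight_ge0.
have meanE : \sum_(j < 2 * N) dft_weight j * cexp_mean L (dft_angle j) =
    L%:R^-1 * \sum_(l < L) (1 - l%:R / N%:R) * complex.Re (phi (l%:R * h)).
  under eq_bigr do rewrite /cexp_mean mulrCA.
  rewrite -mulr_sumr; congr (_ * _).
  under eq_bigr => j _.
    rewrite (raddf_sum (@complex.Re R : Rcomplex R -> R))/= mulr_sumr.
    over.
  rewrite exchange_big/=; apply: eq_bigr => l _.
  have lN : (l <= N)%N by rewrite (leq_trans _ LN)// ltnW.
  have := congr1 (@complex.Re R) (dft_inversion lN).
  rewrite (raddf_sum (@complex.Re R : Rcomplex R -> R))/= => e.
  transitivity (\sum_(j < 2 * N) complex.Re ((dft_weight j)%:C%C * cexp (dft_angle j * l%:R))).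
    by apply: eq_bigr => j _; rewrite !ReImE/=; ring.
  rewrite e; have -> : 1 - l%:R / N%:R = (1 - l%:R / N%:R : R)%:C%C :> R[i].
    by rewrite rmorphB rmorphM fmorphV !rmorph_nat rmorph1.
  by rewrite !ReImE/=; ring.
have lo : M - eta - L%:R / N%:R * M <= \sum_(j < 2 * N) dft_weight j * cexp_mean L (dft_angle j).
  rewrite meanE ler_pdivlMl// -[leLHS]mulr1 mulrC mulrCA.
  rewrite (_ : _ * _ = \sum_(l < L) (M - eta - L%:R / N%:R * M)); last first.
    by rewrite sumr_const card_ord -mulr_natl; ring.
  apply: ler_sum => l _.
  have lL : l%:R / N%:R <= L%:R / N%:R :> R.
    by rewrite ler_wpM2r ?invr_ge0// ler_nat ltnW.
  have lN1 : l%:R / N%:R <= 1 :> R.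
    by rewrite ler_pdivrMr// mul1r ler_nat (leq_trans _ LN)// ltnW.
  have l0 : 0 <= l%:R / N%:R :> R by rewrite divr_ge0.
  have := near0 l (ltn_ord l); rewrite -/M => h1.
  apply: (@le_trans _ _ ((1 - l%:R / N%:R) * (M - eta))); last by rewrite ler_wpM2l ?subr_ge0.
  by nra.
have pt (j : 'I_(2 * N)) : (if 2 * pi <= L%:R * `|dft_angle j| then dft_weight j else 0) <=
    2 * (dft_weight j - dft_weight j * cexp_mean L (dft_angle j)).
  have w0 := dft_weight_ge0 j.
  case: ifPn => [big|_].
    by have := cexp_mean_le_half L0 big (dft_angle_le (ltn_ord j)); nra.
  by have := cexp_mean_le1 (dft_angle j) L0; nra.
rewrite big_mkcond/=; apply: (le_trans (ler_sum _ (fun j _ => pt j))).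
rewrite -mulr_sumr sumrB sum_dft_weight -/M.
by move: lo; lra.
Qed.

End FiniteFourier.

(** * Quantile functions of discrete measures *)

Section StepQuantile.
Context (R : realType).
Variables (w : nat -> R) (K : nat).
Hypothesis w0 : forall j, 0 <= w j.

Definition cumul k : R := \sum_(j < k) w j.

Lemma cumulS k : cumul k.+1 = cumul k + w k.
Proof. by rewrite /cumul big_ord_recr. Qed.

Lemma cumul_le i j : (i <= j)%N -> cumul i <= cumul j.
Proof.
elim: j => [|j ih]; first by rewrite leqn0 => /eqP->.
rewrite leq_eqVlt => /predU1P[->//|]; rewrite ltnS => /ih /le_trans; apply.
by rewrite cumulS lerDl.
Qed.

Lemma cumul0 : cumul 0 = 0. Proof. by rewrite /cumul big_ord0. Qed.

(** The quantile function of the weights: the index of the atom in which the cumulated mass passes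
    u, found by counting the partial sums not exceeding u. It is monotone in u by construction. *)
Definition cumul_idx (u : R) : nat := \sum_(k < K) (cumul k.+1 <= u)%R.

Lemma cumul_idxE k u : (k < K)%N -> cumul k <= u < cumul k.+1 -> cumul_idx u = k.
Proof.
move=> kK /andP[ku uk]; rewrite /cumul_idx.
rewrite (eq_bigr (fun j : 'I_K => (j < k)%N : nat)); last first.
  move=> j _; congr (nat_of_bool _); have [jk|kj] := ltnP j k.
    by rewrite (le_trans (cumul_le jk)).
  by apply/negbTE; rewrite -ltNge (lt_le_trans uk)// cumul_le.
rewrite -big_mkcond/= (big_ord_narrow (ltnW kK)).
by rewrite sum1_card card_ord.
Qed.

Lemma cumul_idx_ex u : 0 <= u < cumul K ->
  exists2 k, (k < K)%N & cumul k <= u < cumul k.+1.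
Proof.
elim: K => [|n ih]; first by rewrite cumul0 => /andP[/le_lt_trans/[apply]]; rewrite ltxx.
move=> /andP[u0 un]; have [nu|nu] := leP (cumul n) u.
  by exists n => //; rewrite nu.
by have [|k kn ku] := ih; [rewrite u0|exists k => //; rewrite ltnW].
Qed.

Lemma cumul_idx_le u v : u <= v -> (cumul_idx u <= cumul_idx v)%N.
Proof.
move=> uv; apply: leq_sum => k _; have [ku|//] := leP (cumul k.+1) u.
by rewrite (le_trans ku uv).
Qed.

End StepQuantile.

Lemma rint_sum d (T : measurableType d) (R : realType)
  (mu : {measure set T -> \bar R}) n (F : 'I_n -> T -> R) :
  (forall i, rintegrable mu (F i)) ->
  \int[mu]_x (\sum_(i < n) F i x) = \sum_(i < n) \int[mu]_x F i x.
Proof.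
suff : (forall i, rintegrable mu (F i)) ->
    rintegrable mu (fun x => \sum_(i < n) F i x) /\
    \int[mu]_x (\sum_(i < n) F i x) = \sum_(i < n) \int[mu]_x F i x.
  by move=> h /h[].
elim: n F => [|n ih] F Fi.
  under eq_fun do rewrite big_ord0; split; first exact: integrable0.
  by rewrite big_ord0 /Rintegral integral0.
have [i e] := ih (fun i => F (lift ord0 i)) (fun i => Fi _).
under eq_fun do rewrite big_ord_recl; split; first exact: rintegrableD.
by rewrite big_ord_recl -e -rintD//; apply: eq_Rintegral => x _; rewrite big_ord_recl.
Qed.

Section RestrictedLebesgue.
Context (R : realType) (M : R).
Local Notation MR := (measurableTypeR R).

Lemma lebesgue_itv_lty : ((@lebesgue_measure R) `[0%R, M[%classic < +oo)%E.
Proof.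
rewrite lebesgue_measure_itv/= lte_fin; case: ifP => _; last exact: ltry.
by rewrite -EFinB ltry.
Qed.

Definition lebesgue_itv : {finite_measure set MR -> \bar R} :=
  mfrestr (measurable_itv `[0%R, M[ : measurable (`[0%R, M[%classic : set MR)) lebesgue_itv_lty.

Lemma lebesgue_itvE A : lebesgue_itv A = lebesgue_measure (A `&` `[0, M[%classic).
Proof. by []. Qed.

Lemma ae_lebesgue_itv (Q : R -> Prop) : (forall u, 0 <= u < M -> Q u) ->
  {ae lebesgue_itv, forall u, Q u}.
Proof.
move=> h; exists (~` `[0, M[%classic); split.
- by apply: measurableC; exact: measurable_itv.
- by rewrite lebesgue_itvE setICl measure0.
- by move=> u /= nQ; rewrite in_itv/= => /h.
Qed.

(** The index j is attained exactly on a cell of length [w j]. Lebesgue measure on [0, M[ thus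
    realises every such discrete measure of mass M on one fixed space. *)
Lemma rint_step (w g : nat -> R) K : (forall j, 0 <= w j) -> cumul w K = M ->
  measurable_fun setT (fun u : MR => g (cumul_idx w K u)) ->
  \int[lebesgue_itv]_u g (cumul_idx w K u) = \sum_(j < K) w j * g j.
Proof.
move=> w0 WM mg.
pose I j : set MR := `[cumul w j, cumul w j.+1[%classic.
have mI j : measurable (I j) by exact: measurable_itv.
pose step u := \sum_(j < K) g j * (\1_(I j) u : R).
have iI j : rintegrable lebesgue_itv (fun u => \1_(I j) u).
  apply: rintegrable_bounded (finite_measure_lty _) _ _ _ (indic_le1 _ _).
  exact: measurable_indic.
have -> : \int[lebesgue_itv]_u g (cumul_idx w K u) = \int[lebesgue_itv]_u step u.
  apply: rint_ae => //.
    apply: measurable_sum => j; apply: measurable_funM => //.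
  apply: ae_lebesgue_itv => u; rewrite -WM => /cumul_idx_ex[k kK ku].
  rewrite (cumul_idxE w0 kK ku) /step (bigD1 (Ordinal kK))//= big1.
    by rewrite indicE mem_set ?mulr1 ?addr0// /I /= in_itv.
  move=> j jk; rewrite indicE memNset ?mulr0// /I /= in_itv/= => ju.
  move/eqP : jk; apply; apply/val_inj => /=.
  by rewrite -(cumul_idxE w0 (ltn_ord j) ju) (cumul_idxE w0 kK ku).
rewrite /step rint_sum; last by move=> j; exact: rintegrableZ.
apply: eq_bigr => j _; rewrite rintZ// mulrC; congr (_ * _).
transitivity (fine (lebesgue_measure (I j `&` `[0%R, M[%classic))).
  by rewrite /Rintegral integral_indic// setIT.
have -> : I j `&` `[0, M[%classic = I j.
  apply/setIidPl => u; rewrite /I /= !in_itv/= => /andP[ju uj].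
  rewrite (le_trans _ ju) ?sumr_ge0//= (lt_le_trans uj)// -WM.
  exact: cumul_le.
rewrite /I lebesgue_measure_itv/= lte_fin cumulS ltrDl.
case: ifPn => [_|]; first by rewrite -EFinB /= addrC addKr.
by rewrite -leNgt => wj; apply/esym/eqP; rewrite eq_le wj w0.
Qed.

End RestrictedLebesgue.

(** * Helly's selection theorem *)

Lemma ultra_fmap (T S : Type) (f : T -> S) (F : set_system T) :
  UltraFilter F -> UltraFilter (f @ F).
Proof.
move=> FU; split; first exact: fmap_proper_filter.
move=> G GF FG; rewrite eqEsubset; split => // A GA.
case: (in_ultra_setVsetC (f @^-1` A) FU) => // FnA.
have GnA : G (~` A) by exact: FG.
by have /filter_ex[x []] : G (A `&` ~` A) by exact: filterI.
Qed.

Section Helly.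
Context (R : realType).
Variable M : R.
Variable Q_ : nat -> R -> R.
Hypothesis Qnd : forall n u v, u <= v -> Q_ n u <= Q_ n v.
Hypothesis Qbnd : forall u : R, 0 < u < M ->
  exists C : R, \forall n \near \oo, `|Q_ n u| <= C.
Local Notation MR := (measurableTypeR R).

(** Monotonicity propagates convergence from the rationals to every point where the limit has no
    jump, and a monotone function has at most countably many jumps, so they form a null set. *)
Lemma helly : exists (nk : nat -> nat) (Q : MR -> R),
  [/\ forall k, (k <= nk k)%N, measurable_fun setT Q &
    {ae lebesgue_itv M, forall u, Q_ (nk k) u @[k --> \oo] --> Q u}].
Proof.
(* An ultrafilter finer than the tails gives a limit at all u simultaneously, so the limit function
   is defined and monotone before any subsequence is chosen. *)
have [U [UU oU]] := ultraFilterLemma (eventually_filter : ProperFilter \oo).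
have limP (u : R) : {l : R | 0 < u < M -> Q_ ^~ u @ U --> l}.
  apply: cid; have [uM|] := boolP (0 < u < M); last by exists 0.
  have [C bC] := Qbnd uM.
  have := @segment_compact R (- C) C; rewrite compact_ultra => /(_ (Q_ ^~ u @ U)).
  case.
  - exact: ultra_fmap.
  - apply: oU; apply: filterS bC => n; rewrite /= in_itv/= ler_norml//.
  - by move=> l [_ lim]; exists l.
pose Q u := sval (limP u).
have QP (u : R) : 0 < u < M -> Q_ ^~ u @ U --> Q u by exact: (svalP (limP u)).
have Qle (u v : R) : 0 < u < M -> 0 < v < M -> u <= v -> Q u <= Q v.
  move=> uM vM uv; apply: ler_cvg_to (QP _ uM) (QP _ vM) _.
  by apply: nearW => n; exact: Qnd.
have close (u e : R) : 0 < u < M -> 0 < e -> U [set n | `|Q_ n u - Q u| < e].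
  by move=> /QP /cvgrPdist_lt h /h; apply: filterS => n; rewrite distrC.
pose rq i : R := ratr (odflt 0 (unpickle i : option rat)).
(* Only finitely many conditions are imposed at stage k, the first k rationals with precision
   1/(k+1), so their intersection still belongs to the ultrafilter. *)
have nkP k : {n | (k <= n)%N /\ forall i, (i < k)%N -> 0 < rq i < M ->
    `|Q_ n (rq i) - Q (rq i)| < k.+1%:R^-1}.
  apply: cid.
  have : U [set n | (k <= n)%N /\ forall i, (i < k)%N -> 0 < rq i < M ->
      `|Q_ n (rq i) - Q (rq i)| < k.+1%:R^-1].
    have h m : U [set n | forall i, (i < m)%N -> 0 < rq i < M ->
        `|Q_ n (rq i) - Q (rq i)| < k.+1%:R^-1].
      elim: m => [|m ih]; first by apply: filterE => n i; rewrite ltn0.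
      have [mM|nM] := boolP (0 < rq m < M).
        have k0 : 0 < k.+1%:R^-1 :> R by rewrite invr_gt0.
        apply: filterS2 ih (close _ _ mM k0) => n h1 h2 i.
        by rewrite ltnS leq_eqVlt => /predU1P[->//|im]; exact: h1.
      apply: filterS ih => n h1 i; rewrite ltnS leq_eqVlt => /predU1P[->|im].
        by rewrite (negbTE nM).
      exact: h1.
    by apply: filterS2 (h k) (oU _ (nbhs_infty_ge k)) => n.
  by move=> /filter_ex[n nP]; exists n.
pose nk k := sval (nkP k).
have nk_ge k : (k <= nk k)%N by have [] := svalP (nkP k).
have rcvg (q : rat) : 0 < (ratr q : R) < M -> Q_ (nk k) (ratr q) @[k --> \oo] --> Q (ratr q).
  move=> qM; apply/cvgrPdist_lt => e e0; near=> k.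
  have [_ /(_ (pickle q))] := svalP (nkP k); rewrite /rq pickleK/= => h.
  rewrite distrC (lt_trans (h _ qM))//.
    by near: k; exact: nbhs_infty_gt.
  by near: k; apply: (cvgr_lt (0:R)) => //; exact: cvg_harmonic.
(* A jump at u is witnessed by two rationals strictly separating the values of Q on the two sides.
   By monotonicity the lower rationals of two different jumps are different, which gives an
   injection into the rationals. *)
pose bad : set R := [set u | 0 < u < M /\ exists r1 r2 : rat, [/\ (r1 < r2)%R,
   forall v, 0 < v < u -> Q v <= ratr r1 & forall v, u < v < M -> ratr r2 <= Q v]].
have cbad : countable bad.
  pose f u : rat := if pselect (bad u) is left b then sval (cid (proj2 b)) else 0.
  apply/countable_injP; exists (fun u => pickle (f u)) => u v.
  rewrite !inE => bu bv /(pcan_inj pickleK); rewrite /f.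
  case: pselect => // bu'; case: pselect => // bv'.
  case: cid => /= r1 [r2 [r12 h1 h2]]; case: cid => /= r1' [r2' [r12' h1' h2']] rr.
  have key (x y : R) (s1 s2 s1' s2' : rat) : 0 < x < M -> 0 < y < M -> x < y ->
      (s1 < s2)%R -> (forall v, x < v < M -> ratr s2 <= Q v) ->
      (forall v, 0 < v < y -> Q v <= ratr s1') -> s1 <> s1'.
    move=> /andP[x0 xM] /andP[y0 yM] xy s12 g1 g2 e.
    have := g1 ((x + y) / 2); have := g2 ((x + y) / 2).
    have a1 : 0 < (x + y) / 2 < y by apply/andP; split; lra.
    have a2 : x < (x + y) / 2 < M by apply/andP; split; lra.
    move=> /(_ a1) b1 /(_ a2) b2; have := le_trans b2 b1.
    by rewrite ler_rat leNgt -e s12.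
  have [uv|vu|//] := ltgtP u v.
    by case: (key _ _ _ _ _ r2' (proj1 bu') (proj1 bv') uv r12 h2 h1').
  by case: (key _ _ _ _ _ r2 (proj1 bv') (proj1 bu') vu r12' h2' h1).
have good (u : R) : 0 < u < M -> ~ bad u -> Q_ (nk k) u @[k --> \oo] --> Q u.
  move=> /[dup] uM /andP[u0 uM'] nb.
  have left_close (e : R) : 0 < e -> exists2 q : rat, 0 < (ratr q : R) < u & Q u - e < Q (ratr q).
    move=> e0; have : exists2 v, 0 < v < u & Q u - e < Q v.
      apply: contrapT => nex; apply: nb; split => //.
      have lt1 : Q u - e < Q u by rewrite ltrBlDr ltrDl.
      have [r2] := rat_in_itvoo lt1; rewrite in_itv/= => /andP[r2l r2u].
      have [r1] := @rat_in_itvoo R _ _ r2l; rewrite in_itv/= => /andP[r1l r1u].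
      exists r1, r2; split.
      - by rewrite ltr_rat in r1u.
      - move=> v vu; rewrite leNgt; apply/negP => Qv; apply: nex; exists v => //.
        exact: lt_trans Qv.
      - move=> v /andP[uv vM]; rewrite (le_trans (ltW r2u))// Qle ?(ltW uv)//.
        by rewrite vM (lt_trans u0).
    move=> [v /andP[v0 vu] Qv]; have [q] := @rat_in_itvoo R _ _ vu.
    rewrite in_itv/= => /andP[vq qu]; exists q; first by rewrite qu (lt_trans v0).
    rewrite (lt_le_trans Qv)// Qle ?(ltW vq) ?v0 ?(lt_trans v0 vq)/=//.
      by rewrite (lt_trans vu).
    by rewrite (lt_trans qu).
  have right_close (e : R) : 0 < e -> exists2 q : rat,
    u < (ratr q : R) < M & Q (ratr q) < Q u + e.
    move=> e0; have : exists2 v, u < v < M & Q v < Q u + e.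
      apply: contrapT => nex; apply: nb; split => //.
      have lt1 : Q u < Q u + e by rewrite ltrDl.
      have [r1] := rat_in_itvoo lt1; rewrite in_itv/= => /andP[r1l r1u].
      have [r2] := @rat_in_itvoo R _ _ r1u; rewrite in_itv/= => /andP[r2l r2u].
      exists r1, r2; split.
      - by rewrite ltr_rat in r2l.
      - move=> v /andP[v0 vu]; rewrite (le_trans _ (ltW r1l))// Qle ?(ltW vu)//.
        by rewrite v0 (lt_trans vu).
      - move=> v vu; rewrite leNgt; apply/negP => Qv; apply: nex; exists v => //.
        exact: lt_trans r2u.
    move=> [v /andP[uv vM] Qv]; have [q] := @rat_in_itvoo R _ _ uv.
    rewrite in_itv/= => /andP[uq qv]; exists q; first by rewrite uq (lt_trans qv).
    rewrite (le_lt_trans _ Qv)// Qle ?(ltW qv) ?vM ?(lt_trans u0 uq) ?(lt_trans qv)//=.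
    by rewrite (lt_trans u0 uv).
  apply/cvgrPdist_lt => e e0.
  have e20 : 0 < e / 2 by rewrite divr_gt0.
  have [p /andP[p0 pu] Qp] := left_close _ e20.
  have [q /andP[uq qM] Qq] := right_close _ e20.
  have pM : 0 < (ratr p : R) < M by rewrite p0 (lt_trans pu).
  have qM' : 0 < (ratr q : R) < M by rewrite qM (lt_trans u0).
  near=> k.
  have : `|Q (ratr p) - Q_ (nk k) (ratr p)| < e / 2.
    by near: k; move/cvgrPdist_lt : (rcvg p pM); apply.
  have : `|Q (ratr q) - Q_ (nk k) (ratr q)| < e / 2.
    by near: k; move/cvgrPdist_lt : (rcvg q qM'); apply.
  have := Qnd (nk k) (ltW pu); have := Qnd (nk k) (ltW uq).
  rewrite !ltr_norml => ? ? /andP[? ?] /andP[? ?]; apply/andP; split; lra.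
(* Restricting to the good set makes the convergence hold everywhere, which gives the measurability
   of the limit. *)
pose G : set MR := `]0, M[%classic `\` bad.
have mG : measurable G.
  by apply: measurableD; [exact: measurable_itv|exact: countable_measurable].
have Gcvg u : \1_G u * Q_ (nk k) u @[k --> \oo] --> \1_G u * Q u.
  rewrite indicE; have [uG|uG] := boolP (u \in G); last first.
    by under eq_fun do rewrite mul0r; rewrite mul0r; exact: cvg_cst.
  under eq_fun do rewrite mul1r; rewrite mul1r.
  by move: uG; rewrite inE /G/= in_itv/= => -[uM nb]; exact: good.
exists nk, (fun u => \1_G u * Q u); split => //.
  apply: (measurable_fun_cvg (h := fun k u => \1_G u * Q_ (nk k) u)) => [k|u _]; last exact: Gcvg.
  apply: measurable_funM => //.
  by apply: nondecreasing_measurable => // u v; exact: Qnd.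
exists (`[0, M[%classic `&` ([set 0] `|` bad) `|` ~` `[0, M[%classic); split.
- apply: measurableU; last by apply: measurableC; exact: measurable_itv.
  apply: measurableI; first exact: measurable_itv.
  by apply: measurableU; [exact: measurable_set1|exact: countable_measurable].
- rewrite lebesgue_itvE; apply: countable_lebesgue_measure0.
  apply: (@sub_countable _ _ _ ([set 0] `|` bad)); last first.
    rewrite -bigcup2E; apply: bigcup_countable; first exact: countableP.
    move=> [|[|i]] _; rewrite /bigcup2/=.
    + exact: countable1.
    + exact: cbad.
    + exact: countable0.
  by apply: subset_card_le => u /= [[[_ ub]|nu] iu] //; case: nu.
- move=> u /= ncv; have [uM|/negP uM] := boolP (0 <= u < M); last by right; rewrite in_itv.
  left; split; first by rewrite in_itv.
  apply: contrapT => /not_orP[u0 nb]; apply: ncv.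
  have uG : u \in G.
    rewrite inE /G/= in_itv/=; split => //; case/andP: uM => u0' ->; rewrite andbT.
    by rewrite lt_neqAle u0' andbT; apply/eqP => e; exact: u0.
  by have := Gcvg u; rewrite indicE uG mul1r; under eq_fun do rewrite mul1r.
Unshelve. all: end_near. Qed.

End Helly.

Lemma ae_imp d (T : measurableType d) (R : realType) (mu : {measure set T -> \bar R})
  (A B : T -> Prop) : (forall x, A x -> B x) -> {ae mu, forall x, A x} ->
  {ae mu, forall x, B x}.
Proof. by move=> AB; apply: filterS. Qed.

Lemma ae_imp2 d (T : measurableType d) (R : realType) (mu : {measure set T -> \bar R})
  (A B C : T -> Prop) : (forall x, A x -> B x -> C x) -> {ae mu, forall x, A x} ->
  {ae mu, forall x, B x} -> {ae mu, forall x, C x}.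
Proof. by move=> ABC; apply: filterS2. Qed.

Section ImageMeasure.
Context d1 d2 (T1 : measurableType d1) (T2 : measurableType d2) (R : realType).
Variables (m : {finite_measure set T1 -> \bar R}) (f : T1 -> T2).
Hypothesis mf : measurable_fun setT f.

(** The proof of measurability is an argument, so that the measure structure can be attached to the
    definition for every measurable map. *)
Definition image_measure of measurable_fun setT f : set T2 -> \bar R := pushforward m f.

Let image_measure0 : image_measure mf set0 = 0%E.
Proof. by rewrite /image_measure /pushforward preimage_set0 measure0. Qed.

Let image_measure_ge0 A : (0 <= image_measure mf A)%E.
Proof. exact: measure_ge0. Qed.

Let image_measure_sigma_additive : semi_sigma_additive (image_measure mf).
Proof.
move=> F mF tF mUF; rewrite /image_measure /pushforward preimage_bigcup.
apply: measure_semi_sigma_additive.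
- by move=> n; rewrite -[X in measurable X]setTI; exact: mf.
- apply/trivIsetP => /= i j _ _ ij; rewrite -preimage_setI.
  by move/trivIsetP : tF => /(_ _ _ _ _ ij) ->//; rewrite preimage_set0.
- by rewrite -preimage_bigcup -[X in measurable X]setTI; exact: mf.
Qed.

HB.instance Definition _ := isMeasure.Build _ _ _ (image_measure mf)
  image_measure0 image_measure_ge0 image_measure_sigma_additive.

Let image_measure_finite : fin_num_fun (image_measure mf).
Proof.
by apply: lty_fin_num_fun; exact: finite_measure_lty.
Qed.

HB.instance Definition _ := Measure_isFinite.Build _ _ _ (image_measure mf)
  image_measure_finite.

End ImageMeasure.

Lemma ler_sum_subset (R : numDomainType) (I : finType) (P Q : pred I) (F : I -> R) :
  (forall i, P i -> Q i) -> (forall i, 0 <= F i) ->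
  \sum_(i | P i) F i <= \sum_(i | Q i) F i.
Proof.
move=> PQ F0; rewrite [leLHS]big_mkcond [leRHS]big_mkcond; apply: ler_sum => i _.
by case: ifPn => [/PQ->|_]; [exact: lexx|case: ifP].
Qed.

Lemma ccvg_near (R : realType) (z w : nat -> R[i]) l :
  (\forall n \near \oo, z n = w n) -> ccvg w l -> ccvg z l.
Proof.
move=> zw [wr wi]; split.
  apply: cvg_trans wr; apply: near_eq_cvg.
  by apply: filterS zw => n ->.
apply: cvg_trans wi; apply: near_eq_cvg.
by apply: filterS zw => n ->.
Qed.

(** * Convergence of the discrete spectral measures *)

Section Bochner.
Context (R : realType).
Local Notation MR := (measurableTypeR R).
Variable phi : R -> R[i].
Hypothesis phiN : forall t, phi (- t) = (phi t)^*.
Hypothesis phi_pd : forall n (c : 'I_n -> R[i]) (t : 'I_n -> R),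
  0 <= complex.Re (\sum_(a < n) \sum_(b < n) c a * (c b)^* * phi (t a - t b)).
Hypothesis phi_re : continuous (fun t => complex.Re (phi t)).
Hypothesis phi_im : continuous (fun t => complex.Im (phi t)).

Local Notation M := (complex.Re (phi 0)).
(* With step [1/n!], every rational time is eventually a multiple of the step. *)
Let step (n : nat) : R := (n`!)%:R^-1.
(** With step 1/n!, these (n!)^2 points make the covered times range up to n! while the frequencies
    range up to pi n!, so that both windows exhaust the line. *)
Let size (n : nat) : nat := (n`! ^ 2)%N.
Let weight n := dft_weight phi (size n) (step n).
(** An angle divided by the step is a frequency; the atoms are thus placed on the real line instead
    of the circle. *)
Let quantile n (u : R) : R :=
  dft_angle R (size n) (cumul_idx (weight n) (2 * size n) u) * n`!%:R.

Let size0 n : (0 < size n)%N. Proof. by rewrite expn_gt0 fact_gt0. Qed.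

Let weight0 n j : 0 <= weight n j. Proof. exact: dft_weight_ge0. Qed.

Let cumul_weight n : cumul (weight n) (2 * size n) = M.
Proof. exact: sum_dft_weight. Qed.

Let factR n : 0 < n`!%:R :> R. Proof. by rewrite ltr0n fact_gt0. Qed.

Lemma dft_angle_nd N i j : (0 < N)%N -> (i <= j)%N -> dft_angle R N i <= dft_angle R N j.
Proof.
move=> N0 ij; rewrite /dft_angle ler_wpM2r ?invr_ge0// ler_wpM2l ?pi_ge0//.
by rewrite lerD2r ler_nat.
Qed.

Let quantile_nd n u v : u <= v -> quantile n u <= quantile n v.
Proof.
move=> uv; rewrite /quantile ler_wpM2r//.
by apply: dft_angle_nd => //; exact: cumul_idx_le.
Qed.

(** Tightness. A large quantile at u would put mass at least u or M - u beyond it on one side, more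
    than the tail estimate permits. *)
Let quantile_bounded (u : R) : 0 < u < M ->
  exists C : R, \forall n \near \oo, `|quantile n u| <= C.
Proof.
move=> /andP[u0 uM].
(* The tail estimate will be 4 eta, half of the smaller of u and M - u. *)
pose eta := Num.min u (M - u) / 8.
have eta0 : 0 < eta by rewrite divr_gt0// lt_min u0 subr_gt0.
have etau : 4 * eta < u.
  have : 8 * eta <= u by rewrite /eta mulrC divfK// ge_min lexx.
  lra.
have etaM : 4 * eta < M - u.
  have : 8 * eta <= M - u by rewrite /eta mulrC divfK// ge_min lexx orbT.
  lra.
have /cvgrPdist_lt/(_ _ eta0)/nbhs_ballP[delta /= delta0 hd] := @phi_re 0.
have close (x : R) : 0 <= x < delta -> M - eta <= complex.Re (phi x).
  move=> /andP[x0 xd]; have := hd x; rewrite /ball/= sub0r normrN ger0_norm// => /(_ xd).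
  rewrite ltr_norml => /andP[_]; lra.
pose k := (Num.truncn delta^-1).+1.
have kd : k%:R^-1 < delta.
  rewrite -[ltRHS]invrK ltf_pV2 ?posrE ?invr_gt0 ?ltr0n//.
  exact: real_truncnS_gt (num_real _).
have [n0 n0P] : exists n0 : nat, M <= n0%:R * eta.
  exists (Num.truncn (M / eta)).+1; rewrite -ler_pdivrMr//.
  by rewrite ltW// real_truncnS_gt// num_real.
exists (2 * pi * k%:R); near=> n.
have kn : (k <= n)%N by near: n; exact: nbhs_infty_ge.
have n0n : (n0 <= n`!)%N.
  apply: (@leq_trans n); last exact: (leq_trans (leqnn _) (fact_geq _)).
  by near: n; exact: nbhs_infty_ge.
have dk : (k %| n`!)%N by apply: dvdn_fact; rewrite kn.
set L := (n`! %/ k)%N.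
have Lk : (L * k)%N = n`! by rewrite divnK.
have L0 : (0 < L)%N by rewrite divn_gt0// dvdn_leq// fact_gt0.
have LN : (0 < L <= size n)%N.
  rewrite L0/= /size expnS expn1 -{1}Lk -mulnA.
  by rewrite leq_pmulr// muln_gt0 fact_gt0.
have tail := dft_tail phiN phi_pd (size0 n) LN (ltW eta0) (h := step n).
have {}tail : \sum_(j < 2 * size n | 2 * pi * k%:R <= `|dft_angle R (size n) j * n`!%:R|)
    weight n j <= 4 * eta.
  rewrite (eq_bigl (fun j : 'I_(2 * size n) => 2 * pi <= L%:R * `|dft_angle R (size n) j|));
    last first.
    move=> j; rewrite normrM (ger0_norm (ltW (factR n))) -Lk natrM mulrA.
    by rewrite ler_pM2r ?ltr0n// [L%:R * _]mulrC.
  apply: le_trans (tail _) _ => [l lL|].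
    apply: close; rewrite mulr_ge0 ?invr_ge0//=; apply: le_lt_trans kd.
    rewrite ler_pdivrMr// mulrC ler_pdivlMr ?ltr0n// -natrM ler_nat -Lk.
    by rewrite leq_mul2r (ltnW lL) orbT.
  have : L%:R / (size n)%:R * M <= eta.
    rewrite mulrAC ler_pdivrMr ?ltr0n// (le_trans (_ : _ <= n`!%:R * M))//.
      have M0 : 0 <= M by rewrite ltW// (lt_trans u0).
      rewrite ler_wpM2r// ler_nat -Lk leq_pmulr//.
    rewrite /size expnS expn1 natrM mulrC mulrA ler_wpM2r//.
    apply: le_trans n0P _; rewrite mulrC ler_wpM2l ?(ltW eta0)// ler_nat//.
  lra.
rewrite leNgt; apply/negP; rewrite /quantile.
have uM' : 0 <= u < cumul (weight n) (2 * size n) by rewrite cumul_weight (ltW u0).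
have [j0 j0N ju] := cumul_idx_ex uM'.
rewrite (cumul_idxE (weight0 n) j0N ju) => big.
have Cge0 : 0 <= 2 * pi * k%:R :> R by rewrite !mulr_ge0// pi_ge0.
set c := dft_angle R (size n) j0 * n`!%:R in big.
(* If the atom is on the positive side, all later atoms are in the tail and carry mass at least M -
   u; if it is on the negative side, it and all earlier ones are, and their mass exceeds u. *)
have [c0|c0] := leP 0 c.
  have : M - u <= 4 * eta; last by rewrite leNgt etaM.
  apply: le_trans tail; rewrite -(cumul_weight n) /cumul.
  rewrite (bigID (fun j : 'I_(2 * size n) => (j < j0)%N))/=.
  apply: (@le_trans _ _ (\sum_(i < 2 * size n | ~~ (i < j0)%N) weight n i)).
    case/andP: ju => ju _; rewrite addrC lerBlDr lerD2l (le_trans _ ju)// /cumul.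
    by rewrite (big_ord_narrow (ltnW j0N)).
  apply: ler_sum_subset => // j; rewrite -leqNgt => jj.
  rewrite (le_trans (ltW big))// !ger0_norm//; last first.
    by rewrite (le_trans c0)// ler_wpM2r// dft_angle_nd.
  by rewrite ler_wpM2r// dft_angle_nd.
have : u <= 4 * eta; last by rewrite leNgt etau.
apply: le_trans tail; case/andP: ju => _ /ltW /le_trans; apply.
rewrite /cumul (_ : \sum_(k < j0.+1) weight n k =
  \sum_(i < 2 * size n | (i < j0.+1)%N) weight n i); last by rewrite (big_ord_narrow j0N).
apply: ler_sum_subset => // j; rewrite ltnS => jj.
have cj : dft_angle R (size n) j * n`!%:R <= c by rewrite ler_wpM2r// dft_angle_nd.
rewrite (le_trans (ltW big))// !ler0_norm ?(le_trans cj)//; last exact: ltW.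
  by rewrite lerN2.
exact: ltW.
Unshelve. all: end_near. Qed.

Lemma cint_quantile n t : cintegral (lebesgue_itv M) setT (fun u => cexp (t * quantile n u)) =
  \sum_(j < 2 * size n) (weight n j)%:C%C * cexp (t * (dft_angle R (size n) j * n`!%:R)).
Proof.
have mq : measurable_fun setT (quantile n : MR -> MR).
  by apply: nondecreasing_measurable => // u v; exact: quantile_nd.
have st (g : R -> R) : measurable_fun setT (g : MR -> MR) ->
    \int[lebesgue_itv M]_u g (t * quantile n u) =
    \sum_(j < 2 * size n) weight n j * g (t * (dft_angle R (size n) j * n`!%:R)).
  move=> mg; rewrite -(rint_step (g := fun j =>
    g (t * (dft_angle R (size n) j * n`!%:R))) (weight0 n) (cumul_weight n))//.
  apply: (measurableT_comp (f := g)) => //.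
  by apply: measurable_funM => //; exact: mq.
apply: cplx_eq; rewrite /cintegral/=.
  rewrite (st cos); last exact: (continuous_measurable_fun (@continuous_cos R)).
  rewrite (raddf_sum (@complex.Re R : Rcomplex R -> R))/=; apply: eq_bigr => j _.
  by rewrite mul0r subr0.
rewrite (st sin); last exact: (continuous_measurable_fun (@continuous_sin R)).
rewrite (raddf_sum (@complex.Im R : Rcomplex R -> R))/=; apply: eq_bigr => j _.
by rewrite mul0r addr0.
Qed.

(** For these n the time t is an exact multiple l of the step, so inversion applies. The Fejer
    correction l/(n!)^2 equals t/n! and disappears in the limit. *)
Lemma cint_quantile_rat n (a b : nat) : (b.+1 <= n)%N -> (a <= n)%N ->
  let t := a%:R / b.+1%:R in
  cintegral (lebesgue_itv M) setT (fun u => cexp (t * quantile n u)) =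
  (1 - (t / n`!%:R)%:C%C) * phi t.
Proof.
move=> bn an t; have dn : (b.+1 %| n`!)%N by apply: dvdn_fact; rewrite bn.
set l := (a * (n`! %/ b.+1))%N.
have lE : t * n`!%:R = l%:R by rewrite /t /l natrM natf_div// mulrA mulrAC.
have ln : (l <= size n)%N.
  rewrite /size expnS expn1 leq_mul ?leq_div//.
  by rewrite (leq_trans an)// fact_geq.
rewrite cint_quantile; have := @dft_inversion R phi phiN (size n) (step n) (size0 n) l ln.
rewrite (eq_bigr (fun j : 'I_(2 * size n) => (weight n j)%:C%C *
    cexp (t * (dft_angle R (size n) j * n`!%:R)))); last first.
  by move=> j _; congr (_ * cexp _); rewrite -lE; ring.
move=> ->; rewrite /step -lE mulfK ?gt_eqF//; congr (_ * _).
congr (1 - _); rewrite -[RHS]/((t / n`!%:R)%:C)%C.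
rewrite -(rmorph_nat (real_complex R)) -(rmorph_nat (real_complex R) (size n)) -fmorphV -rmorphM.
congr (_%:C)%C; rewrite -lE /size natrX; field.
by rewrite pnatr_eq0 -lt0n fact_gt0.
Qed.

Lemma cexp_cvg (u : R^nat) (l : R) : u n @[n --> \oo] --> l ->
  ccvg (fun n => cexp (u n)) (cexp l).
Proof.
move=> ul; split => /=.
  exact: (cvg_comp _ _ ul (@continuous_cos R l)).
exact: (cvg_comp _ _ ul (@continuous_sin R l)).
Qed.

(** Quantile functions replace weak compactness of measures by convergence almost everywhere on [0,
    M[: the measure is the image of Lebesgue measure under their limit. Nonnegative rational times
    come first, continuity of both sides gives the other nonnegative times, and conjugation the
    negative ones. *)
Theorem bochner : exists s : {finite_measure set MR -> \bar R},
  forall t, phi t = fourier s setT t.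
Proof.
have [nk [Q [nkP mQ Qcvg]]] := helly quantile_nd quantile_bounded.
pose s : {finite_measure set MR -> \bar R} := @image_measure _ _ MR MR R (lebesgue_itv M) Q mQ.
have mexp t : cmeasurable (fun x : MR => cexp (t * x)).
  by apply: cmeasurable_cexp; exact: measurable_funM.
have iexp t (m : {finite_measure set MR -> \bar R}) : cintegrable m (fun x : MR => cexp (t * x)).
  by apply: (cintegrable_bounded (finite_measure_lty _) (C := 1)) => // x; rewrite nrm2_cexp.
have fE t : fourier s setT t = cintegral (lebesgue_itv M) setT (fun u => cexp (t * Q u)).
  exact: (esym (@cint_mp _ _ MR MR R (lebesgue_itv M) s Q mQ (fun A _ => erefl) (fun x =>
    cexp (t * x)) (iexp t s))).
have fcvg (t_ : nat -> R) t : t_ n @[n --> \oo] --> t ->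
    ccvg (fun n => fourier s setT (t_ n)) (fourier s setT t).
  move=> tt; apply: (cint_cvg (g := fun=> 1)) => //.
  - by move=> n; exact: mexp.
  - exact: mexp.
  - by apply: rintegrable_cst; exact: finite_measure_lty.
  - by move=> n x; exact: norm_cos_le1.
  - by move=> n x; exact: norm_sin_le1.
  - apply: nearW => x; apply: (@cexp_cvg (fun n => t_ n * x) (t * x)).
      exact: cvgMr_tmp.
have pcvg (t_ : nat -> R) t : t_ n @[n --> \oo] --> t -> ccvg (fun n => phi (t_ n)) (phi t).
  move=> tt; split.
    exact: (continuous_cvg _ (@phi_re t)).
  exact: (continuous_cvg _ (@phi_im t)).
have rat_case (a b : nat) : phi (a%:R / b.+1%:R) = fourier s setT (a%:R / b.+1%:R).
  set t := a%:R / b.+1%:R.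
  apply: (@ccvg_unique _ (fun k => cintegral (lebesgue_itv M) setT
    (fun u => cexp (t * quantile (nk k) u)))); last first.
    rewrite fE; apply: (cint_cvg (g := fun=> 1)).
    - move=> n; apply: cmeasurable_cexp; apply: measurable_funM => //.
      by apply: nondecreasing_measurable => // u v; exact: quantile_nd.
    - by apply: cmeasurable_cexp; apply: measurable_funM.
    - by apply: rintegrable_cst; exact: finite_measure_lty.
    - by move=> n x; exact: norm_cos_le1.
    - by move=> n x; exact: norm_sin_le1.
    - apply: ae_imp Qcvg => u Qu; apply: (@cexp_cvg (fun n => t * quantile (nk n) u) (t * Q u)).
      exact: cvgMl_tmp.
  apply: (@ccvg_near _ _ (fun k => (1 - (t / (nk k)`!%:R)%:C%C) * phi t)).
    near=> k; apply: cint_quantile_rat; apply: leq_trans (nkP k).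
      by near: k; exact: nbhs_infty_ge.
    by near: k; exact: nbhs_infty_ge.
  rewrite -[X in ccvg _ X]mul1r; apply: ccvgM; last exact: ccvg_cst.
  split => /=; last by rewrite subr0; exact: cvg_cst.
  rewrite -[X in _ --> X]subr0; apply: cvgB; first exact: cvg_cst.
  rewrite -[X in _ --> X](mulr0 t); apply: cvgMl_tmp.
  apply/cvgrPdist_lt => e e0; near=> k.
  rewrite sub0r normrN ger0_norm ?invr_ge0//.
  rewrite -[ltRHS]invrK ltf_pV2 ?posrE ?invr_gt0 ?ltr0n ?fact_gt0//.
  apply: (@lt_le_trans _ _ k%:R); first by near: k; exact: nbhs_infty_gtr.
  by rewrite ler_nat (leq_trans (nkP k))// fact_geq.
have pos_case t : 0 <= t -> phi t = fourier s setT t.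
  move=> t0; pose t_ n : R := (Num.truncn (t * n.+1%:R))%:R / n.+1%:R.
  have tt : t_ n @[n --> \oo] --> t.
    apply/cvgrPdist_lt => e e0; near=> n.
    have n0 : 0 < n.+1%:R :> R by [].
    have /andP[l1 l2] : (Num.truncn (t * n.+1%:R))%:R <= t * n.+1%:R < (Num.truncn (t *
      n.+1%:R)).+1%:R.
      by apply: truncn_itv; rewrite mulr_ge0.
    have h : n.+1%:R^-1 < e by near: n; apply: (cvgr_lt (0:R)) => //; exact: cvg_harmonic.
    rewrite ger0_norm; last by rewrite subr_ge0 /t_ ler_pdivrMr.
    apply: le_lt_trans h; rewrite /t_ lerBlDl -[X in _ + X]mul1r -mulrDl ler_pdivlMr//.
    by rewrite (le_trans (ltW l2))// natr1.
  apply: (ccvg_unique (pcvg _ _ tt)).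
  under eq_fun do rewrite rat_case; exact: fcvg.
exists s => t; have [/pos_case//|t0] := leP 0 t.
rewrite -[t]opprK phiN pos_case ?oppr_ge0 1?ltW//.
rewrite /fourier -(cintJ (iexp _ _)); congr cintegral; apply/funext => x.
by rewrite -cexpN -mulNr.
Unshelve. all: end_near. Qed.

End Bochner.

(** * Continuity of a measurable flow *)

Lemma boundedly_closed_weighted d1 d2 (S : measurableType d1) (T : measurableType d2)
  (R : realType) (B : set (S -> R)) (p : S -> T) (w : S -> R) C : boundedly_closed B ->
  (forall z, `|w z| <= C) -> boundedly_closed [set f : T -> R | B (fun z => f (p z) * w z)].
Proof.
move=> [Blin Blim] wC; split=> [c f g /= Bf Bg|f_ f K /= Bf fK ff].
  rewrite (_ : (fun z => _) = (fun z => c * (f (p z) * w z) + g (p z) * w z)); first exact: Blin.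
  by apply/funext => z; rewrite mulrDl mulrA.
apply: (Blim (fun n z => f_ n (p z) * w z) _ (K * C)) => // [n z|z].
  by rewrite normrM ler_pM.
exact: cvgMr_tmp.
Qed.

Section Translation.
Context (R : realType).
Local Notation MR := (measurableTypeR R).

Lemma measurable_translation (h : R) : measurable_fun setT (fun t : MR => t + h : MR).
Proof. exact: measurable_funD. Qed.

Lemma lebesgue_translation (h : R) (A : set MR) : measurable A ->
  lebesgue_measure ((fun t : MR => t + h : MR) @^-1` A) = lebesgue_measure A.
Proof.
move=> mA; pose mh := isMeasurableFun.Build _ _ _ _ _ (measurable_translation h).
pose f : {mfun MR >-> MR} := HB.pack (fun t : MR => t + h : MR) mh.
apply/esym; apply: (@lebesgue_measure_unique R (pushforward (@lebesgue_measure R) f)) => //.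
move=> _ [[a b] _ <-]; rewrite /pushforward /=.
rewrite /pushforward (_ : _ @^-1` `]a, b]%classic = `]a - h, b - h]%classic); last first.
  by apply/seteqP; split=> t; rewrite /= !in_itv/= ltrBlDr lerBrDr.
by rewrite !lebesgue_measure_itv/= !lte_fin ltrD2r -!EFinB opprB addrA subrK.
Qed.

Lemma norm_cosD_le (a b : R) : `|cos (a + b) - cos a| <= `|b|.
Proof.
have := sqrRe_le (cexp a * (cexp b - 1)); rewrite nrm2M nrm2_cexp mul1r => h.
have {}h := le_trans h (nrm2_cexpB1 b).
rewrite -(@ler_pXn2r _ 2%N) ?nnegrE// !real_normK ?num_real//.
by move: h; rewrite mulrBr -cexpD mulr1 cReB.
Qed.

Lemma norm_sinD_le (a b : R) : `|sin (a + b) - sin a| <= `|b|.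
Proof.
have := sqrIm_le (cexp a * (cexp b - 1)); rewrite nrm2M nrm2_cexp mul1r => h.
have {}h := le_trans h (nrm2_cexpB1 b).
rewrite -(@ler_pXn2r _ 2%N) ?nnegrE// !real_normK ?num_real//.
by move: h; rewrite mulrBr -cexpD mulr1 cImB.
Qed.

End Translation.

Lemma rintegrable_strip d (X : measurableType d) (R : realType)
  (m : {finite_measure set X -> \bar R}) (D : set (measurableTypeR R))
  (g : measurableTypeR R * X -> R) K : measurable D -> (lebesgue_measure D < +oo)%E ->
  measurable_fun setT g -> (forall z, `|g z| <= K) ->
  rintegrable (@lebesgue_measure R \x m)%E (fun z => \1_D z.1 * g z).
Proof.
move=> mD Dfin mg gK; pose A : set (measurableTypeR R * X) := D `*` setT.
have mA : measurable A by exact: measurableX.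
apply: (@le_rintegrable _ _ _ _ _ (fun z => K * \1_A z)).
- by apply: measurable_funM => //; apply: measurableT_comp => //.
- move=> z; rewrite normrM mulrC.
  have -> : \1_A z = `|\1_D z.1 : R|.
    by rewrite !indicE in_setX [_.2 \in setT]mem_set// andbT ger0_norm.
  by rewrite ler_wpM2r.
- apply: rintegrableZ; apply/integrableP; split; first exact/measurable_EFinP.
  rewrite (eq_integral (fun z => (\1_A z)%:E)); last first.
    by move=> z _; rewrite /= ger0_norm.
  rewrite integral_indic// setIT [ltLHS](_ : _ = (lebesgue_measure D * m setT)%E);
    last exact: product_measure1E.
  have /fineK <- : m setT \is a fin_num by rewrite ge0_fin_numE// finite_measure_lty.
  have /fineK <- : lebesgue_measure D \is a fin_num by rewrite ge0_fin_numE.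
  by rewrite -EFinM ltry.
Qed.

Section ShiftContinuity.
Context d (X : measurableType d) (R : realType) (P : probability X R).
Local Notation MR := (measurableTypeR R).
Local Notation L := (@lebesgue_measure R \x P)%E.

Definition shift1 (h : R) (z : MR * X) : MR * X := (z.1 + h, z.2).

Lemma measurable_shift1 h : measurable_fun setT (shift1 h).
Proof.
apply: measurable_fun_pair => //=.
exact: (measurableT_comp (measurable_translation h)).
Qed.

Lemma shift1_pres h A : measurable A -> L (shift1 h @^-1` A) = L A.
Proof.
move=> mA; pose mh := isMeasurableFun.Build _ _ _ _ _ (measurable_shift1 h).
pose f : {mfun (MR * X)%type >-> (MR * X)%type} := HB.pack (shift1 h) mh.
apply/esym; apply: (@product_measure_unique _ _ _ _ _ _ _ (pushforward L f)) => //.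
move=> B C mB mC; rewrite /pushforward /=.
rewrite /pushforward (_ : _ @^-1` (B `*` C) = ((fun t : MR => t + h : MR) @^-1` B) `*` C)//.
rewrite product_measure1E//; first by congr (_ * _)%E; exact: lebesgue_translation.
by rewrite -[X in measurable X]setTI; exact: measurable_translation.
Qed.

Let rintegrable_window (a b : R) (g : MR * X -> R) K : measurable_fun setT g ->
  (forall z, `|g z| <= K) -> rintegrable L (fun z => \1_(`[a, b[%classic : set MR) z.1 * g z).
Proof.
apply: rintegrable_strip; first exact: measurable_itv.
by rewrite lebesgue_measure_itv/= lte_fin; case: ifP => _; rewrite -?EFinB ltry.
Qed.

Variables (h_ : nat -> R) (C : R).
Hypothesis hC : forall n, `|h_ n| <= C.
Hypothesis h0 : h_ n @[n --> \oo] --> (0:R).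

Local Notation I := (`[0, 1[%classic : set MR).
Local Notation W := (`[- C, C + 1[%classic : set MR).

(** The window [0, 1[ in time makes the modulus of continuity finite, since the product of Lebesgue
    measure with P has infinite mass. *)
Definition shift_diff (g : MR * X -> R) n : R :=
  \int[L]_z (\1_I z.1 * `|g (shift1 (h_ n) z) - g z|).

Let C0 : 0 <= C. Proof. exact: le_trans (normr_ge0 _) (hC 0). Qed.

Let indI (z : MR * X) n : (\1_I z.1 : R) <= \1_W (shift1 (h_ n) z).1.
Proof.
rewrite !indicE ler_nat; case: (boolP (z.1 \in I)) => //.
rewrite inE/= in_itv/= => /andP[z0 z1]; rewrite mem_set//= in_itv/=.
by have := hC n; rewrite ler_norml => /andP[l1 l2]; apply/andP; split; lra.
Qed.

Let indIW (z : MR * X) : (\1_I z.1 : R) <= \1_W z.1.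
Proof.
rewrite !indicE ler_nat; case: (boolP (z.1 \in I)) => //.
rewrite inE/= in_itv/= => /andP[z0 z1]; rewrite mem_set//= in_itv/=.
by apply/andP; split; have := C0; lra.
Qed.

Let mshift (g : MR * X -> R) n : measurable_fun setT g ->
  measurable_fun setT (fun z => g (shift1 (h_ n) z)).
Proof. by move=> mg; apply: measurableT_comp => //; exact: measurable_shift1. Qed.

Let bnorm (g : MR * X -> R) n K : (forall z, `|g z| <= K) ->
  forall z, `| `|g (shift1 (h_ n) z) - g z| | <= K + K.
Proof. by move=> gK z; rewrite normr_id (le_trans (ler_normB _ _))// lerD. Qed.

Let ishift (g : MR * X -> R) n K : measurable_fun setT g ->
  (forall z, `|g z| <= K) ->
  rintegrable L (fun z => \1_I z.1 * `|g (shift1 (h_ n) z) - g z|).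
Proof.
move=> mg gK; apply: rintegrable_window (bnorm n gK).
apply: measurableT_comp => //; apply: measurable_funB => //; exact: mshift.
Qed.

Let ind_ge0 (A : set MR) (z : MR) : 0 <= (\1_A z : R).
Proof. by rewrite indicE. Qed.

Lemma shift_diff_ge0 g n : 0 <= shift_diff g n.
Proof. by apply: Rintegral_ge0 => z _; rewrite mulr_ge0. Qed.

Definition shift_continuous : set (MR * X -> R) := [set g : MR * X -> R |
  [/\ measurable_fun setT g, exists K, forall z, `|g z| <= K &
      shift_diff g n @[n --> \oo] --> (0:R)]].

(** The modulus of f exceeds that of an approximant by at most two L_1 errors, one translated and
    one not, which are small uniformly in the shift. *)
Lemma shift_diff_bclosed : boundedly_closed shift_continuous.
Proof.
split=> [c f g /= [mf [Kf fK] df] [mg [Kg gK] dg]|f_ f K /= Bf fK ff].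
  split.
  - by apply: measurable_funD => //; exact: measurable_funM.
  - exists (`|c| * Kf + Kg) => z; rewrite (le_trans (ler_normD _ _))// lerD// normrM.
    by rewrite ler_wpM2l.
  apply: (@squeeze_cvgr _ _ _ _ (fun=> 0) (fun n => `|c| * shift_diff f n + shift_diff g n)).
  - apply: nearW => n; rewrite shift_diff_ge0/= /shift_diff -rintZ; last exact: ishift fK.
    rewrite -rintD; [|exact: rintegrableZ (ishift n mf fK)|exact: ishift gK].
    apply: le_rint.
    + apply: (@ishift _ n (`|c| * Kf + Kg)).
        by apply: measurable_funD => //; exact: measurable_funM.
      move=> z; rewrite (le_trans (ler_normD _ _))// lerD// normrM.
      by rewrite ler_wpM2l.
    + by apply: rintegrableD; [exact: rintegrableZ (ishift n mf fK)|exact: ishift gK].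
    + move=> z; rewrite mulrCA -mulrDr ler_wpM2l//.
      rewrite -normrM (le_trans _ (ler_normD _ _))//.
      by rewrite le_eqVlt; apply/orP; left; apply/eqP; congr `|_|; ring.
  - exact: cvg_cst.
  - rewrite -[X in _ --> X](addr0 0) -[X in _ --> X + _](mulr0 `|c|).
    by apply: cvgD => //; exact: cvgMl_tmp.
have mf_ n : measurable_fun setT (f_ n) by case: (Bf n).
have mf : measurable_fun setT f by apply: (measurable_fun_cvg (h := f_)) => //.
have fK' z : `|f z| <= K.
  by apply: (ler_cvg_to (cvg_norm (ff z)) (cvg_cst K)); apply: nearW.
have K0 : 0 <= K.
  by apply: le_trans (fK 0 (0, point)).
split => //; first by exists K.
(* The window W contains every translate of [0, 1[ by the [h_ n]. By translation invariance this
   single quantity bounds both errors for all n. *)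
pose r k : R := \int[L]_z (\1_W z.1 * `|f z - f_ k z|).
have dK k z : `| `|f z - f_ k z| | <= K + K.
  by rewrite normr_id (le_trans (ler_normB _ _))// lerD.
have mdiff k : measurable_fun setT (fun z => `|f z - f_ k z|).
  by apply: measurableT_comp => //; exact: measurable_funB.
have r0 : r k @[k --> \oo] --> (0:R).
  have -> : 0 = \int[L]_z (fun=> 0 : R) z by rewrite /Rintegral integral0.
  apply: (rint_cvg (g := fun z => \1_W z.1 * (K + K))).
  - move=> k; by apply: measurable_funM => //; apply: measurableT_comp => //.
  - exact: measurable_cst.
  - apply: (@rintegrable_window _ _ _ (K + K)) => // z.
    by rewrite ger0_norm// addr_ge0.
  - move=> k z; rewrite normrM ger0_norm// ler_wpM2l//.
  - apply: aeW => z; rewrite -[X in _ --> X](mulr0 (\1_W z.1)); apply: cvgMl_tmp.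
    rewrite -(normr0 R); apply: cvg_norm.
    by rewrite -[X in _ --> X](subrr (f z)); apply: cvgB; [exact: cvg_cst|exact: ff].
have key k n : shift_diff f n <= shift_diff (f_ k) n + (r k + r k).
  have irk : rintegrable L (fun z => \1_W z.1 * `|f z - f_ k z|).
    exact: rintegrable_window (mdiff k) (dK k).
  have irk' : rintegrable L (fun z => \1_W (shift1 (h_ n) z).1 *
      `|f (shift1 (h_ n) z) - f_ k (shift1 (h_ n) z)|).
    exact: (rintegrable_mp (measurable_shift1 (h_ n)) (@shift1_pres (h_ n)) irk).
  rewrite {1}/r -(rint_mp (measurable_shift1 (h_ n)) (@shift1_pres (h_ n)) irk).
  rewrite -!rintD//; [|exact: ishift (fK k)|exact: rintegrableD].
  apply: le_rint; first exact: ishift fK'.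
    by apply: rintegrableD; [exact: ishift (fK k)|exact: rintegrableD].
  move=> z; set z' := shift1 _ z.
  apply: (@le_trans _ _ (\1_I z.1 * `|f_ k z' - f_ k z| +
     (\1_I z.1 * `|f z' - f_ k z'| + \1_I z.1 * `|f z - f_ k z|))).
    rewrite -!mulrDr ler_wpM2l//.
    have -> : f z' - f z = (f_ k z' - f_ k z) + ((f z' - f_ k z') - (f z - f_ k z)) by ring.
    by rewrite (le_trans (ler_normD _ _))// lerD2l ler_normB.
  by rewrite lerD2l lerD// ler_wpM2r// ?indI.
apply/cvgrPdist_le => e e0.
have e4 : 0 < e / 4 by rewrite divr_gt0.
have [k rk] : exists k, r k <= e / 4.
  have /cvgrPdist_le/(_ _ e4)[k _ /(_ k (leqnn _))] := r0.
  by rewrite /= sub0r normrN => /(le_trans (ler_norm _)) rk; exists k.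
have [_ _ dk] := Bf k; near=> n.
have : shift_diff (f_ k) n <= e / 4.
  near: n; move/cvgrPdist_le : dk => /(_ _ e4); apply: filterS => n /=.
  by rewrite sub0r normrN; apply: le_trans; exact: ler_norm.
rewrite sub0r normrN ger0_norm ?shift_diff_ge0//.
have := key k n; lra.
Unshelve. all: end_near. Qed.

(** Cosines and sines are Lipschitz, so the claim is explicit for a trigonometric function of time
    multiplied by a function of the space variable. The class then grows to rectangles and to all
    measurable sets. *)
Lemma shift_diff_indic E : measurable E -> shift_diff (\1_E) n @[n --> \oo] --> (0:R).
Proof.
pose B := shift_continuous.
have Bcl := shift_diff_bclosed.
have trig (A : set X) (c : MR -> R) q : measurable A -> measurable_fun setT c ->
    (forall t, `|c t| <= 1) -> (forall t h, `|c (t + h) - c t| <= `|q * h|) ->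
    B (fun z => c z.1 * \1_A z.2).
  move=> mA mc c1 cL.
  have mg : measurable_fun setT (fun z : MR * X => c z.1 * \1_A z.2 : R).
    by apply: measurable_funM; apply: measurableT_comp => //.
  have g1 (z : MR * X) : `|c z.1 * \1_A z.2| <= 1.
    by rewrite normrM -(mul1r 1) ler_pM// indic_le1.
  split => //; first by exists 1.
  pose K : R := \int[L]_z (\1_I z.1 * 1).
  apply: (@squeeze_cvgr _ _ _ _ (fun=> 0) (fun n => `|q| * `|h_ n| * K)).
  - apply: nearW => n; rewrite shift_diff_ge0/= /K -rintZ; last first.
      by apply: (@rintegrable_window _ _ _ 1) => // z; rewrite normr1.
    apply: le_rint; first exact: ishift g1.
      apply: rintegrableZ.
      by apply: (@rintegrable_window _ _ _ 1) => // z; rewrite normr1.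
    move=> z; rewrite mulr1 mulrC ler_wpM2r// /shift1/= -mulrBl normrM.
    rewrite -[leRHS]mulr1 ler_pM// ?indic_le1//.
    by rewrite (le_trans (cL _ _))// normrM.
  - exact: cvg_cst.
  - have e : 0 = `|q| * 0 * K by rewrite mulr0 mul0r.
    rewrite [X in _ --> X]e.
    apply: cvgMr_tmp; apply: cvgMl_tmp; rewrite -(normr0 R); exact: cvg_norm.
have rect (A : set X) (D : set MR) : measurable A -> measurable D ->
    B (fun z => \1_D z.1 * \1_A z.2).
  move=> mA mD.
  have slice := boundedly_closed_weighted fst (w := fun z : MR * X => \1_A z.2 : R)
    Bcl (fun z => indic_le1 R A z.2).
  apply: (@boundedly_closed_borel R _ slice) => // q /=.
  - apply: (trig A (fun t => cos (ratr q * t)) (ratr q)) => //.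
    + apply: measurableT_comp; last exact: measurable_funM.
      exact: (continuous_measurable_fun (@continuous_cos R)).
    + by move=> t; exact: norm_cos_le1.
    + by move=> t h; rewrite mulrDr norm_cosD_le.
  - apply: (trig A (fun t => sin (ratr q * t)) (ratr q)) => //.
    + apply: measurableT_comp; last exact: measurable_funM.
      exact: (continuous_measurable_fun (@continuous_sin R)).
    + by move=> t; exact: norm_sin_le1.
    + by move=> t h; rewrite mulrDr norm_sinD_le.
move=> mE; suff [] : B (\1_E) by [].
apply: (boundedly_closed_indic Bcl
  (G := [set A `*` D | A in @measurable _ MR & D in @measurable _ X]) _ _ _ _ mE).
- exact: measurable_prod_measurableType.
- move=> _ _ [D mD [A mA <-]] [D' mD' [A' mA' <-]]; rewrite -setXI.
  by exists (D `&` D'); [exact: measurableI|exists (A `&` A') => //; exact: measurableI].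
- have := rect _ _ (@measurableT _ X) (@measurableT _ MR).
  rewrite (_ : (fun z => _) = cst 1)//.
  by apply/funext => z; rewrite !indicT mulr1.
- move=> _ [D mD [A mA <-]]; have := rect _ _ mA mD.
  rewrite (_ : (fun z => _) = \1_(D `*` A))//.
  by apply/funext => z; rewrite !indicE in_setX -natrM mulnb.
Qed.

End ShiftContinuity.

Lemma ccvg_sum (R : realType) n (z : 'I_n -> nat -> R[i]) (l : 'I_n -> R[i]) :
  (forall i, ccvg (z i) (l i)) -> ccvg (fun k => \sum_(i < n) z i k) (\sum_(i < n) l i).
Proof.
elim: n z l => [|n ih] z l zl.
  by under eq_fun do rewrite big_ord0; rewrite big_ord0; exact: ccvg_cst.
under eq_fun do rewrite big_ord_recl; rewrite big_ord_recl.
by apply: ccvgD => //; exact: ih.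
Qed.

Section LipschitzLimit.
Context d (Y : measurableType d) (R : realType) (mu : {measure set Y -> \bar R}).
Variables (l_ : nat -> (Y -> R[i]) -> R[i]) (l : (Y -> R[i]) -> R[i]) (K : R).
Hypothesis K0 : 0 <= K.
Hypothesis l_lip : forall n f g, L2 mu f -> L2 mu g ->
  nrm2 (l_ n f - l_ n g) <= K * sqnorm mu (fun x => f x - g x).
Hypothesis l_lip0 : forall f g, L2 mu f -> L2 mu g ->
  nrm2 (l f - l g) <= K * sqnorm mu (fun x => f x - g x).

(** A Lipschitz bound uniform in n lets pointwise convergence of functionals pass from an
    approximating sequence to its limit. *)
Lemma ccvg_sqnorm_closed f (g : nat -> Y -> R[i]) : L2 mu f -> (forall k, L2 mu (g k)) ->
  (forall k, ccvg (l_ ^~ (g k)) (l (g k))) ->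
  (forall k, sqnorm mu (fun x => f x - g k x) <= 8^-1 ^+ k.+1) ->
  ccvg (l_ ^~ f) (l f).
Proof.
move=> f2 g2 gl fg; apply: ccvg_nrm2P; apply/cvgrPdist_le => e e0.
have [k rk] : exists k, K * sqnorm mu (fun x => f x - g k x) <= e / 12.
  have e' : 0 < e / 12 / (K + 1) by rewrite !divr_gt0// ltr_wpDl.
  have /cvgrPdist_le/(_ _ e')[k _ /(_ k (leqnn _))] := @expr8_cvg R.
  rewrite /= sub0r normrN => /(le_trans (ler_norm _)) rk; exists k.
  have := le_trans (fg k) rk; rewrite ler_pdivlMr ?ltr_wpDl// mulrC.
  by apply: le_trans; rewrite mulrDl mul1r lerDl sqnorm_ge0.
have [gr gi] := gl k.
have e64 : 0 < e / 12 by rewrite divr_gt0.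
pose eta := Num.min 1 (e / 24); have eta0 : 0 < eta by rewrite lt_min ltr01 divr_gt0.
near=> n.
have rr : `|complex.Re (l (g k)) - complex.Re (l_ n (g k))| <= eta.
  by near: n; move/cvgrPdist_le : gr; apply.
have ii : `|complex.Im (l (g k)) - complex.Im (l_ n (g k))| <= eta.
  by near: n; move/cvgrPdist_le : gi; apply.
have sq (x : R) : `|x| <= eta -> x ^+ 2 <= e / 24.
  move=> xe; rewrite -real_normK ?num_real// expr2.
  have x1 : `|x| <= 1 by rewrite (le_trans xe)// ge_min lexx.
  have xe' : `|x| <= e / 24 by rewrite (le_trans xe)// ge_min lexx orbT.
  by rewrite (le_trans (ler_wpM2l _ x1))// mulr1.
have mid : nrm2 (l_ n (g k) - l (g k)) <= e / 12.
  rewrite -nrm2N opprB /nrm2 cReB cImB; have := sq _ rr; have := sq _ ii; lra.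
rewrite sub0r normrN ger0_norm ?nrm2_ge0//.
have := nrm2D_le (l_ n f - l_ n (g k)) ((l_ n (g k) - l (g k)) + (l (g k) - l f)).
rewrite !addrA !subrK.
have := nrm2D_le (l_ n (g k) - l (g k)) (l (g k) - l f).
rewrite addrA subrK.
have := l_lip n f2 (g2 k); have := l_lip0 f2 (g2 k).
rewrite -[nrm2 (l f - _)]nrm2N opprB.
lra.
Unshelve. all: end_near. Qed.

End LipschitzLimit.

Section FlowContinuity.
Context d (X : measurableType d) (R : realType) (P : probability X R).
Local Notation MR := (measurableTypeR R).
Variable T : R -> X -> X.
Hypothesis flow : measure_preserving_flow P T.

Lemma flow0 x : T 0 x = x. Proof. by case: flow => -[-> _]. Qed.
Lemma flowD s t x : T (s + t) x = T s (T t x).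
Proof. by case: flow => -[_ ->]. Qed.
Lemma measurable_flow t : measurable_fun setT (T t). Proof. by case: flow. Qed.
Lemma flow_pres t A : measurable A -> P (T t @^-1` A) = P A.
Proof. by case: flow => _ _ h _; exact: h. Qed.

Definition cindic (A : set X) : X -> R[i] := fun x => (\1_A x : R)%:C%C.

Lemma nrm2_cindic A x : nrm2 (cindic A x) <= 1.
Proof.
rewrite /nrm2 /cindic/= expr0n/= addr0 indicE; case: (x \in A); rewrite ?expr1n//.
by rewrite expr0n.
Qed.

Lemma cmeasurable_cindic A : measurable A -> cmeasurable (cindic A).
Proof. by move=> mA; apply: cmeasurable_real; exact: measurable_indic. Qed.

Lemma L2_cindic A : measurable A -> L2 P (cindic A).
Proof.
move=> mA; apply: (L2_bounded (finite_measure_lty _) (cmeasurable_cindic mA)).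
exact: nrm2_cindic.
Qed.

Lemma total_cindic : total P (fun A : {A : set X | measurable A} => cindic (sval A)).
Proof.
move=> h h2 h0; have : {ae P, forall x, (h x)^* = 0}.
  apply: annihilator_ae => [|A mA].
    by apply: cintegrableJ; exact: L2_cintegrable1 (finite_measure_lty _) _ h2.
  exact: (h0 (exist _ A mA)).
by apply: ae_imp => x /eqP; rewrite conjC_eq0 => /eqP.
Qed.

Section Sequence.
Variables (h_ : nat -> R) (C : R).
Hypothesis hC : forall n, `|h_ n| <= C.
Hypothesis h0 : h_ n @[n --> \oo] --> (0:R).

(* The left-hand side is its own average over the orbit in time [0, 1], which is
   an [L_1]-modulus of continuity of a jointly measurable set under translation. *)
Lemma flow_indic_cvg A : measurable A ->
  \int[P]_x `|\1_A (T (h_ n) x) - \1_A x : R| @[n --> \oo] --> (0:R).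
Proof.
move=> mA; case: flow => _ _ _ /(_ A mA)[E mE [N [N' [mN' N'0 NN']] EN]].
suff e n : \int[P]_x `|\1_A (T (h_ n) x) - \1_A x : R| = shift_diff P h_ (\1_E) n.
  by under eq_fun do rewrite e; exact: (@shift_diff_indic _ _ _ P _ C hC h0 E mE).
set delta := LHS.
(* Joint measurability holds only up to a null set of the product. By Fubini almost every time
   section of that set is null, and translation invariance gives the same at time t + h. *)
have nul : {ae @lebesgue_measure R, forall t : MR, P (xsection N' t) = 0%E}.
  have mx : measurable_fun setT (P \o xsection N') by exact: measurable_fun_xsection.
  have : (\int[@lebesgue_measure R]_x `|(P \o xsection N') x| = 0)%E.
    rewrite -[RHS]N'0; apply: eq_integral => x _.
    by rewrite gee0_abs.
  move/(ae_eq_integral_abs _ measurableT mx).1; apply: ae_imp => t; exact.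
have nul_h : {ae @lebesgue_measure R, forall t : MR, P (xsection N' (t + h_ n)) = 0%E}.
  have := ae_mp (measurable_translation (h_ n)) (@lebesgue_translation R (h_ n)) nul.
  by [].
have EA t x : ~ N' (t, x) -> (\1_E (t, x) : R) = \1_A (T t x).
  move=> nN; rewrite !indicE; congr (_%:R); congr nat_of_bool.
  have : (E `|` N) (t, x) = A (T t x) by rewrite EN.
  move=> e; apply/idP/idP; rewrite !inE.
    by move=> Et; rewrite -e; left.
  by rewrite -e => -[//|/NN'].
have mI : measurable (`[0, 1[%classic : set MR) by exact: measurable_itv.
have I1 : (@lebesgue_measure R) (`[0, 1[%classic : set MR) = 1%E.
  by rewrite lebesgue_measure_itv/= lte_fin ltr01 sube0.
pose F (z : MR * X) : R := \1_(`[0, 1[%classic : set MR) z.1 * `|\1_E (shift1 (h_ n) z) - \1_E z|.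
have mF : measurable_fun setT F.
  apply: measurable_funM; first by apply: measurableT_comp => //.
  apply: measurableT_comp => //; apply: measurable_funB => //.
  by apply: measurableT_comp => //; exact: measurable_shift1.
have F0 z : 0 <= F z by rewrite mulr_ge0// indicE.
have mTA t : measurable_fun setT (fun x => \1_A (T t x) : R).
  by apply: measurableT_comp => //; exact: measurable_flow.
have inner_t (t : MR) : P (xsection N' t) = 0%E -> P (xsection N' (t + h_ n)) = 0%E ->
    (\int[P]_x (F (t, x))%:E = (\1_(`[0, 1[%classic : set MR) t * delta)%:E)%E.
  move=> n1 n2; have iF : rintegrable P (fun x => F (t, x)).
    apply: (@rintegrable_bounded _ _ _ _ (finite_measure_lty _) _ 2).
      by apply: measurableT_comp mF _; exact: measurable_pair1.
    move=> x; rewrite normrM -[2]mul1r ler_pM// ?indic_le1// normr_id.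
    by rewrite (le_trans (ler_normB _ _))// (_ : 2 = 1 + 1)// lerD// indic_le1.
  rewrite -(EFin_rint iF); congr (_%:E).
  have id t' : rintegrable P (fun x => `|\1_A (T t' x) - \1_A x : R|).
    apply: (@rintegrable_bounded _ _ _ _ (finite_measure_lty _) _ 2).
      by apply: measurableT_comp => //; exact: measurable_funB.
    move=> x; rewrite normr_id.
    by rewrite (le_trans (ler_normB _ _))// (_ : 2 = 1 + 1)// lerD// indic_le1.
  rewrite /delta -(rint_mp (measurable_flow t) (@flow_pres t) (id _)) -rintZ; last first.
    exact: (rintegrable_mp (measurable_flow t) (@flow_pres t) (id _)).
  apply: rint_ae.
  - by apply: measurableT_comp mF _; exact: measurable_pair1.
  - apply: measurable_funM => //; apply: measurableT_comp => //.
    apply: measurable_funB => //.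
    by under eq_fun do rewrite -flowD; exact: mTA.
  have ns (u : MR) : P (xsection N' u) = 0%E -> {ae P, forall x, ~ N' (u, x)}.
    move=> nu; exists (xsection N' u); split => //; first exact: measurable_xsection.
    by move=> x /contrapT Nx; rewrite /xsection/= inE.
  have := ns _ n1; have := ns _ n2; apply: filterS2 => x e1 e2.
  by rewrite /F /shift1/= -flowD [h_ n + t]addrC (EA _ _ e1) (EA _ _ e2).
have mFE : measurable_fun setT (fun z => (F z)%:E) by exact/measurable_EFinP.
have F0E z : (0 <= (F z)%:E)%E by rewrite lee_fin.
rewrite /shift_diff -/F /Rintegral.
rewrite (@fubini_tonelli1 _ _ MR X R (@lebesgue_measure R) P (fun z => (F z)%:E) mFE F0E).
rewrite (ae_eq_integral (fun t : MR => (\1_(`[0, 1[%classic : set MR) t * delta)%:E))//.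
- under eq_integral do rewrite mulrC EFinM.
  rewrite ge0_integralZl//; last 2 first.
  + exact/measurable_EFinP/measurable_indic.
  + by rewrite lee_fin /delta Rintegral_ge0.
  by rewrite integral_indic// setIT [X in (_ * X)%E](_ : _ = 1%E)// mule1.
- exact: measurable_fun_fubini_tonelli_F.
- by apply/measurable_EFinP; apply: measurable_funM.
- by have := nul; have := nul_h; apply: filterS2 => t n2 n1 _; exact: inner_t.
Qed.

Lemma koopman_cindic_cvg A B : measurable A -> measurable B ->
  ccvg (fun n => inner P (koopman T (h_ n) (cindic A)) (cindic B)) (inner P (cindic A) (cindic
    B)).
Proof.
move=> mA mB; have A2 := L2_cindic mA; have B2 := L2_cindic mB.
have U2 n : L2 P (koopman T (h_ n) (cindic A)).
  exact: (L2_mp (measurable_flow _) (@flow_pres _) A2).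
pose D n x : R := `|\1_A (T (h_ n) x) - \1_A x : R|.
have iD n : rintegrable P (D n).
  apply: (@rintegrable_bounded _ _ _ _ (finite_measure_lty _) _ 2).
    apply: measurableT_comp => //; apply: measurable_funB => //.
    by apply: measurableT_comp => //; exact: measurable_flow.
  move=> x; rewrite normr_id.
  by rewrite (le_trans (ler_normB _ _))// (_ : 2 = 1 + 1)// lerD// indic_le1.
have diff n : inner P (koopman T (h_ n) (cindic A)) (cindic B) - inner P (cindic A) (cindic B) =
    cintegral P setT (fun x => (koopman T (h_ n) (cindic A) x - cindic A x) * (cindic B x)^*).
  by rewrite -innerBl.
have ci n : cintegrable P (fun x => (koopman T (h_ n) (cindic A) x - cindic A x) * (cindic B
  x)^*).
  by apply: L2_cintegrable => //; exact: L2B.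
have bnd n x : `|complex.Re ((koopman T (h_ n) (cindic A) x - cindic A x) * (cindic B x)^*)| <=
  D n x /\
    `|complex.Im ((koopman T (h_ n) (cindic A) x - cindic A x) * (cindic B x)^*)| <= D n x.
  have -> : (koopman T (h_ n) (cindic A) x - cindic A x) * (cindic B x)^* =
      ((\1_A (T (h_ n) x) - \1_A x) * \1_B x : R)%:C%C.
    by apply: cplx_eq; rewrite /koopman /cindic !ReImE /=; ring.
  rewrite /= normr0; split; last exact: normr_ge0.
  by rewrite normrM -[leRHS]mulr1 ler_wpM2l// indic_le1.
pose delta n : R := \int[P]_x D n x.
have d0 : delta n @[n --> \oo] --> (0:R) by exact: flow_indic_cvg.
have nd0 : - delta n @[n --> \oo] --> (0:R) by rewrite -oppr0; exact: cvgN.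
suff : ccvg (fun n => inner P (koopman T (h_ n) (cindic A)) (cindic B) -
    inner P (cindic A) (cindic B)) 0.
  move=> h; have := ccvgD h (ccvg_cst (inner P (cindic A) (cindic B))).
  by rewrite add0r; under eq_fun do rewrite subrK.
under eq_fun do rewrite diff.
split; apply: (squeeze_cvgr _ nd0 d0); apply: nearW => n; rewrite -ler_norml.
  by apply: Re_cint_le => // x; case: (bnd n x).
by apply: Im_cint_le => // x; case: (bnd n x).
Qed.

(** Indicators are total, and the bound needed is Cauchy-Schwarz with the invariance of P. The
    second argument is extended first, under a conjugation that makes it linear; the first argument
    follows. *)
Lemma koopman_weak_cvg f g : L2 P f -> L2 P g ->
  ccvg (fun n => inner P (koopman T (h_ n) f) g) (inner P f g).
Proof.
move=> f2 g2; have U2 n k : L2 P k -> L2 P (koopman T (h_ n) k).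
  exact: (L2_mp (measurable_flow _) (@flow_pres _)).
pose a (A : {A : set X | measurable A}) := cindic (sval A).
have a2 A : L2 P (a A) by apply: L2_cindic; exact: (svalP A).
have lip1 k (k2 : L2 P k) n (u v : X -> R[i]) : L2 P u -> L2 P v ->
    nrm2 ((inner P (koopman T (h_ n) k) u)^* - (inner P (koopman T (h_ n) k) v)^*) <=
    sqnorm P k * sqnorm P (fun x => u x - v x).
  move=> u2 v2; rewrite -rmorphB nrm2J -innerBr; [|exact: u2|exact: v2|exact: U2].
  rewrite -(sqnorm_mp (measurable_flow (h_ n)) (@flow_pres (h_ n)) k2).
  by apply: cauchy_schwarz; [exact: U2|exact: L2B].
have lip10 k (k2 : L2 P k) (u v : X -> R[i]) : L2 P u -> L2 P v ->
    nrm2 ((inner P k u)^* - (inner P k v)^*) <= sqnorm P k * sqnorm P (fun x => u x - v x).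
  move=> u2 v2; rewrite -rmorphB nrm2J -innerBr//.
  by apply: cauchy_schwarz => //; exact: L2B.
have step1 A : ccvg (fun n => (inner P (koopman T (h_ n) (a A)) g)^*) (inner P (a A) g)^*.
  have [p gp] := total_comb a2 total_cindic g2.
  apply: (ccvg_sqnorm_closed (sqnorm_ge0 _ _) (lip1 _ (a2 A)) (lip10 _ (a2 A)) g2 (fun k =>
    comb_L2 (p k) a2) _ gp).
  move=> k; have c2 := comb_L2 (p k) a2.
  have e (w : X -> R[i]) : L2 P w -> (inner P w (comb a (p k)))^* =
      \sum_(i < projT1 (p k)) (projT2 (p k)).1 i * (inner P w (a ((projT2 (p k)).2 i)))^*.
    by move=> w2; rewrite -innerC// inner_comb//; apply: eq_bigr => i _; rewrite innerC.
  rewrite (e _ (a2 A)); under eq_fun => n do rewrite (e _ (U2 n _ (a2 A))).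
  apply: ccvg_sum => i; apply: ccvgM; first exact: ccvg_cst.
  apply: ccvgJ; exact: koopman_cindic_cvg (svalP _) (svalP _).
have lip2 n (u v : X -> R[i]) : L2 P u -> L2 P v ->
    nrm2 (inner P (koopman T (h_ n) u) g - inner P (koopman T (h_ n) v) g) <=
    sqnorm P g * sqnorm P (fun x => u x - v x).
  move=> u2 v2; rewrite -(innerBl (U2 n _ u2) (U2 n _ v2) g2) [leRHS]mulrC.
  rewrite -(sqnorm_mp (measurable_flow (h_ n)) (@flow_pres (h_ n)) (L2B u2 v2)).
  by apply: cauchy_schwarz => //; exact: U2 (L2B u2 v2).
have lip20 (u v : X -> R[i]) : L2 P u -> L2 P v ->
    nrm2 (inner P u g - inner P v g) <= sqnorm P g * sqnorm P (fun x => u x - v x).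
  move=> u2 v2; rewrite -innerBl// [leRHS]mulrC.
  by apply: cauchy_schwarz => //; exact: L2B.
have [p fp] := total_comb a2 total_cindic f2.
apply: (ccvg_sqnorm_closed (sqnorm_ge0 _ _) lip2 lip20 f2 (fun k => comb_L2 (p k) a2) _ fp).
move=> k; rewrite inner_comb//.
have e n : inner P (koopman T (h_ n) (comb a (p k))) g =
    \sum_(i < projT1 (p k)) (projT2 (p k)).1 i *
      inner P (koopman T (h_ n) (a ((projT2 (p k)).2 i))) g.
  rewrite -(inner_comb (v := fun j => koopman T (h_ n) (a j)))// => j.
  exact: U2.
under eq_fun do rewrite e.
apply: ccvg_sum => i; apply: ccvgM; first exact: ccvg_cst.
have := ccvgJ (step1 ((projT2 (p k)).2 i)); rewrite conjCK.
by under eq_fun do rewrite conjCK.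
Qed.

End Sequence.

Lemma koopmanD s t f : koopman T (s + t) f = koopman T t (koopman T s f).
Proof. by apply/funext => x; rewrite /koopman/= flowD. Qed.

Lemma koopman0 f : koopman T 0 f = f.
Proof. by apply/funext => x; rewrite /koopman/= flow0. Qed.

Lemma L2_koopman t f : L2 P f -> L2 P (koopman T t f).
Proof. exact: (L2_mp (measurable_flow _) (@flow_pres _)). Qed.

Lemma inner_koopman t f g : L2 P f -> L2 P g ->
  inner P (koopman T t f) (koopman T t g) = inner P f g.
Proof. exact: (inner_mp (measurable_flow _) (@flow_pres _)). Qed.

Lemma inner_koopman2 s t f g : L2 P f -> L2 P g ->
  inner P (koopman T s f) (koopman T t g) = inner P (koopman T (s - t) f) g.
Proof.
move=> f2 g2; rewrite -(inner_koopman t (L2_koopman _ f2) g2) -koopmanD.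
by rewrite subrK.
Qed.

Lemma correlation_continuous f g : L2 P f -> L2 P g ->
  continuous (fun t : R => complex.Re (inner P (koopman T t f) g)) /\
  continuous (fun t : R => complex.Im (inner P (koopman T t f) g)).
Proof.
move=> f2 g2; suff h t (u : R^nat) : u n @[n --> \oo] --> t ->
    ccvg (fun n => inner P (koopman T (u n) f) g) (inner P (koopman T t f) g).
  by split=> t; apply/(@cvg_nbhsP _ R^o) => u /h[].
move=> ut; have v0 : u n - t @[n --> \oo] --> (0:R).
  by rewrite -(subrr t); apply: cvgB => //; exact: cvg_cst.
have [C vC] : exists C, forall n, `|u n - t| <= C.
  have : cvgn (fun n => u n - t) by apply/cvg_ex; exists 0.
  move=> /cvg_seq_bounded[C [_ hC]]; exists (C + 1) => n.
  by apply: (hC (C + 1)) => //; rewrite ltrDl.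
have := koopman_weak_cvg vC v0 (L2_koopman t f2) g2.
by under eq_fun do rewrite -koopmanD addrC subrK.
Qed.

(** Positive definiteness holds because the double sum is the squared norm of the combination of
    translates of f with these coefficients. *)
Theorem spectral_measure_ex f : L2 P f ->
  exists s : {finite_measure set MR -> \bar R}, spectral_measure_of P (koopman T) f s.
Proof.
move=> f2; have [cr ci] := correlation_continuous f2 f2.
apply: (@bochner _ (fun t => inner P (koopman T t f) f)) => //.
- move=> t; rewrite -innerC//; last exact: L2_koopman.
  by have := inner_koopman2 0 t f2 f2; rewrite sub0r koopman0.
- move=> n c t; set S := \sum_(i < n) _.
  have -> : S = inner P (fun x => \sum_(i < n) c i * koopman T (t i) f x)
      (fun x => \sum_(i < n) c i * koopman T (t i) f x).
    have k2 i : L2 P (fun x => c i * koopman T (t i) f x) by apply: L2Z; exact: L2_koopman.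
    rewrite inner_suml//; last exact: L2_sum.
    apply: eq_bigr => i _; rewrite innerC//; last exact: L2_sum.
    rewrite inner_suml// rmorph_sum/=; apply: eq_bigr => j _.
    by rewrite -innerC// innerZl ?innerZr ?inner_koopman2 ?mulrA//; exact: L2_koopman.
  by rewrite inner_sqnorm sqnorm_ge0.
Qed.

End FlowContinuity.

(** * Spectral form of the weak limits *)

Section MeanExponential.
Context (R : realType).
Local Notation MR := (measurableTypeR R).
Local Notation leb := (@lebesgue_measure R).

Lemma derivable_LRcontinuous (F : R -> R) (a b : R) : (forall x, derivable F x 1) ->
  derivable_oo_LRcontinuous F a b.
Proof.
move=> dF; have cF : continuous F by move=> x; exact/differentiable_continuous/derivable1_diffP.
by split=> [x _|//|]; [|exact/cvg_at_right_filter/cF|exact/cvg_at_left_filter/cF].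
Qed.

Lemma Rintegral_FTC (f F : R -> R) (a : R) : 0 < a -> continuous f ->
  (forall x, is_derive x (1:R) F (f x)) -> \int[leb]_(x in `[0, a]) f x = F a - F 0.
Proof.
move=> a0 cf dF; rewrite /Rintegral (@continuous_FTC2 R f F) //.
- exact: continuous_subspaceT.
- by apply: derivable_LRcontinuous => x; exact: ex_derive.
- by move=> x _; rewrite derive1E; exact: derive_val.
Qed.

Lemma cint_mean_cexp (a x : R) : 0 < a ->
  cintegral leb `[0, a]%classic (fun t => cexp (t * x)) = a%:C%C * psi (a * x).
Proof.
move=> a0; have [->|x0] := eqVneq x 0.
  rewrite mulr0 psi0 mulr1; under [X in cintegral _ _ X]eq_fun do rewrite mulr0 cexp0.
  apply: cplx_eq; rewrite /cintegral/= Rintegral_cst//= ?mul0r// mul1r.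
  by rewrite lebesgue_measure_itv/= lte_fin a0 oppr0 adde0.
have a0' : a != 0 by rewrite gt_eqF.
rewrite psi_neq0 ?mulf_neq0//; apply: cplx_eq; rewrite /cintegral !ReImE/=.
  have -> : \int[leb]_(t in `[0, a]) cos (t * x) = x^-1 * sin (a * x) - x^-1 * sin (0 * x).
    apply: (Rintegral_FTC (f := fun t => cos (t * x)) (F := fun t => x^-1 * sin (t * x)) a0).
      move=> t; apply: continuous_comp; last exact: continuous_cos.
      exact: mulrr_continuous.
    move=> t; apply: is_derive_eq.
    by rewrite /GRing.scale/=; field.
  by rewrite mul0r sin0 mulr0 subr0; field; rewrite a0' x0.
have -> : \int[leb]_(t in `[0, a]) sin (t * x) = - (x^-1 * cos (a * x)) - - (x^-1 * cos (0 * x)).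
  apply: (Rintegral_FTC (f := fun t => sin (t * x)) (F := fun t => - (x^-1 * cos (t * x))) a0).
    move=> t; apply: continuous_comp; last exact: continuous_sin.
    exact: mulrr_continuous.
  move=> t; apply: is_derive_eq.
  by rewrite /GRing.scale/=; field.
by rewrite mul0r cos0; field; rewrite a0' x0.
Qed.

Lemma cint_mean_cexpM (a x : R) c : 0 < a ->
  cintegral leb `[0, a]%classic (fun t => cexp (t * x) * c) = a%:C%C * psi (a * x) * c.
Proof.
move=> a0; rewrite -cint_mean_cexp//.
have ic (f : R -> R) r : continuous f ->
    leb.-integrable `[0, a]%classic (EFin \o (fun t => f (t * x) * r)).
  move=> cf; apply: continuous_compact_integrable; first exact: segment_compact.
  apply: continuous_subspaceT => t; apply: continuousM; last exact: cst_continuous.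
  by apply: continuous_comp; [exact: mulrr_continuous|exact: cf].
have ic1 (f : R -> R) : continuous f -> leb.-integrable `[0, a]%classic (EFin \o (fun t =>
  f (t * x))).
  by move=> /(ic _ 1); rewrite (_ : (fun t => _ * 1) = fun t => f (t * x))//;
    apply/funext => t; rewrite mulr1.
have cc := @continuous_cos R; have cs := @continuous_sin R.
have mI : measurable (`[0, a]%classic : set MR) by exact: measurable_itv.
apply: cplx_eq; rewrite /cintegral ReImE/=.
  under eq_Rintegral do rewrite cReM/=.
  rewrite RintegralB//; [|exact: ic|exact: ic].
  by rewrite !RintegralZr//; exact: ic1.
under eq_Rintegral do rewrite cImM/=.
rewrite RintegralD//; [|exact: ic|exact: ic].
by rewrite !RintegralZr//; exact: ic1.
Qed.

Lemma rint_window_Fubini (s : {finite_measure set MR -> \bar R}) (D : set MR)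
  (f : MR * MR -> R) K : measurable D -> (leb D < +oo)%E -> measurable_fun setT f ->
  (forall z, `|f z| <= K) ->
  \int[leb]_(t in D) (\int[s]_x f (t, x)) = \int[s]_x (\int[leb]_(t in D) f (t, x)).
Proof.
move=> mD Dfin mf fK; pose g (z : MR * MR) : R := \1_D z.1 * f z.
have mg : measurable_fun setT g by apply: measurable_funM => //; apply: measurableT_comp.
have gi : rintegrable (leb \x s)%E g by exact: rintegrable_strip fK.
have ii : rintegrable leb (fun t => \1_D t : R).
  apply/integrableP; split; first exact/measurable_EFinP/measurable_indic.
  rewrite (eq_integral (fun z => (\1_D z)%:E)); last by move=> z _; rewrite /= ger0_norm.
  by rewrite integral_indic// setIT.
have i1 (t : MR) : rintegrable s (fun x => g (t, x)).
  apply: (@rintegrable_bounded _ _ _ _ (finite_measure_lty _) _ K).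
    by apply: measurableT_comp mg _; exact: measurable_pair1.
  move=> x; rewrite normrM -[leRHS]mul1r ler_pM// indic_le1//.
have i2 (x : MR) : rintegrable leb (fun t => g (t, x)).
  apply: (@le_rintegrable _ _ _ _ _ (fun t => K * \1_D t)).
  - by apply: measurableT_comp mg _; exact: measurable_pair2.
  - by move=> t; rewrite /g/= normrM mulrC [`|\1_D t|]ger0_norm// ler_wpM2r.
  - exact: rintegrableZ.
transitivity (\int[leb]_t \int[s]_x g (t, x)).
  rewrite Rintegral_mkcond; apply: eq_Rintegral => t _.
  rewrite patchE; case: ifPn => tD; rewrite /g/= indicE.
    by rewrite tD; apply: eq_Rintegral => x _; rewrite mul1r.
  rewrite (negbTE tD); under eq_Rintegral do rewrite mul0r.
  by rewrite /Rintegral integral0.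
transitivity (\int[s]_x \int[leb]_t g (t, x)); last first.
  apply: eq_Rintegral => x _; rewrite [RHS]Rintegral_mkcond; apply: eq_Rintegral => t _.
  by rewrite patchE /g/= indicE; case: ifPn; rewrite ?mul1r ?mul0r.
have F := @Fubini _ _ MR MR R leb s (fun z => (g z)%:E) gi.
rewrite /Rintegral; congr fine.
rewrite -!/(Rintegral _ _ _).
under eq_integral do rewrite EFin_rint//.
by rewrite F; apply: eq_integral => x _; rewrite EFin_rint.
Qed.

Lemma cint_window_Fubini (s : {finite_measure set MR -> \bar R}) (D : set MR)
  (f : MR * MR -> R[i]) : measurable D -> (leb D < +oo)%E -> cmeasurable f ->
  (forall z, nrm2 (f z) <= 1) ->
  cintegral leb D (fun t => cintegral s setT (fun x => f (t, x))) =
  cintegral s setT (fun x => cintegral leb D (fun t => f (t, x))).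
Proof.
move=> mD Dfin [mr mi] f1.
have le1 (r : R) w : r ^+ 2 <= nrm2 w -> nrm2 w <= 1 -> `|r| <= 1.
  move=> rw w1; rewrite -(@ler_pXn2r _ 2%N) ?nnegrE// real_normK ?num_real//.
  by rewrite expr1n (le_trans rw).
apply: cplx_eq; rewrite /cintegral/=.
  apply: (@rint_window_Fubini s D (fun z => complex.Re (f z)) 1) => // z.
  exact: le1 (sqrRe_le _) (f1 z).
apply: (@rint_window_Fubini s D (fun z => complex.Im (f z)) 1) => // z.
exact: le1 (sqrIm_le _) (f1 z).
Qed.

End MeanExponential.

Lemma normc_lt_nrm2 (R : realType) (z : R[i]) (r : R) : `|z| < r%:C%C -> 0 < r ->
  nrm2 z <= r ^+ 2.
Proof.
move=> zr r0; rewrite -lecR -mulCJ -normCK rmorphXn/=.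
have r0c : 0 <= r%:C%C by rewrite (lecR 0) ltW.
by rewrite ler_pXn2r ?nnegrE// ltW.
Qed.

Section WeakClosureSymbol.
Context d (X : measurableType d) (R : realType) (P : probability X R).
Local Notation MR := (measurableTypeR R).
Variables (T : R -> X -> X) (eps : R).
Hypothesis flow : measure_preserving_flow P T.
Hypothesis limits : forall a : R, 0 < a ->
  exists2 J, flow_integral P T a J &
    weak_closure P (koopman T)
      (fun f x => (1 - eps)%:C%C * Theta P f x + (eps / a)%:C%C * J f x).
Variables (u : X -> R[i]) (s : {finite_measure set MR -> \bar R}) (theta : MR -> R).
Hypothesis u2 : L2 P u.
Hypothesis us : spectral_measure_of P (koopman T) u s.
Hypothesis mtheta : measurable_fun setT theta.
Hypothesis theta_cexp : forall q,
  cintegral s setT (fun x => (theta x)%:C%C * cexp (q * x)) = (nrm2 (inner P u (cst 1)))%:C%C.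

(** The function theta stands for the spectral form of [Theta] on the vector u. It is the indicator
    of 0 for the cyclic vector and 0 for a vector orthogonal to the constants, so both cases share
    the argument. *)
Definition mixed_symbol (a : R) (x : MR) : R[i] :=
  (1 - eps)%:C%C * (theta x)%:C%C + eps%:C%C * psi (a * x).

Hypothesis theta01 : forall x, 0 <= theta x <= 1.
Hypothesis mixed_symbol_le1 : forall a x, nrm2 (mixed_symbol a x) <= 1.

Let sfin := finite_measure_lty s.

Lemma cmeasurable_mixed_symbol a : cmeasurable (mixed_symbol a).
Proof.
apply: cmeasurableD; apply: cmeasurableM; try exact: cmeasurable_cst.
  exact: cmeasurable_real.
by apply: cmeasurable_psi; exact: measurable_funM.
Qed.

Let mexp (t : R) : cmeasurable (fun x : MR => cexp (t * x)).
Proof. by apply: cmeasurable_cexp; exact: measurable_funM. Qed.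

Let iexp (t : R) : cintegrable s (fun x : MR => cexp (t * x)).
Proof. by apply: (cintegrable_bounded sfin (C := 1)) => // x; rewrite nrm2_cexp. Qed.

Lemma inner_cst1 f : L2 P f -> forall q, inner P (koopman T q f) (cst 1) = inner P f (cst 1).
Proof.
move=> f2 q; have c1 : L2 P (cst 1) := L2_cst (finite_measure_lty P) 1.
exact: (inner_koopman flow q f2 c1).
Qed.

Lemma inner_Theta f g : L2 P f -> L2 P g ->
  inner P (Theta P f) g = inner P f (cst 1) * (inner P g (cst 1))^*.
Proof.
move=> f2 g2; have c1 : L2 P (cst 1) := L2_cst (finite_measure_lty P) 1.
have -> : Theta P f = fun x => inner P f (cst 1) * cst 1 x by apply/funext => x; rewrite mulr1.
by rewrite innerZl// -innerC.
Qed.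

Lemma inner_koopman_char t q : inner P (koopman T t (koopman T q u)) u =
  cintegral s setT (fun x => cexp (t * x) * cexp (q * x)).
Proof.
rewrite -(koopmanD flow) us /fourier; congr cintegral; apply/funext => x.
by rewrite -/(cexp _) addrC mulrDl cexpD.
Qed.

Lemma inner_flow_integral a J q : 0 < a -> flow_integral P T a J ->
  inner P (J (koopman T q u)) u =
  a%:C%C * cintegral s setT (fun x => psi (a * x) * cexp (q * x)).
Proof.
move=> a0 [_ JE]; rewrite JE//; last exact: (L2_koopman flow).
transitivity (cintegral (@lebesgue_measure R) `[0, a]%classic
    (fun t => cintegral s setT (fun x => cexp (t * x) * cexp (q * x)))).
  by congr cintegral; apply/funext => t; exact: inner_koopman_char.
rewrite (@cint_window_Fubini _ s _ (fun z : MR * MR => cexp (z.1 * z.2) * cexp (q * z.2))).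
- rewrite -cintZ; last first.
    apply: (cintegrable_bM (C := 1)) (iexp q).
      by apply: cmeasurable_psi; exact: measurable_funM.
    by move=> x; exact: nrm2_psi_le1.
  by congr cintegral; apply/funext => x /=; rewrite mulrA cint_mean_cexpM.
- exact: measurable_itv.
- by rewrite lebesgue_measure_itv/= lte_fin a0 -EFinB ltry.
- apply: cmeasurableM; apply: cmeasurable_cexp; apply: measurable_funM => //.
- by move=> z; rewrite nrm2M !nrm2_cexp mulr1.
Qed.

Lemma weak_closure_char (a q : R) J : 0 < a -> flow_integral P T a J ->
  inner P (fun x => (1 - eps)%:C%C * Theta P (koopman T q u) x +
                    (eps / a)%:C%C * J (koopman T q u) x) u =
  cintegral s setT (fun x => mixed_symbol a x * cexp (q * x)).
Proof.
move=> a0 JP; have q2 := L2_koopman flow q u2.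
have J2 : L2 P (J (koopman T q u)) by case: JP => -[h _ _] _; exact: h.
have Th2 : L2 P (Theta P (koopman T q u)).
  exact: (L2_cst (finite_measure_lty P)).
rewrite (innerDl (L2Z _ Th2) (L2Z _ J2) u2) (innerZl _ Th2 u2) (innerZl _ J2 u2).
rewrite inner_Theta// inner_cst1// (inner_flow_integral _ a0 JP).
rewrite mulCJ -(theta_cexp q) mulrA -rmorphM/= divfK ?gt_eqF//.
have ipsi : cintegrable s (fun x => psi (a * x) * cexp (q * x)).
  apply: (cintegrable_bM (C := 1)) (iexp q).
    by apply: cmeasurable_psi; exact: measurable_funM.
  by move=> x; exact: nrm2_psi_le1.
have ith : cintegrable s (fun x => (theta x)%:C%C * cexp (q * x)).
  apply: (cintegrable_bM (C := 1)) (iexp q); first exact: cmeasurable_real.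
  move=> x; rewrite /nrm2/= expr0n addr0; have /andP[t0 t1] := theta01 x.
  by rewrite expr_le1.
rewrite -!cintZ// -cintD; [|exact: cintegrableZ..].
by congr cintegral; apply/funext => x; rewrite /mixed_symbol mulrDl !mulrA.
Qed.

(** A weak neighbourhood tests finitely many vectors. Testing ever more rational characters with
    ever smaller error gives a genuine sequence of times, and convergence on rational characters
    extends to all of L_1 through Borel indicators. *)
Lemma weak_limits_ex (a : R) : 0 < a -> exists t_ : nat -> R,
  forall g, cintegrable s g -> weak_lim s (fun n x => cexp (t_ n * x)) (mixed_symbol a) g.
Proof.
move=> a0; have [J JP [_ wc]] := limits a0.
(* An enumeration of the rationals in which a number coding none falls back to frequency 0. A given
   q is among the tests once n exceeds its code. *)
pose rq i : R := ratr (odflt 0 (unpickle i : option rat)).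
have tP n : {t : R | forall i : 'I_n, `|inner P (koopman T t (koopman T (rq i) u)) u -
    cintegral s setT (fun x => mixed_symbol a x * cexp (rq i * x))| < (n.+1%:R^-1)%:C%C}.
  apply: cid; have n0 : 0 < n.+1%:R^-1 :> R by rewrite invr_gt0.
  have [t tP] := wc n (fun i => koopman T (rq i) u) (fun=> u) _
    (fun i => L2_koopman flow _ u2) (fun=> u2) n0.
  by exists t => i; rewrite -(weak_closure_char _ a0 JP).
pose t_ n := sval (tP n); exists t_.
have wchar (q : rat) : weak_lim s (fun n x => cexp (t_ n * x)) (mixed_symbol a)
    (fun x => cexp (ratr q * x)).
  apply: ccvg_nrm2P; apply: (@squeeze_cvgr _ _ _ _ (fun=> 0) (fun n => n.+1%:R^-1)).
  - near=> n; rewrite nrm2_ge0/=.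
    have qn : (pickle q < n)%N by near: n; exact: nbhs_infty_gt.
    have := svalP (tP n) (Ordinal qn); rewrite /rq/= pickleK/= inner_koopman_char =>
      /normc_lt_nrm2 h.
    apply: le_trans (h _) _; first by rewrite invr_gt0.
    by rewrite expr2 -[leRHS]mul1r ler_wpM2r// invf_le1// ler1n.
  - exact: cvg_cst.
  - exact: cvg_harmonic.
have mem n : cmeasurable (fun x : MR => cexp (t_ n * x)) by exact: mexp.
have me1 n (x : MR) : nrm2 (cexp (t_ n * x)) <= 1 by rewrite nrm2_cexp.
apply: (weak_lim_cintegrable sfin mem (cmeasurable_mixed_symbol a) me1 (mixed_symbol_le1 a)).
move=> A mA; pose B := [set g : MR -> R | [/\ measurable_fun setT g,
    exists C, forall x, `|g x| <= C &
    weak_lim s (fun n x => cexp (t_ n * x)) (mixed_symbol a) (fun x => (g x)%:C%C)]].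
suff [] : B (\1_A) by [].
have Bcl : boundedly_closed B.
  exact: (weak_lim_bclosed sfin mem (cmeasurable_mixed_symbol a) me1 (mixed_symbol_le1 a)).
have wlin c1 c2 q : weak_lim s (fun n x => cexp (t_ n * x)) (mixed_symbol a)
    (fun x => c1 * cexp (ratr q * x) + c2 * cexp (ratr (- q) * x)).
  have mm := cmeasurable_mixed_symbol a; have mm1 := mixed_symbol_le1 a.
  apply: weak_limD => //; try exact: cintegrableZ.
    by apply: weak_limZ => //; exact: wchar.
  by apply: weak_limZ => //; exact: wchar.
apply: (@boundedly_closed_borel R B Bcl) => // q; split.
- apply: measurableT_comp; last exact: measurable_funM.
  exact: (continuous_measurable_fun (@continuous_cos R)).
- by exists 1 => x; exact: norm_cos_le1.
- have := wlin (2^-1) (2^-1) q; congr weak_lim; apply/funext => x.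
  rewrite rmorphN mulNr cexpN (_ : 2^-1 = (2^-1 : R)%:C%C :> R[i]); last first.
    by rewrite fmorphV rmorph_nat.
  by apply: cplx_eq; rewrite !ReImE/=; field.
- apply: measurableT_comp; last exact: measurable_funM.
  exact: (continuous_measurable_fun (@continuous_sin R)).
- by exists 1 => x; exact: norm_sin_le1.
- have := wlin (Complex 0 (- 2^-1)) (Complex 0 (2^-1)) q; congr weak_lim; apply/funext => x.
  rewrite rmorphN mulNr cexpN.
  by apply: cplx_eq; rewrite !ReImE/=; field.
Unshelve. all: end_near. Qed.

End WeakClosureSymbol.

Lemma cexp_annihilator_ae (R : realType) (mu : {measure set (measurableTypeR R) ->
  \bar R}) kappa :
  cintegrable mu kappa ->
  (forall p, cintegral mu setT (fun x => cexp (p * x) * kappa x) = 0) ->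
  {ae mu, forall x, kappa x = 0}.
Proof.
move=> ki k0; apply: annihilator_ae => // A mA.
have mq (p : R) : measurable_fun setT (fun x : measurableTypeR R => p * x).
  exact: measurable_funM.
have cs p := cexp_annihilates ki (mq p) (k0 p).
have {}cs p : cintegral mu setT (fun x => (cos (p * x))%:C%C * kappa x) = 0 /\
    cintegral mu setT (fun x => (sin (p * x))%:C%C * kappa x) = 0.
  by apply: cs; under [X in cintegral _ _ X]eq_fun do rewrite -mulNr; exact: k0.
have [] // := @boundedly_closed_borel R _ (annihilator_bclosed ki) _ _ A mA.
- move=> q; split; last by case: (cs (ratr q)).
  + apply: measurableT_comp (mq _); exact: (continuous_measurable_fun (@continuous_cos R)).
  + by exists 1 => z; exact: norm_cos_le1.
- move=> q; split; last by case: (cs (ratr q)).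
  + apply: measurableT_comp (mq _); exact: (continuous_measurable_fun (@continuous_sin R)).
  + by exists 1 => z; exact: norm_sin_le1.
Qed.

(** Orthogonality to the images of a total family spreads to the images of all vectors, since Phi
    respects combinations and is Lipschitz. It serves to free one factor of a tensor at a time. *)
Lemma total_orth d1 d2 (Y : measurableType d1) (Z : measurableType d2) (R : realType)
  (mu : {measure set Y -> \bar R}) (nu : {measure set Z -> \bar R})
  (I : Type) (a : I -> Y -> R[i]) (Phi : (Y -> R[i]) -> Z -> R[i]) K h :
  (forall j, L2 mu (a j)) -> total mu a -> (forall f, L2 mu f -> L2 nu (Phi f)) ->
  (forall p, Phi (comb a p) = comb (fun j => Phi (a j)) p) ->
  (forall f g, L2 mu f -> L2 mu g ->
    sqnorm nu (fun z => Phi f z - Phi g z) <= K * sqnorm mu (fun x => f x - g x)) ->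
  L2 nu h -> (forall j, inner nu (Phi (a j)) h = 0) ->
  forall f, L2 mu f -> inner nu (Phi f) h = 0.
Proof.
move=> a2 atot Phi2 Phic PhiL h2 ah f f2; have [p fp] := total_comb a2 atot f2.
have c2 n : L2 mu (comb a (p n)) by exact: comb_L2.
have Pn n : L2 nu (Phi (comb a (p n))) by exact: Phi2.
have lim : sqnorm nu (fun z => Phi (comb a (p n)) z - Phi f z) @[n --> \oo] --> (0:R).
  apply: (@squeeze_cvgr _ _ _ _ (fun=> 0) (fun n => `|K| * 8^-1 ^+ n.+1)).
  - apply: nearW => n; rewrite sqnorm_ge0/=.
    rewrite (_ : (fun z => _) = (fun z => - (Phi f z - Phi (comb a (p n)) z))); last first.
      by apply/funext => z; rewrite opprB.
    rewrite sqnormN (le_trans (PhiL _ _ f2 (c2 n)))//.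
    apply: (@le_trans _ _ (`|K| * sqnorm mu (fun x => f x - comb a (p n) x))).
      by rewrite ler_wpM2r ?sqnorm_ge0// ler_norm.
    by rewrite ler_wpM2l.
  - exact: cvg_cst.
  - by rewrite -[X in _ --> X](mulr0 `|K|); apply: cvgMl_tmp; exact: expr8_cvg.
have := inner_cvg Pn (Phi2 _ f2) h2 lim.
rewrite (_ : (fun n => _) = (fun=> 0)); first by move/ccvg_unique => /(_ _ (ccvg_cst 0)).
apply/funext => n; rewrite Phic inner_comb//; last by move=> j; exact: Phi2.
by rewrite big1// => i _; rewrite ah mulr0.
Qed.

Section TotalTensor.
Context d1 d2 (T1 : measurableType d1) (T2 : measurableType d2) (R : realType).
Variables (m1 : {finite_measure set T1 -> \bar R}) (m2 : {finite_measure set T2 -> \bar R}).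
Local Notation mm := (m1 \x m2)%E.
Variables (I J : Type) (a : I -> T1 -> R[i]) (b : J -> T2 -> R[i]).
Hypotheses (a2 : forall i, L2 m1 (a i)) (b2 : forall j, L2 m2 (b j)).
Hypotheses (atot : total m1 a) (btot : total m2 b).

Let L2_cind d (T : measurableType d) (m : {finite_measure set T -> \bar R}) A :
  measurable A -> L2 m (cindic R A).
Proof.
move=> mA; apply: (L2_bounded (finite_measure_lty _) (C := 1)); first exact: cmeasurable_cindic.
exact: nrm2_cindic.
Qed.

(** Freeing each factor in turn gives orthogonality to every tensor, in particular to the indicators
    of rectangles, which generate the product sigma-algebra. *)
Lemma total_tensor : total mm (fun ij : I * J => tensor (a ij.1) (b ij.2)).
Proof.
move=> h h2 h0.
have st1 j f : L2 m1 f -> inner mm (tensor f (b j)) h = 0.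
  apply: (@total_orth _ _ _ _ _ m1 mm I a (fun f => tensor f (b j)) (sqnorm m2 (b j))) => //.
  - by move=> g g2; exact: L2_tensor.
  - move=> p; apply/funext => z; rewrite /tensor /comb mulr_suml.
    by apply: eq_bigr => i _; rewrite mulrA.
  - move=> g g' g2 g'2; rewrite mulrC -sqnorm_tensor//; last exact: L2B.
    by rewrite le_eqVlt; apply/orP; left; apply/eqP; congr sqnorm; apply/funext => z;
      rewrite /tensor mulrBl.
  - by move=> i; exact: (h0 (i, j)).
have st2 f g : L2 m1 f -> L2 m2 g -> inner mm (tensor f g) h = 0.
  move=> f2; apply: (@total_orth _ _ _ _ _ m2 mm J b (fun g => tensor f g) (sqnorm m1 f)) => //.
  - by move=> g' g2; exact: L2_tensor.
  - move=> p; apply/funext => z; rewrite /tensor /comb mulr_sumr.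
    by apply: eq_bigr => i _; rewrite mulrCA.
  - move=> k k' k2 k'2; rewrite -sqnorm_tensor//; last exact: L2B.
    by rewrite le_eqVlt; apply/orP; left; apply/eqP; congr sqnorm; apply/funext => z;
      rewrite /tensor mulrBr.
  - by move=> j; exact: st1.
have ki : cintegrable mm (fun z => (h z)^*).
  by apply: cintegrableJ; apply: L2_cintegrable1 (finite_prod_lty _ _) _ h2.
have rect A B : measurable A -> measurable B ->
    cintegral mm setT (fun z => (\1_(A `*` B) z : R)%:C%C * (h z)^*) = 0.
  move=> mA mB; rewrite -(st2 _ _ (L2_cind m1 mA) (L2_cind m2 mB)).
  congr cintegral; apply/funext => z; rewrite /tensor /cindic; congr (_ * _).
  by rewrite -rmorphM/=; congr (_%:C)%C; rewrite !indicE in_setX -natrM mulnb.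
have : {ae mm, forall z, (h z)^* = 0}.
  apply: annihilator_ae => // A mA.
  have [] // := boundedly_closed_indic (annihilator_bclosed ki)
    (G := [set A `*` B | A in @measurable _ T1 & B in @measurable _ T2]) _ _ _ _ mA.
  - exact: measurable_prod_measurableType.
  - move=> _ _ [C mC [D mD <-]] [C' mC' [D' mD' <-]]; rewrite -setXI.
    by exists (C `&` C'); [exact: measurableI|exists (D `&` D') => //; exact: measurableI].
  - split; [exact: measurable_cst|by exists 1 => z; rewrite normr1|].
    by rewrite -(rect _ _ measurableT measurableT); congr cintegral; apply/funext => z;
      rewrite setXTT indicT.
  - move=> _ [C mC [D mD <-]]; split; last exact: rect.
      by apply: measurable_indic; exact: measurableX.
    by exists 1 => z; exact: indic_le1.
by apply: ae_imp => x /eqP; rewrite conjC_eq0 => /eqP.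
Qed.

End TotalTensor.

Section Indicator.
Context d (Y : measurableType d) (R : realType) (m : {finite_measure set Y -> \bar R}).

Lemma cintegrable_indic A : measurable A -> cintegrable m (fun x => (\1_A x : R)%:C%C).
Proof.
move=> mA; apply: (cintegrable_real (finite_measure_lty m)).
apply: (rintegrable_bounded (finite_measure_lty m) (C := 1)) => [|x].
  exact: measurable_indic.
exact: indic_le1.
Qed.

Lemma cint_indic A : measurable A ->
  cintegral m setT (fun x => (\1_A x : R)%:C%C) = (fine (m A))%:C%C.
Proof.
move=> mA; apply: cplx_eq; rewrite /cintegral/=; last by rewrite /Rintegral integral0.
by rewrite /Rintegral integral_indic ?setIT.
Qed.

End Indicator.

(** * The spectral isomorphism of a cyclic vector *)

Section CyclicFlow.
Context d (X : measurableType d) (R : realType) (P : probability X R).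
Local Notation MR := (measurableTypeR R).
Variables (T : R -> X -> X) (eps : R).
Hypothesis flow : measure_preserving_flow P T.
Hypotheses (eps0 : 0 < eps) (eps1 : eps < 1).
Hypothesis limits : forall a : R, 0 < a ->
  exists2 J, flow_integral P T a J &
    weak_closure P (koopman T)
      (fun f x => (1 - eps)%:C%C * Theta P f x + (eps / a)%:C%C * J f x).
Variables (u : X -> R[i]) (s : {finite_measure set MR -> \bar R}).
Hypothesis u2 : L2 P u.
Hypothesis ucyc : L2 P `<=` closed_span P (orbit_of (koopman T) u).
Hypothesis us : spectral_measure_of P (koopman T) u s.
Local Notation PP := (P \x P)%E.
Local Notation ss := (s \x s)%E.
Local Notation U := (koopman T).

Definition orbit1 (p : R) : X -> R[i] := U p u.
Definition chr1 (p : R) (x : MR) : R[i] := cexp (p * x).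

Lemma L2_orbit1 p : L2 P (orbit1 p). Proof. exact: L2_koopman. Qed.

Lemma cmeasurable_chr1 p : cmeasurable (chr1 p).
Proof. by apply: cmeasurable_cexp; exact: measurable_funM. Qed.

Lemma L2_chr1 p : L2 s (chr1 p).
Proof.
apply: (L2_bounded (finite_measure_lty s) (C := 1)) => [|x]; first exact: cmeasurable_chr1.
by rewrite nrm2_cexp.
Qed.

Lemma total_orbit1 : total P orbit1.
Proof.
move=> h h2 h0; apply: sqnorm_eq0_ae => //.
have S2 : orbit_of U u `<=` L2 P by move=> _ [t _ <-]; exact: L2_orbit1.
have := closed_span_orth S2 h2 h2 _ (ucyc h2); rewrite inner_sqnorm => e.
have /(congr1 (@complex.Re R)) : (sqnorm P h)%:C%C = 0 by apply: e => _ [t _ <-]; exact: h0.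
by [].
Qed.

Lemma total_chr1 : total s chr1.
Proof.
move=> h h2 h0; have : {ae s, forall x, (h x)^* = 0}.
  apply: cexp_annihilator_ae => [|p]; last exact: h0.
  by apply: cintegrableJ; exact: L2_cintegrable1 (finite_measure_lty _) _ h2.
by apply: ae_imp => x /eqP; rewrite conjC_eq0 => /eqP.
Qed.

Lemma gram1 : same_gram P s orbit1 chr1.
Proof.
split=> [p|p|p q]; [exact: L2_orbit1|exact: L2_chr1|].
rewrite /orbit1 (inner_koopman2 flow)// us /fourier /inner.
congr cintegral; apply/funext => x.
by rewrite -/(cexp _) /chr1 mulrBl cexpD cexpN.
Qed.

Local Notation corr1 := (corresp P s orbit1 chr1).

Lemma corr1_koopman t f f' : corr1 f f' -> corr1 (U t f) (fun x => cexp (t * x) * f' x).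
Proof.
move=> [f2 f'2 ff']; split.
- exact: L2_koopman.
- by apply: (L2_bM (C := 1)) => //; [exact: cmeasurable_chr1|move=> x; rewrite nrm2_cexp].
- move=> p; have -> : orbit1 p = U t (orbit1 (p - t)).
    by rewrite /orbit1 -(koopmanD flow) subrK.
  rewrite (inner_koopman flow)//; last exact: L2_orbit1.
  rewrite ff' /inner; congr cintegral; apply/funext => x.
  by rewrite /chr1 mulrBl cexpD cexpN rmorphM/= conjCK mulrA mulrC mulrA.
Qed.

Definition cst1 : X -> R[i] := cst 1.

Lemma L2_cst1 : L2 P cst1. Proof. exact: L2_cst (finite_measure_lty P) _. Qed.

Lemma inner_cst11 : inner P cst1 cst1 = 1.
Proof.
rewrite inner_sqnorm sqnormE (_ : \int[P]_x _ = 1)//.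
under eq_Rintegral do rewrite /nrm2/= expr0n expr1n addr0.
by rewrite Rintegral_cst// mul1r [X in fine X](_ : _ = 1%E)//; exact: probability_setT.
Qed.

(** A multiple of the point mass at frequency 0, the eigenvalue of the constants. *)
Definition origin (c : R[i]) (x : MR) : R[i] := c * (\1_[set 0] x : R)%:C%C.

Lemma cmeasurable_origin c : cmeasurable (origin c).
Proof.
apply: cmeasurableM; first exact: cmeasurable_cst.
by apply: cmeasurable_real; apply: measurable_indic; exact: measurable_set1.
Qed.

(** The constant function is invariant, so its image is unchanged by every character [cexp (t * x)].
    Countably many times suffice to force it to vanish outside x = 0. *)
Lemma corr1_cst : exists c, corr1 cst1 (origin c).
Proof.
have [g [c2 g2 gP]] := corresp_ex gram1 total_orbit1 L2_cst1.
have gfix t : {ae s, forall x, cexp (t * x) * g x = g x}.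
  have h := corr1_koopman t (And3 c2 g2 gP).
  exact: (corresp_ae gram1 total_chr1 h (And3 c2 g2 gP)).
have g0 : {ae s, forall x, g x = origin (g 0) x}.
  have : {ae s, forall x, forall n : nat, cexp (n.+1%:R^-1 * x) * g x = g x}.
    by apply/ae_foralln => n; exact: gfix.
  apply: ae_imp => x gx; rewrite /origin indicE.
  have [->|x0] := eqVneq x 0; first by rewrite mem_set// mulr1.
  rewrite memNset ?mulr0//=; last exact/eqP.
  (* The time 1/(n+1) brings x into ]-1, 1[, where a nonzero angle never has exponential 1. *)
  pose n := Num.truncn `|x|; have xn : `|x| < n.+1%:R by exact: truncnS_gt.
  have xpi : `|n.+1%:R^-1 * x| < 2 * pi.
    rewrite normrM ger0_norm ?invr_ge0// (lt_le_trans (y := 1))//.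
      by rewrite mulrC ltr_pdivrMr// mul1r.
    have := pi_ge2 R; lra.
  have xn0 : 0 < `|n.+1%:R^-1 * x| by rewrite normr_gt0 mulf_neq0// invr_neq0.
  have c1 := cexp_neq1 xn0 xpi.
  have := gx n => /eqP; rewrite -subr_eq0 -[X in _ - X]mul1r -mulrBl mulf_eq0 subr_eq0.
  by rewrite (negbTE c1)/= => /eqP.
exists (g 0); split => //.
  apply: (L2_bounded (finite_measure_lty s) (C := nrm2 (g 0))) => [|x].
    exact: cmeasurable_origin.
  rewrite nrm2M ler_piMr ?nrm2_ge0// /nrm2/= expr0n addr0 indicE.
  by case: (x \in _); rewrite ?expr1n ?expr0n.
move=> p; rewrite gP /inner; apply: cint_ae.
- apply: cmeasurableM; first exact: L2_meas g2.
  by apply: cmeasurableJ; exact: cmeasurable_chr1.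
- apply: cmeasurableM; first exact: cmeasurable_origin.
  by apply: cmeasurableJ; exact: cmeasurable_chr1.
- by apply: ae_imp g0 => x ->.
Qed.

Lemma cint_origin c (f : MR -> R[i]) : cintegral s setT (fun x => origin c x * f x) =
  c * f 0 * (fine (s [set 0]))%:C%C.
Proof.
have -> : (fun x => origin c x * f x) = (fun x => (c * f 0) * (\1_[set 0] x : R)%:C%C).
  apply/funext => x; rewrite /origin indicE; have [->|x0] := eqVneq x 0.
    by rewrite mulrAC.
  by rewrite memNset ?mulr0 ?mul0r//=; exact/eqP.
by rewrite cintZ ?cint_indic//; exact: cintegrable_indic.
Qed.

Section Origin.
Variable c : R[i].
Hypothesis corr_c : corr1 cst1 (origin c).
Let m0 : R := fine (s [set 0]).

Lemma origin_mass : nrm2 c * m0 = 1.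
Proof.
have := inner_corresp gram1 total_orbit1 total_chr1 corr_c corr_c.
rewrite inner_cst11 /inner cint_origin /origin indicE mem_set// mulr1 mulCJ -rmorphM/=.
by move=> /(congr1 (@complex.Re R)).
Qed.

Lemma origin_neq0 : c != 0.
Proof.
by apply/eqP => c0; have := origin_mass; rewrite c0 /nrm2/= expr0n addr0 mul0r => /esym/eqP;
  rewrite oner_eq0.
Qed.

Lemma m0_neq0 : m0 != 0.
Proof.
by apply/eqP => m00; have := origin_mass; rewrite m00 mulr0 => /esym/eqP; rewrite oner_eq0.
Qed.

(** The image of u is the character 1, so its inner product with the constant has squared modulus
    [nrm2 c * m0 ^+ 2]; normalisation of the constant gives [nrm2 c * m0 = 1]. *)
Lemma nrm2_inner_cst1 : nrm2 (inner P u cst1) = m0.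
Proof.
have := inner_corresp gram1 total_orbit1 total_chr1 corr_c (corresp_gen gram1 0).
rewrite {2}/inner cint_origin /orbit1 (koopman0 flow) /chr1 mul0r cexp0 rmorph1 mulr1 => e.
rewrite -nrm2J -innerC ?e; [|exact: u2|exact: L2_cst1].
rewrite nrm2M (_ : nrm2 m0%:C%C = m0 * m0); last by rewrite /nrm2/= expr0n addr0 expr2.
by rewrite mulrA origin_mass mul1r.
Qed.

End Origin.

(** This identifies the indicator of 0 as the symbol of the projection onto the constants. *)
Lemma theta_cexp q : cintegral s setT (fun x => (\1_[set 0] x : R)%:C%C * cexp (q * x)) =
  (nrm2 (inner P u (cst 1)))%:C%C.
Proof.
have [c cc] := corr1_cst; rewrite -/cst1 (nrm2_inner_cst1 cc).
have -> : (fun x : MR => (\1_[set 0] x : R)%:C%C * cexp (q * x)) = (fun x =>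
  origin 1 x * cexp (q * x)).
  by apply/funext => x; rewrite /origin mul1r.
by rewrite cint_origin mulr0 cexp0 !mul1r.
Qed.

Lemma cyclic_weak_limits : forall a, 0 < a -> exists t_ : nat -> R,
  forall g, cintegrable s g -> weak_lim s (fun n x => cexp (t_ n * x)) (limit_symbol eps a) g.
Proof.
apply: (weak_limits_ex (theta := \1_[set 0]) flow limits u2 us).
- by apply: measurable_indic; exact: measurable_set1.
- exact: theta_cexp.
- by move=> x; rewrite indicE; case: (x \in _); rewrite /= ?lexx ?ler01.
- by move=> a x; exact: nrm2_limit_symbol.
Qed.

Lemma cyclic_no_atom x : x != 0 -> s [set x] = 0%E.
Proof.
move=> x0; pose m := fine (s [set x]).
have sE : s [set x] = m%:E by rewrite fineK// fin_num_measure//; exact: measurable_set1.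
suff : m = 0 by rewrite sE => ->.
have cintE (f : MR -> R[i]) : cintegral s setT (fun y =>
  f y * (\1_[set x] y : R)%:C%C) = f x * m%:C%C.
  have -> : (fun y => f y * (\1_[set x] y : R)%:C%C) = (fun y => f x * (\1_[set x] y : R)%:C%C).
    apply/funext => y; rewrite indicE; have [->//|yx] := eqVneq y x.
    by rewrite memNset ?mulr0//=; exact/eqP.
  by rewrite cintZ ?cint_indic//; exact: cintegrable_indic.
have gi : cintegrable s (fun y => (\1_[set x] y : R)%:C%C).
  by apply: cintegrable_indic; exact: measurable_set1.
(* each [|cexp (t_n x)|] is 1 whereas the limit symbol has modulus at most [eps] *)
have [t_ /(_ _ gi)] := cyclic_weak_limits ltr01.
rewrite /weak_lim cintE limit_symbol_neq0//.
under eq_fun do rewrite cintE.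
move=> h; have h' := ccvgM h (ccvgJ h).
have : ccvg (fun=> (m ^+ 2)%:C%C) (eps%:C%C * psi (1 * x) * m%:C%C * (eps%:C%C * psi (1 * x) *
  m%:C%C)^*).
  move: h'; congr ccvg; apply/funext => n.
  rewrite mulCJ nrm2M nrm2_cexp mul1r /nrm2/= expr0n addr0//.
move=> /(ccvg_unique (ccvg_cst _)) => /(congr1 (@complex.Re R)).
rewrite mulCJ/= !nrm2M (_ : nrm2 m%:C%C = m ^+ 2); last by rewrite /nrm2/= expr0n addr0.
rewrite nrm2_real => e; apply/eqP; rewrite -sqrf_eq0; apply/eqP.
have := nrm2_psi_le1 (1 * x); have := nrm2_ge0 (psi (1 * x)) => p0 p1.
have m20 := sqr_ge0 m; have e1 : eps ^+ 2 < 1 by rewrite expr_lt1// ltW.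
have e0 := sqr_ge0 eps.
have : eps ^+ 2 * nrm2 (psi (1 * x)) <= eps ^+ 2 by rewrite ler_piMr.
move: e; set w := nrm2 _ => e ew.
have : m ^+ 2 <= eps ^+ 2 * m ^+ 2 by rewrite {1}e ler_wpM2r.
nra.
Qed.

Definition pair_orbit (pq : R * R) : X * X -> R[i] := tensor (orbit1 pq.1) (orbit1 pq.2).
Definition pair_chr (pq : R * R) : MR * MR -> R[i] := tensor (chr1 pq.1) (chr1 pq.2).

Lemma gram2 : same_gram PP ss pair_orbit pair_chr.
Proof.
case: gram1 => o2 c2 oc; split=> [pq|pq|pq rt]; [exact: L2_tensor|exact: L2_tensor|].
by rewrite !inner_tensor// !oc.
Qed.

Lemma total_orbit2 : total PP pair_orbit.
Proof. exact: (total_tensor L2_orbit1 L2_orbit1 total_orbit1 total_orbit1). Qed.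

Lemma total_chr2 : total ss pair_chr.
Proof. exact: (total_tensor L2_chr1 L2_chr1 total_chr1 total_chr1). Qed.

Lemma chr2E p q : pair_chr (p, q) = char2 p q.
Proof. by apply/funext => z; rewrite char2E. Qed.

End CyclicFlow.

Lemma cint_mfrestr d (Y : measurableType d) (R : realType) (mu : {measure set Y -> \bar R})
  (D : set Y) (mD : measurable D) (Dfin : (mu D < +oo)%E) (f : Y -> R[i]) : cmeasurable f ->
  cintegral (mfrestr mD Dfin) setT f = cintegral mu setT (fun x => (\1_D x : R)%:C%C * f x).
Proof.
have rr (g : Y -> R) : measurable_fun setT g ->
    \int[mfrestr mD Dfin]_x g x = \int[mu]_x (\1_D x * g x).
  move=> mg; have mDg : measurable_fun setT (fun x => \1_D x * g x).
    by apply: measurable_funM => //; exact: measurable_indic.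
  transitivity (\int[mfrestr mD Dfin]_x (\1_D x * g x)).
    apply: rint_ae => //; exists (~` D); split; first exact: measurableC.
      by transitivity (mu (~` D `&` D)) => //; rewrite setICl measure0.
    move=> x /= nx Dx; apply: nx; by rewrite indicE mem_set// mul1r.
  have e (m : {measure set Y -> \bar R}) :
      \int[m]_x (\1_D x * g x) = \int[m]_(x in D) g x.
    rewrite [RHS]Rintegral_mkcond; apply: eq_Rintegral => x _.
    by rewrite patchE indicE; case: ifP; rewrite ?mul1r ?mul0r.
  rewrite !e /Rintegral; congr fine; apply: eq_measure_integral => A mA AD.
  by rewrite /mfrestr /mrestr; congr (mu _); exact/setIidPl.
move=> [mr mi]; apply: cplx_eq; rewrite /cintegral/=.
  by rewrite rr//; apply: eq_Rintegral => x _; rewrite cReM/= mul0r subr0.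
by rewrite rr//; apply: eq_Rintegral => x _; rewrite cImM/= mul0r addr0.
Qed.

(** Uniqueness of the Fourier transform: s' is the image under th of the measure with density k. It
    is used to read null sets of a spectral measure off the square of a function on the plane. *)
Lemma fourier_unique d (Z : measurableType d) (R : realType)
  (s' : {finite_measure set (measurableTypeR R) -> \bar R}) (mu : {measure set Z -> \bar R})
  (th k : Z -> R) : measurable_fun setT th -> rintegrable mu k ->
  (forall t, fourier s' setT t = cintegral mu setT (fun z => cexp (t * th z) * (k z)%:C%C)) ->
  forall A, measurable A -> fine (s' A) = \int[mu]_z (\1_A (th z) * k z).
Proof.
move=> mth ki F; have sfin := finite_measure_lty s'.
have mk := rintegrable_meas ki.
pose B := [set g : measurableTypeR R -> R | [/\ measurable_fun setT g,
  exists C, forall x, `|g x| <= C & \int[s']_x g x = \int[mu]_z (g (th z) * k z)]].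
have gki (g : measurableTypeR R -> R) C : measurable_fun setT g -> (forall x, `|g x| <= C) ->
    rintegrable mu (fun z => g (th z) * k z).
  move=> mg gC; apply: (le_rintegrable _ _ (rintegrableZ C (rintegrable_norm ki))).
    by apply: measurable_funM => //; exact: (measurableT_comp mg mth).
  by move=> z; rewrite normrM ler_wpM2r.
have Bcl : boundedly_closed B.
  split=> [c f g [mf [C fC] fE] [mg [D gD] gE]|f_ f C Bf fC ff].
    split; first by apply: measurable_funD => //; exact: measurable_funM.
      by exists (`|c| * C + D) => x; rewrite (le_trans (ler_normD _ _))// lerD// normrM ler_wpM2l.
    rewrite rintD ?rintZ ?fE ?gE//; last 3 first.
    - exact: (rintegrable_bounded sfin mf fC).
    - by apply: rintegrableZ; exact: (rintegrable_bounded sfin mf fC).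
    - exact: (rintegrable_bounded sfin mg gD).
    rewrite -rintZ; last exact: gki fC.
    rewrite -rintD; [|by apply: rintegrableZ; exact: gki fC|exact: gki gD].
    by apply: eq_Rintegral => z _; rewrite mulrDl mulrA.
  have mf : measurable_fun setT f.
    by apply: (measurable_fun_cvg (h := f_)) => [m|x _]; [case: (Bf m)|exact: ff].
  split => //.
    by exists C => x; apply: (ler_cvg_to (cvg_norm (ff x)) (cvg_cst C)); apply: nearW.
  have l1 : \int[s']_x f_ n x @[n --> \oo] --> \int[s']_x f x.
    apply: (rint_cvg (g := fun=> C)) => //; first by move=> n; case: (Bf n).
      by apply: rintegrable_cst.
    by apply: aeW => x; exact: ff.
  have l2 : \int[mu]_z (f_ n (th z) * k z) @[n --> \oo] --> \int[mu]_z (f (th z) * k z).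
    apply: (rint_cvg (g := fun z => C * `|k z|)).
    - move=> n; apply: measurable_funM => //; case: (Bf n) => mfn _ _.
      exact: (measurableT_comp mfn mth).
    - by apply: measurable_funM => //; exact: (measurableT_comp mf mth).
    - by apply: rintegrableZ; exact: rintegrable_norm.
    - by move=> n z; rewrite normrM ler_wpM2r.
    - by apply: aeW => z; apply: cvgMr_tmp; exact: ff.
  have e : (fun n => \int[s']_x f_ n x) = (fun n => \int[mu]_z (f_ n (th z) * k z)).
    by apply/funext => n; case: (Bf n).
  by rewrite -e in l2; exact: (cvg_unique _ l1 l2).
move=> A mA; have mq (q : R) : measurable_fun setT (fun x : measurableTypeR R => q * x).
  exact: measurable_funM.
have [_ _] : B (\1_A); last first.
  by rewrite /Rintegral integral_indic// setIT.
apply: (@boundedly_closed_borel R B Bcl) => // q; split.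
- apply: measurableT_comp (mq _); exact: (continuous_measurable_fun (@continuous_cos R)).
- by exists 1 => x; exact: norm_cos_le1.
- have /(congr1 (@complex.Re R)) := F (ratr q); rewrite /fourier /cintegral/= => ->.
  by apply: eq_Rintegral => z _; rewrite mulr0 subr0.
- apply: measurableT_comp (mq _); exact: (continuous_measurable_fun (@continuous_sin R)).
- by exists 1 => x; exact: norm_sin_le1.
- have /(congr1 (@complex.Im R)) := F (ratr q); rewrite /fourier /cintegral/= => ->.
  by apply: eq_Rintegral => z _; rewrite mulr0 add0r.
Qed.

(** * The tensor square *)

Section TensorSquare.
Context d (X : measurableType d) (R : realType) (P : probability X R).
Local Notation MR := (measurableTypeR R).
Variables (T : R -> X -> X) (eps : R).
Hypothesis flow : measure_preserving_flow P T.
Hypotheses (eps0 : 0 < eps) (eps1 : eps < 1).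
Hypothesis limits : forall a : R, 0 < a ->
  exists2 J, flow_integral P T a J &
    weak_closure P (koopman T)
      (fun f x => (1 - eps)%:C%C * Theta P f x + (eps / a)%:C%C * J f x).
Variables (u : X -> R[i]) (s : {finite_measure set MR -> \bar R}).
Hypothesis u2 : L2 P u.
Hypothesis ucyc : L2 P `<=` closed_span P (orbit_of (koopman T) u).
Hypothesis us : spectral_measure_of P (koopman T) u s.
Local Notation PP := (P \x P)%E.
Local Notation ss := (s \x s)%E.
Local Notation U2 := (koopman (product_flow T)).
Local Notation orbit2 := (pair_orbit T u).
Local Notation chr2 := (@pair_chr R).
Local Notation corr2 := (corresp PP ss orbit2 chr2).
Local Notation swap := (@pswap _ _).

Let G2 : same_gram PP ss orbit2 chr2.
Proof. exact: (gram2 flow u2 us). Qed.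

Let O2 : total PP orbit2.
Proof. exact: (total_orbit2 flow u2 ucyc). Qed.

Let C2 : total ss chr2.
Proof. exact: total_chr2. Qed.

Let ssfin : (ss setT < +oo)%E := finite_prod_lty s s.
Let PPfin : (PP setT < +oo)%E := finite_prod_lty P P.

Lemma L2_orbit2 pq : L2 PP (orbit2 pq).
Proof. by case: G2. Qed.

Lemma cmeasurable_chr2 pq : cmeasurable (chr2 pq).
Proof. by case: G2 => _ h _; exact: L2_meas (h pq). Qed.

Lemma nrm2_chr2 pq z : nrm2 (chr2 pq z) = 1.
Proof. by rewrite /pair_chr /tensor nrm2M !nrm2_cexp mulr1. Qed.

Lemma product_flow_pres t :
  measurable_fun setT (product_flow T t) /\
  forall A, measurable A -> PP (product_flow T t @^-1` A) = PP A.
Proof. exact: pair_map_pres (measurable_flow flow t) (@flow_pres _ _ _ _ _ flow t). Qed.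

Lemma L2_product_flow t f : L2 PP f -> L2 PP (U2 t f).
Proof. by case: (product_flow_pres t) => m p; exact: L2_mp. Qed.

Lemma inner_product_flow t f g : L2 PP f -> L2 PP g -> inner PP (U2 t f) (U2 t g) = inner PP f g.
Proof. by case: (product_flow_pres t) => m p; exact: inner_mp. Qed.

Lemma product_flow_orbit2 t p q : U2 t (orbit2 (p, q)) = orbit2 (p + t, q + t).
Proof.
by apply/funext => z; rewrite /koopman /pair_orbit /tensor /orbit1 /koopman/= !(flowD flow).
Qed.

Lemma corr2_product_flow t f f' : corr2 f f' -> corr2 (U2 t f) (fun z => chr2 (t, t) z * f' z).
Proof.
move=> [f2 f'2 ff']; split.
- exact: L2_product_flow.
- by apply: (L2_bM (C := 1)) => //; [exact: cmeasurable_chr2|move=> x; rewrite nrm2_chr2].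
- move=> [p q]; have -> : orbit2 (p, q) = U2 t (orbit2 (p - t, q - t)).
    by rewrite product_flow_orbit2 !subrK.
  rewrite inner_product_flow//; last exact: L2_orbit2.
  rewrite ff' /inner; congr cintegral; apply/funext => z.
  rewrite /pair_chr /tensor /chr1/= !mulrBl !cexpD !cexpN !rmorphM/= !conjCK.
  ring.
Qed.

Lemma corr2_swap f f' : corr2 f f' -> corr2 (f \o swap) (f' \o swap).
Proof.
move=> [f2 f'2 ff']; split.
- exact: (L2_mp (@measurable_pswap _ X) (pswap_pres P)).
- exact: (L2_mp (@measurable_pswap _ MR) (pswap_pres s)).
- move=> [p q].
  have -> : orbit2 (p, q) = fun z => orbit2 (q, p) (swap z).
    by apply/funext => z; rewrite /pair_orbit /tensor /= mulrC.
  have -> : chr2 (p, q) = fun z => chr2 (q, p) (swap z).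
    by apply/funext => z; rewrite /pair_chr /tensor /= mulrC.
  case: G2 => o2 c2 _.
  rewrite (inner_mp (@measurable_pswap _ X) (pswap_pres P) f2 (o2 _)).
  by rewrite (inner_mp (@measurable_pswap _ MR) (pswap_pres s) f'2 (c2 _)).
Qed.

Lemma corr2_ae f g f' : L2 PP g -> {ae PP, forall z, f z = g z} -> corr2 f f' -> corr2 g f'.
Proof.
move=> g2 fg [f2 f'2 ff']; split => // pq; rewrite -ff' /inner; apply: cint_ae.
- by apply: cmeasurableM; [exact: L2_meas g2|apply: cmeasurableJ; exact: L2_meas (L2_orbit2 pq)].
- by apply: cmeasurableM; [exact: L2_meas f2|apply: cmeasurableJ; exact: L2_meas (L2_orbit2 pq)].
- by apply: ae_imp fg => z ->.
Qed.

Let antisym k : diag_ann s k -> {ae ss, forall z, k z + k (swap z) = 0}.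
Proof.
exact: (diag_ann_antisymmetric eps0 eps1 (cyclic_weak_limits flow eps0 eps1 limits u2 ucyc us)).
Qed.

(** The product flow acts as multiplication by diagonal characters, so orthogonality to an orbit is
    annihilation of these characters by a single integrable function. *)
Lemma corr2_orth_diag_ann f f' h h' : corr2 f f' -> corr2 h h' ->
  (forall t, inner PP (U2 t f) h = 0) -> diag_ann s (fun z => f' z * (h' z)^*).
Proof.
move=> ff' hh' fh; split.
  by case: ff' hh' => _ ? _ [_ ? _]; exact: L2_cintegrable.
move=> t; rewrite -(fh t).
rewrite (inner_corresp G2 O2 C2 (corr2_product_flow t ff') hh') /inner.
congr cintegral; apply/funext => z; rewrite mulrA; congr (_ * _ * _).
by rewrite -chr2E.
Qed.

Theorem symmetric_square_simple : simple_spectrum PP U2 (symmetric_L2 P).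
Proof.
exists (orbit2 (0, 0)).
  split; first exact: L2_orbit2.
  by apply: aeW => z; rewrite /pair_orbit /tensor /= mulrC.
move=> f [f2 fsym].
have S2 : orbit_of U2 (orbit2 (0, 0)) `<=` L2 PP.
  by move=> _ [t _ <-]; apply: L2_product_flow; exact: L2_orbit2.
apply: (closed_span_dual S2 f2) => h h2 hort.
have [f' ff'] := corresp_ex G2 O2 f2; have [h' hh'] := corresp_ex G2 O2 h2.
have f'sym : {ae ss, forall z, f' (swap z) = f' z}.
  have c1 := corr2_swap ff'.
  have c2 : corr2 f (f' \o swap).
    apply: corr2_ae c1 => //; apply: ae_imp fsym => z e; exact/esym.
  exact: (corresp_ae G2 C2 c2 ff').
have da := corr2_orth_diag_ann (corresp_gen G2 (0, 0)) hh' (fun t =>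
  hort _ (ex_intro2 _ _ t I erefl)).
have hanti : {ae ss, forall z, h' (swap z) = - h' z}.
  apply: ae_imp (antisym da) => z.
  rewrite /pair_chr /tensor /chr1 /= !mul0r cexp0 !mul1r => e.
  have : (h' z)^* = - (h' (swap z))^* by apply/eqP; rewrite -addr_eq0; apply/eqP.
  by move/(congr1 (fun w => w^*)); rewrite rmorphN /= !conjCK => ->; rewrite opprK.
have [_ f'2 _] := ff'; have [_ h'2 _] := hh'.
rewrite (inner_corresp G2 O2 C2 ff' hh').
(* Exchanging the coordinates preserves the product measure and f' but changes the sign of h', so
   the inner product equals its opposite. *)
have e : inner ss f' h' = - inner ss f' h'.
  rewrite -{1}(inner_mp (@measurable_pswap _ MR) (pswap_pres s) f'2 h'2).
  rewrite -innerNr// /inner; apply: cint_ae.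
  - apply: cmeasurableM; first exact: L2_meas (L2_mp (@measurable_pswap _ MR) (pswap_pres s) f'2).
    by apply: cmeasurableJ; exact: L2_meas (L2_mp (@measurable_pswap _ MR) (pswap_pres s) h'2).
  - apply: cmeasurableM; first exact: L2_meas f'2.
    by apply: cmeasurableJ; apply: cmeasurableN; exact: L2_meas h'2.
  - by have := f'sym; have := hanti; apply: filterS2 => z -> ->.
by have /eqP := e; rewrite -addr_eq0 -mulr2n mulrn_eq0 => /eqP.
Qed.

Definition below : set (MR * MR) := [set z | z.1 < z.2].

Lemma measurable_below : measurable below.
Proof.
have -> : below = (fun z : MR * MR => z.2 - z.1) @^-1` `]0, +oo[%classic.
  by apply/seteqP; split=> z; rewrite /below/= in_itv/= andbT subr_gt0.
rewrite -[X in measurable X]setTI; have h : measurable_fun setT (fun z : MR * MR =>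
  z.2 - z.1 : MR).
  exact: measurable_funB.
by apply: h => //; exact: measurable_itv.
Qed.

Definition ind (A : set (MR * MR)) (z : MR * MR) : R[i] := (\1_A z : R)%:C%C.

Let cmeas_below : cmeasurable (ind below).
Proof. by apply: cmeasurable_real; apply: measurable_indic; exact: measurable_below. Qed.

Let nrm2_ind A z : nrm2 (ind A z) <= 1.
Proof.
rewrite /nrm2 /ind/= expr0n/= addr0 indicE; case: (z \in A); rewrite ?expr1n//.
by rewrite expr0n.
Qed.

Let L2_below : L2 ss (ind below).
Proof. exact: (L2_bounded ssfin cmeas_below (nrm2_ind below)). Qed.

Lemma below_ex : exists2 v, L2 PP v & corr2 v (ind below).
Proof.
have [v vv] := corresp_ex (same_gram_sym G2) C2 L2_below.
by exists v; [case: vv|exact: corresp_sym].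
Qed.

Let below_fin : (ss below < +oo)%E.
Proof.
by apply: le_lt_trans ssfin; apply: le_measure; rewrite ?inE//; exact: measurable_below.
Qed.

Let madd : measurable_fun setT (fun z : MR * MR => z.1 + z.2 : MR).
Proof. exact: measurable_funD. Qed.

Definition sum_measure : {finite_measure set MR -> \bar R} :=
  @image_measure _ _ _ MR R (mfrestr measurable_below below_fin) _ madd.

Lemma fourier_sum_measure t : fourier sum_measure setT t =
  cintegral ss setT (fun z => ind below z * chr2 (t, t) z).
Proof.
have mexp : cmeasurable (fun x : MR => cexp (t * x)).
  by apply: cmeasurable_cexp; exact: measurable_funM.
have iexp : cintegrable sum_measure (fun x : MR => cexp (t * x)).
  by apply: (cintegrable_bounded (finite_measure_lty sum_measure) (C := 1)) => // x;
    rewrite nrm2_cexp.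
transitivity (cintegral (mfrestr measurable_below below_fin) setT (fun z =>
  cexp (t * (z.1 + z.2)))).
  exact: (esym (@cint_mp _ _ (MR * MR)%type MR R (mfrestr measurable_below below_fin)
    sum_measure _ madd (fun A _ => erefl) (fun x => cexp (t * x)) iexp)).
rewrite cint_mfrestr; last exact: (cmeasurable_mp madd mexp).
by congr cintegral; apply/funext => z; rewrite /pair_chr /tensor /chr1 /= mulrDr cexpD.
Qed.

(** The sum is symmetric, so the null set below the diagonal can be exchanged with one above it;
    only diagonal points remain. *)
Lemma sum_measure_null A : measurable A -> sum_measure A = 0%E ->
  {ae ss, forall z, A (z.1 + z.2) -> z.1 = z.2}.
Proof.
move=> mA A0; pose N := (fun z : MR * MR => z.1 + z.2 : MR) @^-1` A `&` below.
have mN : measurable N.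
  apply: measurableI; last exact: measurable_below.
  by rewrite -[X in measurable X]setTI; exact: madd.
have N0 : ss N = 0%E by exact: A0.
have nb : {ae ss, forall z, ~ N z}.
  by exists N; split => // z /contrapT.
have nb' : {ae ss, forall z, ~ N (swap z)}.
  exact: (ae_mp (@measurable_pswap _ MR) (pswap_pres s) nb).
apply: filterS2 nb nb' => z n1 n2 Az.
have [lt|gt|//] := ltgtP z.1 z.2; first by case: n1.
by case: n2; split; rewrite /preimage/= 1?addrC.
Qed.

Lemma diagonal_null : {ae ss, forall z, z.1 = z.2 -> z = (0, 0)}.
Proof.
pose D : set (MR * MR) := [set z | z.1 = z.2 /\ z.1 != 0].
have mD : measurable D.
  have -> : D = (fun z : MR * MR => z.1 - z.2) @^-1` [set 0] `&` fst @^-1` (~` [set 0]).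
    apply/seteqP; split=> z; rewrite /D/=.
      by move=> [-> z0]; split; [exact: subrr|exact/eqP].
    by move=> [/subr0_eq -> /eqP].
  apply: measurableI; rewrite -[X in measurable X]setTI.
    have h : measurable_fun setT (fun z : MR * MR => z.1 - z.2 : MR) by exact: measurable_funB.
    by apply: h => //; exact: measurable_set1.
  by apply: (@measurable_fst _ _ MR MR) => //; apply: measurableC; exact: measurable_set1.
exists D; split => //.
  rewrite /product_measure1 integral0_eq// => x _ /=.
  have [->|x0] := eqVneq x 0.
    rewrite (_ : xsection D 0 = set0) ?measure0//.
    by apply/seteqP; split=> y //; rewrite /xsection/= inE /D/= => -[_]; rewrite eqxx.
  rewrite (_ : xsection D x = [set x]).
    exact: (cyclic_no_atom flow eps0 eps1 limits u2 ucyc us).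
  apply/seteqP; split=> y; rewrite /xsection/= inE /D/=; first by case.
  by move=> ->.
move=> z /= nz; rewrite /D/=.
have [e ne] : z.1 = z.2 /\ z <> (0, 0).
  apply: contrapT => h; apply: nz => e; apply: contrapT => ne; exact: h.
split => //; apply/eqP => z0; apply: ne.
by rewrite [z]surjective_pairing -e z0.
Qed.

Lemma L2_origin w : L2 s (origin w).
Proof.
apply: L2Z; apply: (L2_bounded (finite_measure_lty s) (C := 1)) => [|x].
  by apply: cmeasurable_real; apply: measurable_indic; exact: measurable_set1.
by rewrite /nrm2/= expr0n addr0 indicE; case: (x \in _); rewrite ?expr1n ?expr0n.
Qed.

Lemma corr2_cst c : corresp P s (orbit1 T u) (@chr1 R) (@cst1 _ X R) (origin c) ->
  corr2 (cst 1) (tensor (origin c) (origin c)).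
Proof.
move=> [c12 o2 cP]; split; [exact: (L2_cst PPfin)|exact: L2_tensor|].
move=> [p q]; have -> : (cst 1 : X * X -> R[i]) = tensor (@cst1 _ X R) (@cst1 _ X R).
  by apply/funext => z; rewrite /tensor mulr1.
case: (gram1 flow u2 us) => r2 k2 _.
by rewrite !inner_tensor// !cP.
Qed.

Lemma inner_tensor_origin f c : inner ss f (tensor (origin c) (origin c)) =
  f (0, 0) * (c^* * c^*) * ((fine (s [set 0]))%:C%C * (fine (s [set 0]))%:C%C).
Proof.
transitivity (cintegral ss setT (fun z => f (0, 0) * tensor (origin (c^*)) (origin (c^*)) z)).
  congr cintegral; apply/funext => z; rewrite /tensor /origin.
  rewrite !rmorphM/= !indicE; have [z1|z1] := eqVneq z.1 0; last first.
    by rewrite [z.1 \in _]memNset ?(mulr0, mul0r, conjc0, rmorph0)//=; exact/eqP.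
  have [z2|z2] := eqVneq z.2 0; last first.
    by rewrite [z.2 \in _]memNset ?(mulr0, mul0r, conjc0, rmorph0)//=; exact/eqP.
  rewrite z1 z2 mem_set//= !rmorph1 !mulr1; congr (f _ * _).
  by rewrite [z]surjective_pairing z1 z2.
have io w : cintegrable s (origin w) by exact: (L2_cintegrable1 (finite_measure_lty s)
  (L2_origin w)).
rewrite cintZ; last exact: (L2_cintegrable1 ssfin (L2_tensor (L2_origin _) (L2_origin _))).
rewrite cint_tensor// -mulrA; congr (_ * _).
have eo w : cintegral s setT (origin w) = w * (fine (s [set 0]))%:C%C.
  have := cint_origin s w (fun=> 1); rewrite mulr1 => <-.
  by congr cintegral; apply/funext => x; rewrite mulr1.
by rewrite !eo mulrACA.
Qed.

(** The origin carries positive mass for the product measure, so the value of f' there is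
    meaningful: the inner product with the constants is a nonzero multiple of it. *)
Lemma orth_constants_origin f f' : corr2 f f' -> inner PP f (cst 1) = 0 -> f' (0, 0) = 0.
Proof.
move=> ff' f1; have [c cc] := corr1_cst flow u2 ucyc us.
have c0 := origin_neq0 flow u2 ucyc us cc.
have m0 : (fine (s [set 0]))%:C%C != 0 :> R[i].
  apply: contra (m0_neq0 flow u2 ucyc us cc) => /eqP/(congr1 (@complex.Re R))/= e.
  exact/eqP.
have := inner_corresp G2 O2 C2 ff' (corr2_cst cc); rewrite f1 inner_tensor_origin => /esym/eqP.
by rewrite !mulf_eq0 !conjC_eq0 (negbTE c0) (negbTE m0) !orbF => /eqP.
Qed.

Lemma orth_constants_sum_measure f f' A : measurable A -> sum_measure A = 0%E ->
  corr2 f f' -> orth_constants PP f -> {ae ss, forall z, A (z.1 + z.2) -> f' z = 0}.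
Proof.
move=> mA A0 ff' [f2 f1]; have f0 := orth_constants_origin ff' f1.
have := sum_measure_null mA A0; have := diagonal_null.
by apply: ae_imp2 => z h1 h2 /h2 /h1 ->.
Qed.

Section MaximalType.
Variable v0 : X * X -> R[i].
Hypothesis vv0 : corr2 v0 (ind below).

Let L2v0 : L2 PP v0. Proof. by case: vv0. Qed.

Definition above : set (MR * MR) := [set z | z.2 < z.1].

Let v1 : X * X -> R[i] := v0 \o swap.

Let vv1 : corr2 v1 (ind above).
Proof. exact: (corr2_swap vv0). Qed.

Let L2v1 : L2 PP v1. Proof. by case: vv1. Qed.

Let orth_cst v (A : set (MR * MR)) : corr2 v (ind A) -> ~ A (0, 0) -> orth_constants PP v.
Proof.
move=> vA A0; split; first by case: vA.
have [c cc] := corr1_cst flow u2 ucyc us.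
rewrite (inner_corresp G2 O2 C2 vA (corr2_cst cc)) inner_tensor_origin.
by rewrite /ind indicE memNset//= !mul0r.
Qed.

Let orth_v0 : orth_constants PP v0.
Proof. by apply: (orth_cst vv0); rewrite /below/= ltxx. Qed.

Let orth_v1 : orth_constants PP v1.
Proof. by apply: (orth_cst vv1); rewrite /above/= ltxx. Qed.

Let corr_v0 t : inner PP (U2 t v0) v0 = fourier sum_measure setT t.
Proof.
rewrite fourier_sum_measure (inner_corresp G2 O2 C2 (corr2_product_flow t vv0) vv0).
congr cintegral; apply/funext => z.
have e : ind below z * (ind below z)^* = ind below z.
  rewrite mulCJ /ind /nrm2/= expr0n addr0 indicE.
  by case: (_ \in _); rewrite ?expr1n ?expr0n.
by rewrite -[LHS]mulrA e mulrC.
Qed.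

Let corr_v1 t : inner PP (U2 t v1) v1 = fourier sum_measure setT t.
Proof.
rewrite -corr_v0 -(inner_mp (@measurable_pswap _ X) (pswap_pres P) (L2_product_flow t L2v0) L2v0).
by [].
Qed.

Let mixed_v t t' : inner PP (U2 t v0) (U2 t' v1) = 0.
Proof.
rewrite (inner_corresp G2 O2 C2 (corr2_product_flow t vv0) (corr2_product_flow t' vv1)).
rewrite /inner (_ : (fun z => _) = fun=> 0) ?cint0//.
apply/funext => z; rewrite /ind !indicE.
have [zb|zb] := boolP (z \in below); last by rewrite !(mulr0, mul0r).
have /negP/negbTE -> : ~ z \in above.
  by move: zb; rewrite !inE /below /above/= => h1 h2; move: (lt_trans h1 h2); rewrite ltxx.
by rewrite !(mulr0, conjc0, rmorph0).
Qed.

Lemma dominated_sum_measure v s' : orth_constants PP v ->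
  spectral_measure_of PP U2 v s' -> s' `<< sum_measure.
Proof.
move=> ov sv; apply/null_content_dominatesP => A mA A0.
have [v2 _] := ov; have [v' cv] := corresp_ex G2 O2 v2.
have [_ v'2 _] := cv.
have F t : fourier s' setT t =
    cintegral ss setT (fun z => cexp (t * (z.1 + z.2)) * (nrm2 (v' z))%:C%C).
  rewrite -sv (inner_corresp G2 O2 C2 (corr2_product_flow t cv) cv).
  congr cintegral; apply/funext => z; rewrite -mulrA mulCJ; congr (_ * _).
  by rewrite /pair_chr /tensor /chr1/= mulrDr cexpD.
have := fourier_unique madd (L2_nrm2 v'2) F mA.
rewrite (_ : \int[ss]_z _ = 0); last first.
  rewrite (rint_ae (g := fun=> 0)) ?/Rintegral ?integral0//.
  - apply: measurable_funM; last exact: rintegrable_meas (L2_nrm2 v'2).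
    exact: (measurableT_comp (measurable_indic mA) madd).
  - apply: ae_imp (orth_constants_sum_measure mA A0 cv ov) => z h.
    rewrite indicE; have [zA|_] := boolP (_ \in A); last by rewrite mul0r.
    by rewrite h ?/nrm2/= ?expr0n/= ?addr0 ?mulr0//; move: zA; rewrite inE.
move=> e; have : s' A \is a fin_num by exact: fin_num_measure.
by move/fineK <-; rewrite e.
Qed.

(** Antisymmetry is applied to the conjugate of h' cut to each side of the diagonal. The two terms
    then have disjoint supports, so h' vanishes off the diagonal; on the diagonal only the origin
    matters, and f' is 0 there. *)
Lemma spanned_by_halves f : orth_constants PP f ->
  closed_span PP (orbit_of U2 v0 `|` orbit_of U2 v1) f.
Proof.
move=> [f2 f1].
have S2 : orbit_of U2 v0 `|` orbit_of U2 v1 `<=` L2 PP.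
  by move=> _ [[t _ <-]|[t _ <-]]; exact: L2_product_flow.
apply: (closed_span_dual S2 f2) => h h2 hort.
have [f' ff'] := corresp_ex G2 O2 f2; have [h' hh'] := corresp_ex G2 O2 h2.
have [_ f'2 _] := ff'; have [_ h'2 _] := hh'.
have d0 := corr2_orth_diag_ann vv0 hh' (fun t => hort _ (or_introl (ex_intro2 _ _ t I erefl))).
have d1 := corr2_orth_diag_ann vv1 hh' (fun t => hort _ (or_intror (ex_intro2 _ _ t I erefl))).
have f'0 := orth_constants_origin ff' f1.
rewrite (inner_corresp G2 O2 C2 ff' hh') -(@cint0 _ _ _ ss) /inner.
apply: cint_ae.
- by apply: cmeasurableM; [exact: L2_meas f'2|apply: cmeasurableJ; exact: L2_meas h'2].
- exact: cmeasurable_cst.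
have hz : {ae ss, forall z, z.1 <> z.2 -> h' z = 0}.
  apply: ae_imp2 (antisym d0) (antisym d1) => z; rewrite /ind !indicE => e0 e1 ne.
  have h'0 : (h' z)^* = 0.
    have [lt|gt|//] := ltgtP z.1 z.2.
      move: e0; rewrite mem_set// memNset /below/=; last by apply/negP; rewrite -leNgt ltW.
      by rewrite mul1r mul0r addr0.
    move: e1; rewrite mem_set// memNset /above/=; last by apply/negP; rewrite -leNgt ltW.
    by rewrite mul1r mul0r addr0.
  by apply/eqP; rewrite -conjC_eq0 h'0.
apply: ae_imp2 hz diagonal_null => z n1 n2.
have [e|ne] := eqVneq z.1 z.2; first by rewrite (n2 e) f'0 mul0r.
by rewrite n1 ?rmorph0 ?mulr0//; exact/eqP.
Qed.

(** For the constant multiplicity 2, the sets [mult_gt] are everything for n = 0 and 1 and empty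
    afterwards, hence the zero vectors from index 2 on. *)
Let half_vectors (n : nat) : X * X -> R[i] :=
  if n == 0%N then v0 else if n == 1%N then v1 else cst 0.

Lemma homogeneous_halves : homogeneous_spectrum PP U2 (orth_constants PP) 2.
Proof.
exists sum_measure, (fun=> Some 2%N); split; last by apply: aeW.
- split; first exact: dominated_sum_measure.
  exists v0, sum_measure; split; [exact: orth_v0|exact: corr_v0|by []].
- have L20 : L2 PP (cst 0 : X * X -> R[i]) by exact: L2_0.
  have i0l f : L2 PP f -> inner PP (cst 0) f = 0.
    by move=> f2; rewrite /inner (_ : (fun z => _) = fun=> 0) ?cint0//; apply/funext => z;
      rewrite mul0r.
  have i0r f : L2 PP f -> inner PP f (cst 0) = 0.
    by move=> f2; rewrite innerC// i0l// rmorph0.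
  have half2 n : L2 PP (half_vectors n) by rewrite /half_vectors; case: n => [|[|n]].
  split.
    move=> [|[|n]]; rewrite /mult_gt /=; first by rewrite set_true.
      by rewrite set_true.
    by rewrite set_false.
  exists half_vectors; split.
  + move=> [|[|n]]; [exact: orth_v0|exact: orth_v1|].
    by split; [exact: L20|apply: i0l; exact: (L2_cst PPfin)].
  + move=> [|[|n]] t; rewrite /mult_gt /=.
    * by rewrite set_true; exact: corr_v0.
    * by rewrite set_true; exact: corr_v1.
    * rewrite set_false /fourier /cintegral !Rintegral_set0.
      exact: i0r.
  + have cross n k t t' : (n < k)%N -> inner PP (U2 t (half_vectors n)) (U2 t' (half_vectors
    k)) = 0.
      case: k => [//|[|k]].
        by case: n => [_|//]; exact: mixed_v.
      by move=> _; apply: i0r; exact: L2_product_flow (half2 n).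
    move=> n k t t' nk; have [lt|gt|//] := ltngtP n k; first exact: cross.
    by rewrite innerC ?cross ?rmorph0//; exact: L2_product_flow.
  + move=> f of1 delta delta0; have [n [c [w [wS wd]]]] := spanned_by_halves of1 delta0.
    exists n, c, w; split => // i; case: (wS i) => [[t _ <-]|[t _ <-]].
      by exists 0%N => //; exists t.
    by exists 1%N => //; exists t.
Qed.

End MaximalType.

Theorem tensor_square_homogeneous : homogeneous_spectrum PP U2 (orth_constants PP) 2.
Proof. by have [v0 _ vv0] := below_ex; exact: (homogeneous_halves vv0). Qed.

End TensorSquare.

(** * Singularity of the convolution square *)

Section AddMeasure.
Context d (T : measurableType d) (R : realType).
Variables m1 m2 : {finite_measure set T -> \bar R}.

Definition add_measure : set T -> \bar R := measure_add m1 m2.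

HB.instance Definition _ := Measure.on add_measure.

Let add_measure_finite : fin_num_fun add_measure.
Proof.
apply: lty_fin_num_fun.
rewrite [ltLHS](_ : _ = (m1 setT + m2 setT)%E); last exact: measure_addE.
by rewrite lte_add_pinfty// finite_measure_lty.
Qed.

HB.instance Definition _ := Measure_isFinite.Build _ _ _ add_measure add_measure_finite.

Lemma rint_add_measure (g : T -> R) C : measurable_fun setT g -> (forall x, `|g x| <= C) ->
  \int[add_measure]_x g x = \int[m1]_x g x + \int[m2]_x g x.
Proof.
move=> mg gC.
have i1 := rintegrable_bounded (finite_measure_lty m1) mg gC.
have i2 := rintegrable_bounded (finite_measure_lty m2) mg gC.
rewrite /Rintegral integral_measure_add// fineD//; exact: integrable_fin_num.
Qed.

(** For rho the sum of the two measures and f the Radon-Nikodym derivative of the first one, the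
    second one has density 1 - f. *)
Lemma joint_density : exists (rho : {finite_measure set T -> \bar R}) (f : T -> R),
  rintegrable rho f /\
  forall (g : T -> R) C, measurable_fun setT g -> (forall x, `|g x| <= C) ->
    \int[m1]_x g x = \int[rho]_x (g x * f x) /\
    \int[m2]_x g x = \int[rho]_x (g x * (1 - f x)).
Proof.
pose rho : {finite_measure set T -> \bar R} := add_measure.
have dom : m1 `<< rho.
  apply/null_content_dominatesP => A mA.
  move=> h; have : (m1 A + m2 A = 0)%E by rewrite -h; exact/esym/measure_addE.
  move/eqP.
  by rewrite padde_eq0// => /andP[/eqP].
pose D := Radon_Nikodym (charge_of_finite_measure m1) rho.
have Dfin x : D x \is a fin_num by exact: Radon_Nikodym_fin_num.
have Di : rho.-integrable setT D by exact: Radon_Nikodym_integrable.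
pose f x := fine (D x); have fD : EFin \o f = D by apply/funext => x; rewrite /= fineK.
have fi : rintegrable rho f by rewrite /rintegrable fD.
exists rho, f; split => // g C mg gC.
have i1 := rintegrable_bounded (finite_measure_lty m1) mg gC.
have e1 : \int[m1]_x g x = \int[rho]_x (g x * f x).
  rewrite /Rintegral -(Radon_Nikodym_change_of_variables dom measurableT i1).
  by congr fine; apply: eq_integral => x _; rewrite /= EFinM /f fineK.
split => //.
have gi := rintegrable_bounded (finite_measure_lty rho) mg gC.
have gfi : rintegrable rho (fun x => g x * f x).
  apply: (le_rintegrable _ _ (rintegrableZ C (rintegrable_norm fi))).
    by apply: measurable_funM => //; exact: rintegrable_meas fi.
  by move=> x; rewrite normrM ler_wpM2r.
have -> : \int[rho]_x (g x * (1 - f x)) = \int[rho]_x (g x - g x * f x).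
  by apply: eq_Rintegral => x _; rewrite mulrBr mulr1.
by rewrite rintB// -e1 /rho (rint_add_measure mg gC) addrC addKr.
Qed.

End AddMeasure.

Section ConvolutionSingular.
Context (R : realType).
Local Notation MR := (measurableTypeR R).
Variables (s : {finite_measure set MR -> \bar R}) (eps : R).
Hypotheses (eps0 : 0 < eps) (eps1 : eps < 1).
Hypothesis weak_limits : forall a, 0 < a -> exists t_ : nat -> R,
  forall g, cintegrable s g ->
    weak_lim s (fun n x => cexp (t_ n * x)) (fun x => eps%:C%C * psi (a * x)) g.
Local Notation ss := (s \x s)%E.

Let ssfin : (ss setT < +oo)%E := finite_prod_lty s s.

Let madd : measurable_fun setT (fun z : MR * MR => z.1 + z.2 : MR).
Proof. exact: measurable_funD. Qed.

Definition conv_measure : {finite_measure set MR -> \bar R} :=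
  @image_measure _ _ _ MR R (mfrestr measurableT ssfin) _ madd.

Lemma conv_measureE A : conv_measure A = convolution s s A.
Proof. by rewrite /conv_measure /= /image_measure /pushforward /mfrestr /mrestr setIT. Qed.

Lemma cint_conv_measure (g : MR -> R[i]) : cintegrable conv_measure g ->
  cintegral conv_measure setT g = cintegral ss setT (fun z => g (z.1 + z.2)).
Proof.
move=> gi; have mg := cintegrable_meas gi.
rewrite -(@cint_mp _ _ (MR * MR)%type MR R (mfrestr measurableT ssfin)
    conv_measure _ madd (fun A _ => erefl) g gi).
rewrite cint_mfrestr; last exact: (cmeasurable_mp madd mg).
by congr cintegral; apply/funext => z; rewrite indicT mul1r.
Qed.

Let mexp (t : R) : cmeasurable (fun x : MR => cexp (t * x)).
Proof. by apply: cmeasurable_cexp; exact: measurable_funM. Qed.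

Let psia (a : R) (x : MR) : R[i] := eps%:C%C * psi (a * x).

Let mpsia a : cmeasurable (psia a).
Proof.
apply: cmeasurableM; first exact: cmeasurable_cst.
by apply: cmeasurable_psi; exact: measurable_funM.
Qed.

Let psia1 a x : nrm2 (psia a x) <= 1.
Proof.
by rewrite nrm2M nrm2_real mulr_ile1 ?nrm2_ge0 ?sqr_ge0 ?nrm2_psi_le1// exprn_ile1// ltW.
Qed.

Let psia_cvg x : ccvg (fun n => psia n.+1%:R^-1 x) eps%:C%C.
Proof. by rewrite -[X in ccvg _ X]mulr1; apply: ccvgM; [exact: ccvg_cst|exact: psi_cvg]. Qed.

(* As [a -> 0] the limit operator becomes [eps] on [L_2(s)] but [eps ^+ 2] on
   [L_2(s * s)], so nothing nonzero can be integrated alike against both. *)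
Lemma no_common_part (g1 g2 : MR -> R) C : measurable_fun setT g1 -> measurable_fun setT g2 ->
  (forall x, `|g1 x| <= C) -> (forall x, `|g2 x| <= C) ->
  (forall t, cintegral s setT (fun x => cexp (t * x) * (g1 x)%:C%C) =
     cintegral conv_measure setT (fun x => cexp (t * x) * (g2 x)%:C%C)) ->
  \int[s]_x g1 x = 0.
Proof.
move=> mg1 mg2 g1C g2C E.
have i1 : cintegrable s (fun x => (g1 x)%:C%C).
  apply: (cintegrable_real (finite_measure_lty s)).
  exact: (rintegrable_bounded (finite_measure_lty s) mg1 g1C).
have i2 : cintegrable conv_measure (fun x => (g2 x)%:C%C).
  apply: (cintegrable_real (finite_measure_lty conv_measure)).
  exact: (rintegrable_bounded (finite_measure_lty conv_measure) mg2 g2C).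
have i2' : cintegrable ss (fun z => (g2 (z.1 + z.2))%:C%C).
  apply: (cintegrable_real ssfin); apply: (rintegrable_bounded ssfin (C := C)) => //.
  exact: (measurableT_comp mg2 madd).
have ie t : cintegrable conv_measure (fun x => cexp (t * x) * (g2 x)%:C%C).
  by apply: (cintegrable_bM (C := 1)) i2 => // x; rewrite nrm2_cexp.
have step a : 0 < a -> cintegral s setT (fun x => psia a x * (g1 x)%:C%C) =
    cintegral ss setT (fun z => psia a z.1 * psia a z.2 * (g2 (z.1 + z.2))%:C%C).
  move=> a0; have [t_ tw] := weak_limits a0.
  have e1 n (x : MR) : nrm2 (cexp (t_ n * x)) <= 1 by rewrite nrm2_cexp.
  have w1 := tw _ i1.
  have w2 := @weak_lim_tensor _ _ _ s (fun n x => cexp (t_ n * x)) (psia a)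
    (fun n => mexp (t_ n)) (mpsia a) e1 (psia1 a) tw _ i2'.
  apply: (ccvg_unique w1); move: w2; congr (ccvg _ _); apply/funext => n.
  rewrite E cint_conv_measure//; congr cintegral; apply/funext => z.
  by rewrite mulrDr cexpD.
have lim1 := cint_dominated_cvg i1 (fun n => mpsia n.+1%:R^-1) (cmeasurable_cst _ eps%:C%C)
  (fun n => psia1 n.+1%:R^-1) psia_cvg.
have lim2 : ccvg (fun n => cintegral ss setT
    (fun z => psia n.+1%:R^-1 z.1 * psia n.+1%:R^-1 z.2 * (g2 (z.1 + z.2))%:C%C))
    (cintegral ss setT (fun z => eps%:C%C * eps%:C%C * (g2 (z.1 + z.2))%:C%C)).
  apply: (cint_dominated_cvg (w_ := fun n z => psia n.+1%:R^-1 z.1 * psia n.+1%:R^-1 z.2)) => //.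
  - by move=> n; exact: (cmeasurable_tensor (mpsia _) (mpsia _)).
  - by move=> n z; rewrite nrm2M mulr_ile1 ?nrm2_ge0.
  - by move=> z; apply: ccvgM; exact: psia_cvg.
have lim1' : (fun n => cintegral s setT (fun x => psia n.+1%:R^-1 x * (g1 x)%:C%C)) =
  (fun n => cintegral ss setT
    (fun z => psia n.+1%:R^-1 z.1 * psia n.+1%:R^-1 z.2 * (g2 (z.1 + z.2))%:C%C)).
  by apply/funext => n; apply: step; rewrite invr_gt0.
rewrite lim1' in lim1; have := ccvg_unique lim1 lim2.
rewrite cintZ// cintZ// -(cint_conv_measure i2).
have E0 := E 0.
have e0 (m : {finite_measure set MR -> \bar R}) (g : MR -> R) :
    cintegral m setT (fun x => cexp (0 * x) * (g x)%:C%C) = cintegral m setT (fun x =>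
      (g x)%:C%C).
  by congr cintegral; apply/funext => x; rewrite mul0r cexp0 mul1r.
rewrite !e0 in E0; rewrite -E0 => /(congr1 (@complex.Re R)).
rewrite /cintegral/= !(mul0r, mulr0, subr0, addr0).
set I := \int[s]_x _ => h.
have : eps * (1 - eps) * I = 0 by rewrite mulrBr mulr1 mulrBl h subrr.
by move/eqP; rewrite !mulf_eq0 gt_eqF//= subr_eq0 gt_eqF//= => /eqP.
Qed.

(** The densities being f and 1 - f, the function 1 - f against s and the function f against the
    convolution define the same measure, of density f(1 - f). This common part vanishes, so f takes
    only the values 0 and 1 up to a null set, and the set where f <= 0 separates the measures. *)
Theorem singular_conv_measure : exists A, [/\ measurable A,
  s A = 0%E & conv_measure (~` A) = 0%E].
Proof.
have [rho [f [fi fE]]] := joint_density s conv_measure.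
have mf := rintegrable_meas fi.
have mI (i : interval R) : measurable (f @^-1` [set` i]).
  by rewrite -[X in measurable X]setTI; apply: mf => //; exact: measurable_itv.
(* The density is known to be an integrable function, with no pointwise bounds; cutting to the set
   where it lies in [0, 1] makes the multipliers bounded and nonnegative. *)
pose B := f @^-1` `[0, 1]%classic; have mB : measurable B by exact: mI.
pose g1 x : R := \1_B x * (1 - f x); pose g2 x : R := \1_B x * f x.
have Bcase x : (\1_B x = 1 :> R /\ 0 <= f x <= 1) \/ \1_B x = 0 :> R.
  by rewrite indicE; have [|_] := boolP (x \in B); [rewrite inE /B/= in_itv/=; left|right].
have b1 x : 0 <= g1 x <= 1.
  by rewrite /g1; case: (Bcase x) => [[-> /andP[? ?]]| ->]; rewrite ?mul0r ?lexx ?ler01// mul1r;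
    apply/andP; split; lra.
have b2 x : 0 <= g2 x <= 1.
  by rewrite /g2; case: (Bcase x) => [[-> /andP[? ?]]| ->]; rewrite ?mul0r ?lexx ?ler01// mul1r;
    apply/andP; split; lra.
have nb (g : MR -> R) x : 0 <= g x <= 1 -> `|g x| <= 1 by move=> /andP[? ?]; rewrite ger0_norm.
have mB1 : measurable_fun setT (\1_B : MR -> R) by exact: measurable_indic.
have mg1 : measurable_fun setT g1 by apply: measurable_funM => //; exact: measurable_funB.
have mg2 : measurable_fun setT g2 by exact: measurable_funM.
have I0 : \int[s]_x g1 x = 0.
  apply: (no_common_part mg1 mg2 (C := 1)) => [x|x|t]; try exact: nb.
  have tr (c : MR -> R) : measurable_fun setT c -> (forall x, `|c x| <= 1) ->
      \int[s]_x (c x * g1 x) = \int[conv_measure]_x (c x * g2 x).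
    move=> mc c1.
    have h1 x : `|c x * g1 x| <= 1 by rewrite normrM mulr_ile1// nb.
    have h2 x : `|c x * g2 x| <= 1 by rewrite normrM mulr_ile1// nb.
    have [-> _] := fE _ _ (measurable_funM mc mg1) h1.
    have [_ ->] := fE _ _ (measurable_funM mc mg2) h2.
    by apply: eq_Rintegral => x _; rewrite /= /g1 /g2; ring.
  have mt : measurable_fun setT (fun x : MR => t * x) by exact: measurable_funM.
  have trc := tr _ (measurableT_comp (continuous_measurable_fun (@continuous_cos R)) mt)
    (fun x => norm_cos_le1 _).
  have trs := tr _ (measurableT_comp (continuous_measurable_fun (@continuous_sin R)) mt)
    (fun x => norm_sin_le1 _).
  apply: cplx_eq; rewrite /cintegral/=.
    transitivity (\int[s]_x (cos (t * x) * g1 x)).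
      by apply: eq_Rintegral => x _; rewrite mulr0 subr0.
    rewrite trc; apply: eq_Rintegral => x _.
    by rewrite mulr0 subr0.
  transitivity (\int[s]_x (sin (t * x) * g1 x)).
    by apply: eq_Rintegral => x _; rewrite mulr0 add0r.
  rewrite trs; apply: eq_Rintegral => x _.
  by rewrite mulr0 add0r.
have g1f0 : {ae rho, forall x, g1 x * f x = 0}.
  have g1f x : 0 <= g1 x * f x <= 1.
    by rewrite /g1; case: (Bcase x) => [[-> /andP[? ?]]| ->]; rewrite ?mul0r ?lexx ?ler01// mul1r;
      apply/andP; split; nra.
  apply: rint_ge0_eq0.
  - apply: (rintegrable_bounded (finite_measure_lty rho) (C := 1)) => [|x].
      exact: measurable_funM.
    exact: (nb (fun x => g1 x * f x)).
  - by move=> x; case/andP: (g1f x).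
  - by have [<- _] := fE _ _ mg1 (fun x => nb _ _ (b1 x)).
have iM (A : set MR) (w : MR -> R) : measurable A -> rintegrable rho w ->
    rintegrable rho (fun x => \1_A x * w x).
  move=> mA wi; apply: (le_rintegrable _ _ (rintegrable_norm wi)).
    by apply: measurable_funM; [exact: measurable_indic|exact: rintegrable_meas wi].
  by move=> x; rewrite normrM ler_piMl// indic_le1.
have i1f : rintegrable rho (fun x => 1 - f x).
  by apply: rintegrableB => //; apply: rintegrable_cst; exact: finite_measure_lty.
have null (m : {finite_measure set MR -> \bar R}) A (w : MR -> R) : measurable A ->
    \int[m]_x (\1_A x : R) = \int[rho]_x w x -> rintegrable rho w -> (forall x, w x <= 0) ->
    m A = 0%E.
  move=> mA e wi w0; have h : \int[rho]_x w x <= \int[rho]_x (fun=> 0 : R) x.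
    by apply: le_rint => //; apply: rintegrable_cst; exact: finite_measure_lty.
  have mA0 : fine (m A) = 0.
    apply/eqP; rewrite eq_le fine_ge0// andbT.
    move: h; rewrite -e {1}/Rintegral integral_indic// setIT => /le_trans; apply.
    by rewrite /Rintegral integral0.
  by rewrite -(fineK (fin_num_measure m _ mA)) mA0.
pose A := f @^-1` `]-oo, 0]%classic; have mA : measurable A by exact: mI.
exists A; split => //.
  apply: (null s A (fun x => \1_A x * f x)) => //; last 2 first.
  - exact: iM.
  - move=> x; rewrite indicE; have [|_] := boolP (x \in A); last by rewrite mul0r.
    by rewrite inE /A/= in_itv/= mul1r.
  by have [] := fE (\1_A) 1 (measurable_indic mA) (fun x => indic_le1 _ _ x).
(* Where f > 0, vanishing of the common part leaves only points with f >= 1 up to a null set, and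
   there the density 1 - f is nonpositive. *)
pose E := f @^-1` `[1, +oo[%classic; have mE : measurable E by exact: mI.
have mCA : measurable (~` A) by exact: measurableC.
apply: (null conv_measure (~` A) (fun x => \1_E x * (1 - f x))) => //; last 2 first.
- exact: iM.
- move=> x; rewrite indicE; have [|_] := boolP (x \in E); last by rewrite mul0r.
  by rewrite inE /E/= in_itv/= andbT mul1r subr_le0.
have [_ ->] := fE (\1_(~` A)) 1 (measurable_indic mCA) (fun x => indic_le1 _ _ x).
apply: rint_ae.
- exact: rintegrable_meas (iM _ _ mCA i1f).
- exact: rintegrable_meas (iM _ _ mE i1f).
- apply: ae_imp g1f0 => x; rewrite /g1 !indicE in_setC.
  have -> : (x \in A) = (f x <= 0) by apply/idP/idP; rewrite inE /A/= in_itv.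
  have -> : (x \in E) = (1 <= f x) by apply/idP/idP; rewrite inE /E/= in_itv/= andbT.
  have -> : (x \in B) = (0 <= f x <= 1) by apply/idP/idP; rewrite inE /B/= in_itv.
  rewrite -ltNge; have [f0|f0] := ltP 0 (f x); have [f1|f1] := leP 1 (f x) => //=.
  + rewrite (ltW f0) (ltW f1)/= mul1r => /eqP; rewrite mulf_eq0 (gt_eqF f0) orbF => /eqP ->.
    by rewrite !mulr0.
  + by move: (le_trans f1 f0); rewrite ler10.
Qed.

End ConvolutionSingular.

(** A null set of the product has null sections almost everywhere. Domination is used on each
    section for one factor, and then on the exceptional set of sections for the other. *)
Lemma convolution_null (R : realType)
  (m1 m2 : {finite_measure set (measurableTypeR R) -> \bar R}) A : measurable A ->
  m1 `<< m2 -> convolution m2 m2 A = 0%E -> convolution m1 m1 A = 0%E.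
Proof.
move=> mA /null_content_dominatesP dom; rewrite /convolution /pushforward.
set N := _ @^-1` A.
have mN : measurable (N : set (measurableTypeR R * measurableTypeR R)).
  rewrite -[X in measurable X]setTI.
  have h : measurable_fun setT (fun z : measurableTypeR R * measurableTypeR R =>
    z.1 + z.2 : measurableTypeR R) by exact: measurable_funD.
  exact: h.
have sec (m m' : {finite_measure set (measurableTypeR R) -> \bar R}) :
    (m \x m')%E N = 0%E <-> {ae m, forall x, m' (xsection N x) = 0%E}.
  have mx : measurable_fun setT (m' \o xsection N) by exact: measurable_fun_xsection.
  have -> : (m \x m')%E N = (\int[m]_x `|(m' \o xsection N) x|)%E.
    by apply: eq_integral => x _; rewrite gee0_abs.
  rewrite (ae_eq_integral_abs m measurableT mx); split.
    by apply: ae_imp => x; exact.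
  by apply: ae_imp => x xN _.
move=> /sec h; apply/sec.
have : {ae m2, forall x, m1 (xsection N x) = 0%E}.
  by apply: ae_imp h => x; apply: dom; exact: measurable_xsection.
move=> [K [mK K0 KN]]; exists K; split => //; exact: dom.
Qed.

(** The maximal type is dominated by the spectral measure s of one vector v orthogonal to the
    constants. For v the projection [Theta] contributes nothing, so theta is 0 and the limit symbol
    is eps psi; the set separating s from its convolution square serves for sigma. *)
Theorem spectral_type_singular d (X : measurableType d) (R : realType) (P : probability X R)
  (T : R -> X -> X) (eps : R) : 0 < eps -> eps < 1 -> measure_preserving_flow P T ->
  (forall a : R, 0 < a -> exists2 J, flow_integral P T a J &
     weak_closure P (koopman T)
       (fun f x => (1 - eps)%:C%C * Theta P f x + (eps / a)%:C%C * J f x)) ->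
  forall sigma : {finite_measure set (measurableTypeR R) -> \bar R},
    maximal_spectral_type P (koopman T) (orth_constants P) sigma ->
    mutually_singular sigma (convolution sigma sigma).
Proof.
move=> eps0 eps1 flow limits sigma [_ [v [s [[v2 v1] vs dom]]]].
have symE a (x : measurableTypeR R) :
    mixed_symbol eps (fun=> 0) a x = eps%:C%C * psi (a * x).
  by rewrite /mixed_symbol rmorph0 mulr0 add0r.
have lim a : 0 < a -> exists t_ : nat -> R, forall g, cintegrable s g ->
    weak_lim s (fun n x => cexp (t_ n * x)) (fun x => eps%:C%C * psi (a * x)) g.
  have h1 q : cintegral s setT (fun x => ((0 : R)%:C)%C * cexp (q * x)) =
      (nrm2 (inner P v (cst 1)))%:C%C.
    rewrite v1 (_ : (fun x => _) = fun=> 0) ?cint0; first by rewrite /nrm2/= expr0n addr0.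
    by apply/funext => x; rewrite rmorph0 mul0r.
  have h2 (x : measurableTypeR R) : 0 <= (0 : R) <= 1 by rewrite lexx ler01.
  have h3 b x : nrm2 (mixed_symbol eps (fun=> 0) b x) <= 1.
    rewrite symE nrm2M nrm2_real mulr_ile1 ?nrm2_ge0 ?sqr_ge0 ?nrm2_psi_le1//.
    by rewrite exprn_ile1// ltW.
  have m0 : measurable_fun setT (fun _ : measurableTypeR R => 0 : R) by exact: measurable_cst.
  move=> a0; have [t_ tP] := weak_limits_ex flow limits v2 vs m0 h1 h2 h3 a0.
  have symF : mixed_symbol eps (fun=> 0) a = (fun x => eps%:C%C * psi (a * x)).
    by apply/funext => x; exact: symE.
  by rewrite symF in tP; exists t_.
have [A [mA sA cA]] := singular_conv_measure eps0 eps1 lim.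
exists A; split => //; first by move/null_content_dominatesP : dom; exact.
apply: (convolution_null (m2 := s)) => //; first exact: measurableC.
by rewrite -conv_measureE.
Qed.

Theorem theorem1 (R : realType) (d : measure_display) (X : measurableType d)
    (P : probability X R) (T : R -> X -> X) (eps : R) :
  0 < eps -> eps < 1 ->
  standard_probability P ->
  measure_preserving_flow P T ->
  ergodic_flow P T ->
  simple_spectrum P (koopman T) (L2 P) ->
  (forall a : R, 0 < a ->
     exists2 J, flow_integral P T a J &
       weak_closure P (koopman T)
         (fun f x => (1 - eps)%:C%C * Theta P f x + (eps / a)%:C%C * J f x)) ->
  [/\ forall sigma : {finite_measure set (measurableTypeR R) -> \bar R},
        maximal_spectral_type P (koopman T) (orth_constants P) sigma ->
        mutually_singular sigma (convolution sigma sigma),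
      simple_spectrum (P \x P)%E (koopman (product_flow T)) (symmetric_L2 P)
    & homogeneous_spectrum (P \x P)%E (koopman (product_flow T))
        (orth_constants (P \x P)%E) 2].
Proof.
move=> eps0 eps1 _ flow _ [u u2 ucyc] limits.
have [s us] := spectral_measure_ex flow u2; split.
- exact: (spectral_type_singular eps0 eps1 flow limits).
- exact: (symmetric_square_simple flow eps0 eps1 limits u2 ucyc us).
- exact: (tensor_square_homogeneous flow eps0 eps1 limits u2 ucyc us).
Qed.
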